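(* Let $2\leq s<\infty$ be an integer, let $\{3,4,3\}$ denote the 24-cell, and let $\rho_0,\dots,\rho_4$ be the distinguished generators of $G(2^{\{3,4,3\},\mathcal{G}(s)})$. Put $\tilde{\rho}_0:=\rho_0\rho_1\rho_0$ and $H:=H(2^{\{3,4,3\},\mathcal{G}(s)})=\langle\tilde{\rho}_0,\rho_1,\rho_2,\rho_3,\rho_4\rangle$. Then the incidence system $\mathcal{H}(2^{\{3,4,3\},\mathcal{G}(s)})=\Gamma(H;(H_i)_{i\in\{0,\dots,4\}})$ is a regular hypertope and its automorphism group $H$, of order $576\cdot(2s)^{12}$, is defined on the generators $\tilde{\rho}_0,\rho_1,\rho_2,\rho_3,\rho_4$ by the Coxeter relations $$\tilde{\rho}_0^2=\rho_1^2=\rho_2^2=\rho_3^2=\rho_4^2=(\tilde{\rho}_0\rho_2)^3=(\rho_1\rho_2)^3=(\rho_2\rho_3)^4=(\rho_3\rho_4)^3=id,$$ with all other pairs of distinct generators commuting, and the extra relations $$(\tilde{\beta}^{-i}\beta^i)^2=id\ \text{ for } i\in\{3,4\},\quad\text{and}\quad(\tilde{\beta}^6\beta^6)^s=id,$$ where $\beta:=\rho_1\rho_2\rho_3\rho_4$ and $\tilde{\beta}:=\tilde{\rho}_0\rho_2\rho_3\rho_4$. Moreover, its toroidal residue is $\left\{{3\atop 3},4\right\}_{(4,0,0)}$.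
   Context: C-groups and polytopes: a C-group of rank $m$ is a group $G$ with generating involutions $\rho_0,\dots,\rho_{m-1}$ satisfying $\langle\rho_i\mid i\in I\rangle\cap\langle\rho_j\mid j\in J\rangle=\langle\rho_k\mid k\in I\cap J\rangle$ for all $I,J\subseteq\{0,\dots,m-1\}$; it is a string C-group if $(\rho_i\rho_j)^2=id$ whenever $|i-j|\geq 2$. Abstract regular polytopes $\mathcal{P}$ of rank $m$ are in one-to-one correspondence with string C-groups $G(\mathcal{P})$ of rank $m$: the $i$-faces are the right cosets of $\langle\rho_j\mid j\neq i\rangle$, and vertices are the $0$-faces. Construction of $2^{\mathcal{P},\mathcal{G}(s)}$: let $\mathcal{P}$ be a centrally symmetric regular $n$-polytope with group $G(\mathcal{P})=\langle\tau_0,\dots,\tau_{n-1}\rangle$, i.e. $G(\mathcal{P})$ has a proper central involution $\alpha$ fixing no vertex. Let $F_0$ be the base vertex, stabilized by $\langle\tau_1,\dots,\tau_{n-1}\rangle$. Let $W$ be the Coxeter group generated by involutions $\sigma_F$, one for each vertex $F$ of $\mathcal{P}$, with defining relations $\sigma_F^2=id$, $(\sigma_F\sigma_{F\alpha})^s=id$, and $(\sigma_F\sigma_{F'})^2=id$ for $F'\notin\{F,F\alpha\}$. The group $G(\mathcal{P})$ acts on $W$ by $\tau^{-1}\sigma_F\tau=\sigma_{F\tau}$. Then $2^{\mathcal{P},\mathcal{G}(s)}$ is the regular $(n+1)$-polytope with group $G(2^{\mathcal{P},\mathcal{G}(s)}):=W\rtimes G(\mathcal{P})=\langle\rho_0,\dots,\rho_n\rangle$,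 where $\rho_0:=\sigma_{F_0}$ and $\rho_i:=\tau_{i-1}$ for $1\leq i\leq n$. For the 24-cell, $G(\mathcal{P})$ is the Coxeter group $[3,4,3]$ of order $1152$, there are $24$ vertices, and $\alpha=(\tau_0\tau_1\tau_2\tau_3)^6$. Hypertopes and halving: for a group $H$ with subgroups $(H_i)_{i\in I}$, $\Gamma(H;(H_i)_{i\in I})$ is the incidence system whose elements of type $i$ are the right cosets of $H_i$, two elements being incident iff the cosets intersect. A flag is a set of pairwise incident elements and a chamber is a flag containing an element of every type. A regular hypertope is an incidence system in which every flag lies in a chamber (a geometry) and which is thin (every flag missing exactly one type lies in exactly two chambers), residually connected (every residue of rank at least $2$ has connected incidence graph) and flag-transitive (type-preserving automorphisms are transitive on flags of each given type). Its automorphism group here means the group of type-preserving automorphisms. For a regular $(n+1)$-polytope with group $\langle\rho_0,\dots,\rho_n\rangle$, the halving group is $\langle\tilde{\rho}_0,\rho_1,\dots,\rho_n\rangle$ with $\tilde{\rho}_0=\rho_0\rho_1\rho_0$; $H_i$ is the subgroup generated by all these generators except the $i$-th one ($\tilde{\rho}_0$ being number $0$). The toroidal residue is the rank $4$ residue with group $\langle\tilde{\rho}_0,\rho_1,\rho_2,\rho_3\rangle$. The regular toroidal hypertope $\left\{{3\atop 3},4\right\}_{(4,0,0)}$ is the coset hypertope (with respect to its maximal parabolic subgroups) of the group with generators $\tilde{\rho}_0,\rho_1,\rho_2,\rho_3$ and defining relations $\tilde{\rho}_0^2=\rho_1^2=\rho_2^2=\rho_3^2=(\tilde{\rho}_0\rho_2)^3=(\rho_1\rho_2)^3=(\rho_2\rho_3)^4=(\tilde{\rho}_0\rho_1)^2=(\tilde{\rho}_0\rho_3)^2=(\rho_1\rho_3)^2=(\tilde{\rho}_0\rho_2\rho_3\rho_2\rho_1)^4=id$.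 *)

(* Defs.v *)
From HB Require Import structures.
From mathcomp Require Import all_boot.
From mathcomp Require Import boolp classical_sets functions cardinality.
From Stdlib Require Import Relation_Operators.

Set Implicit Arguments.
Unset Strict Implicit.
Unset Printing Implicit Defensive.

Local Open Scope classical_set_scope.
Local Open Scope group_scope.
Local Open Scope quotient_scope.

Section Subgroups.
Variable G : groupType.
Implicit Types (A H K : set G) (g : G).

Definition is_subgroup H := H 1 /\ forall x y, H x -> H y -> H (x / y).

Definition gen A : set G := smallest is_subgroup A.

Definition rcoset H g : set G := [set h * g | h in H].

Definition rcosets H K : set (set G) := [set rcoset K g | g in H].

Lemma rcosetM A g h : rcoset (rcoset A g) h = rcoset A (g * h).
Proof.
apply/seteqP; split => x /=.
  by case=> _ [a Aa <-] <-; exists a => //; rewrite mulgA.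
by case=> a Aa <-; exists (a * g); [exists a | rewrite mulgA].
Qed.

Lemma rcoset1 A : rcoset A 1 = A.
Proof.
apply/seteqP; split => x /=; first by case=> a Aa <-; rewrite mulg1.
by move=> Ax; exists x => //; rewrite mulg1.
Qed.

End Subgroups.

(* A letter [(x, false)] stands for the generator [x], and [(x, true)] for its
   formal inverse. *)
Definition word (X : Type) := seq (X * bool).

Section Presentations.
Variable X : choiceType.
Implicit Types (u v w : word X) (x : X).

Definition winv w : word X := rev [seq (l.1, ~~ l.2) | l <- w].

Definition wexp w n : word X := flatten (nseq n w).

(* [weq R u v]: the words [u] and [v] represent the same element of the group
   with relators [R], i.e. they differ in the free group by an element of the
   normal closure of [R]. *)
Inductive weq (R : word X -> Prop) : word X -> word X -> Prop :=
| weq_refl w : weq R w w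
| weq_sym u v : weq R u v -> weq R v u
| weq_trans u v w : weq R u v -> weq R v w -> weq R u w
| weq_cancel u v x b : weq R (u ++ [:: (x, b), (x, ~~ b) & v]) (u ++ v)
| weq_rel u v r : R r -> weq R (u ++ r ++ v) (u ++ v).

Definition weval (G : groupType) (f : X -> G) w : G :=
  \prod_(l <- w) (if l.2 then (f l.1)^-1 else f l.1).

(* The subgroup generated by the [f x] is defined, on these generators, by the
   relators [R]. *)
Definition presented_by (G : groupType) (f : X -> G) (R : word X -> Prop) :=
  forall w, weval f w = 1 <-> weq R w [::].

Section WordCongruence.
Variable R : word X -> Prop.

Lemma weq_ctx a b u v : weq R u v -> weq R (a ++ u ++ b) (a ++ v ++ b).
Proof.
elim=> {u v} [w|u v _|u v w _ IH1 _|u v x c|u v r Rr].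
- exact: weq_refl.
- exact: weq_sym.
- exact: (weq_trans IH1).
- have := weq_cancel R (a ++ u) (v ++ b) x c.
  by rewrite -?catA /= -?catA.
- have := weq_rel (a ++ u) (v ++ b) Rr.
  by rewrite -!catA.
Qed.

Lemma weq_cat u u' v v' : weq R u u' -> weq R v v' -> weq R (u ++ v) (u' ++ v').
Proof.
move=> uu' vv'; apply: weq_trans (weq_ctx [::] v uu') _.
by have := weq_ctx u' [::] vv'; rewrite !cats0.
Qed.

Lemma winvK : involutive winv.
Proof.
move=> w; rewrite /winv map_rev revK -map_comp -[RHS]map_id.
by apply: eq_map => -[x b] /=; rewrite negbK.
Qed.

Lemma winv_cat u v : winv (u ++ v) = winv v ++ winv u.
Proof. by rewrite /winv map_cat rev_cat. Qed.

Lemma weq_mulV w : weq R (w ++ winv w) [::].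
Proof.
elim: w => [|[x b] w IH]; first exact: weq_refl.
have -> : (x, b) :: w = [:: (x, b)] ++ w by [].
rewrite winv_cat; apply: weq_trans (weq_cancel R [::] [::] x b).
by have := weq_ctx [:: (x, b)] (winv [:: (x, b)]) IH; rewrite /= -!catA.
Qed.

Lemma weq_inv u v : weq R u v -> weq R (winv u) (winv v).
Proof.
move=> uv; apply: weq_trans (_ : weq R _ (winv u ++ v ++ winv v)) _.
  apply: weq_sym; have := weq_ctx (winv u) [::] (weq_mulV v).
  by rewrite !cats0.
apply: weq_trans (_ : weq R _ (winv u ++ u ++ winv v)) _.
  exact/weq_ctx/weq_sym.
have := weq_ctx [::] (winv v) (weq_mulV (winv u)).
by rewrite winvK -!catA.
Qed.

Definition weqb : rel (word X) := fun u v => `[< weq R u v >].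

Lemma weqb_equiv : equiv_class_of weqb.
Proof.
split=> [u|u v|v u w]; first exact/asboolP/weq_refl.
  by apply/asboolP/asboolP; apply: weq_sym.
by move=> /asboolP uv /asboolP vw; apply/asboolP/(weq_trans uv).
Qed.

Canonical weqb_equiv_rel := EquivRelPack weqb_equiv.

Definition presented_group := {eq_quot weqb}.

HB.instance Definition _ := Choice.on presented_group.
HB.instance Definition _ := Quotient.on presented_group.

Local Notation cl w := (\pi_presented_group w).

Lemma clP u v : cl u = cl v <-> weq R u v.
Proof. by split=> [/eqmodP /asboolP|uv]; last exact/eqmodP/asboolP. Qed.

Lemma clW (Q : presented_group -> Prop) : (forall w, Q (cl w)) -> forall a, Q a.
Proof. by move=> Qcl a; rewrite -[a]reprK; apply: Qcl. Qed.

Lemma weq_repr w : weq R (repr (cl w)) w.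
Proof. by apply/clP; rewrite reprK. Qed.

Definition pmul (a b : presented_group) := cl (repr a ++ repr b).
Definition pinv (a : presented_group) := cl (winv (repr a)).

Lemma pmul_cl u v : pmul (cl u) (cl v) = cl (u ++ v).
Proof. by apply/clP/weq_cat; apply: weq_repr. Qed.

Lemma pinv_cl u : pinv (cl u) = cl (winv u).
Proof. exact/clP/weq_inv/weq_repr. Qed.

Lemma pmulA : associative pmul.
Proof.
by elim/clW=> u; elim/clW=> v; elim/clW=> w; rewrite !pmul_cl catA.
Qed.

Lemma pmul1 : left_id (cl [::]) pmul.
Proof. by elim/clW=> u; rewrite pmul_cl. Qed.

Lemma p1mul : right_id (cl [::]) pmul.
Proof. by elim/clW=> u; rewrite pmul_cl cats0. Qed.

Lemma pmulV : right_inverse (cl [::]) pinv pmul.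
Proof. by elim/clW=> u; rewrite pinv_cl pmul_cl; apply/clP/weq_mulV. Qed.

Lemma pmulV' : left_inverse (cl [::]) pinv pmul.
Proof.
elim/clW=> u; rewrite pinv_cl pmul_cl; apply/clP.
by have := weq_mulV (winv u); rewrite winvK.
Qed.

HB.instance Definition _ :=
  isGroup.Build presented_group pmulA pmul1 p1mul pmulV' pmulV.

Definition pgen x : presented_group := cl [:: (x, false)].

(* Extension of a map on generators; a morphism as soon as [f] kills [R]. *)
Definition plift (G : groupType) (f : X -> G) (a : presented_group) : G :=
  weval f (repr a).

Lemma weval_cat (G : groupType) (f : X -> G) u v :
  weval f (u ++ v) = weval f u * weval f v.
Proof. by rewrite /weval big_cat. Qed.

Section Lift.
Variables (G : groupType) (f : X -> G).
Hypothesis fR : forall r, R r -> weval f r = 1.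

Lemma weval_weq u v : weq R u v -> weval f u = weval f v.
Proof.
elim=> {u v} [//|u v _ -> //|u v w _ -> _ -> //|u v x b|u v r Rr].
  rewrite !weval_cat; congr (_ * _).
  by rewrite /weval !big_cons /=; case: b => /=; rewrite ?mulKg ?mulVKg.
by rewrite !weval_cat (fR Rr) mul1g.
Qed.

Lemma plift_cl u : plift f (cl u) = weval f u.
Proof. exact/weval_weq/weq_repr. Qed.

Lemma plift_gen x : plift f (pgen x) = f x.
Proof. by rewrite plift_cl /weval big_seq1. Qed.

Lemma pliftM : {morph plift f : a b / a * b}.
Proof.
elim/clW=> u; elim/clW=> v.
have -> : (cl u : presented_group) * cl v = cl (u ++ v) by exact: pmul_cl.
by rewrite !plift_cl weval_cat.
Qed.

End Lift.

Lemma weval_morph (G H : groupType) (f : X -> G) (phi : G -> H) w :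
  {morph phi : a b / a * b} -> phi (weval f w) = weval (phi \o f) w.
Proof.
move=> phiM; have phi1 : phi 1 = 1 by apply: (mulgI (phi 1)); rewrite -phiM !mulg1.
have phiV a : phi a^-1 = (phi a)^-1.
  by apply: (mulgI (phi a)); rewrite -phiM !mulgV phi1.
rewrite /weval (big_morph phi phiM phi1); apply: eq_bigr => -[x b] _ /=.
by case: b.
Qed.

Lemma cl_weval w : cl w = weval pgen w.
Proof.
elim: w => [|[x b] w IH]; first by rewrite /weval big_nil.
rewrite /weval big_cons -/(weval pgen w) -IH.
have -> : (if (x, b).2 then (pgen (x, b).1)^-1 else pgen (x, b).1)
          = cl [:: (x, b)].
  by case: b => /=; [apply: pinv_cl | ].
by symmetry; apply: pmul_cl.
Qed.

Lemma pmorph_ext (G : groupType) (phi psi : presented_group -> G) :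
    {morph phi : a b / a * b} -> {morph psi : a b / a * b} ->
  (forall x, phi (pgen x) = psi (pgen x)) -> phi =1 psi.
Proof.
move=> phiM psiM e; elim/clW=> w; rewrite cl_weval !weval_morph //.
by apply: eq_bigr => -[x b] _ /=; rewrite e.
Qed.

Lemma weval_pgen_rel r : R r -> weval pgen r = 1.
Proof.
by move=> Rr; rewrite -cl_weval; apply/clP; have := weq_rel [::] [::] Rr;
  rewrite cats0.
Qed.

End WordCongruence.
End Presentations.

Definition wgen (X : choiceType) (x : X) : word X := [:: (x, false)].

(* [wseq n [:: i; j; ...]] is the word x_i x_j ... in the generators
   x_0, ..., x_n. *)
Definition wseq n (s : seq nat) : word 'I_n.+1 :=
  [seq (inord i, false) | i <- s].

(* Coxeter relators; [m i j] is used only for [i != j]. *)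
Inductive coxeter_relator n (m : nat -> nat -> nat) : word 'I_n -> Prop :=
| cox_square (i : 'I_n) : coxeter_relator m (wexp (wgen i) 2)
| cox_braid (i j : 'I_n) : i != j ->
    coxeter_relator m (wexp (wgen i ++ wgen j) (m i j)).

Record group_action (N Q : groupType) := GroupAction {
  gact :> Q -> N -> N;
  gactM : forall g, {morph gact g : x y / x * y};
  gact1 : forall x, gact 1 x = x;
  gact_comp : forall g h x, gact (g * h) x = gact h (gact g x) }.

Section SemidirectProduct.
Variables (N Q : groupType).

(* The pair [(x, g)] stands for the product x g; see [sd_conj] for how the
   action is realised. *)
Definition semidirect (a : group_action N Q) : Type := (N * Q)%type.

Variable a : group_action N Q.

HB.instance Definition _ := Choice.copy (semidirect a) (N * Q)%type.

Definition sd_mul (u v : semidirect a) : semidirect a :=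
  (u.1 * a u.2^-1 v.1, u.2 * v.2).
Definition sd_one : semidirect a := (1, 1).
Definition sd_inv (u : semidirect a) : semidirect a := (a u.2 u.1^-1, u.2^-1).

Lemma gact_one g : a g 1 = 1.
Proof. by apply: (mulgI (a g 1)); rewrite -gactM !mulg1. Qed.

Lemma sd_mulA : associative sd_mul.
Proof.
by move=> u v w; rewrite /sd_mul /= gactM -gact_comp invgM !mulgA.
Qed.

Lemma sd_mul1 : left_id sd_one sd_mul.
Proof. by case=> x g; rewrite /sd_mul /= invg1 gact1 !mul1g. Qed.

Lemma sd_1mul : right_id sd_one sd_mul.
Proof. by case=> x g; rewrite /sd_mul /= gact_one !mulg1. Qed.

Lemma sd_mulV : left_inverse sd_one sd_inv sd_mul.
Proof.
by case=> x g; rewrite /sd_mul /= invgK -gactM mulVg gact_one mulVg.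
Qed.

Lemma sd_mulV' : right_inverse sd_one sd_inv sd_mul.
Proof.
by case=> x g; rewrite /sd_mul /= -gact_comp mulgV gact1 mulgV.
Qed.

HB.instance Definition _ :=
  isGroup.Build (semidirect a) sd_mulA sd_mul1 sd_1mul sd_mulV sd_mulV'.

Definition sd_inl (x : N) : semidirect a := (x, 1).
Definition sd_inr (g : Q) : semidirect a := (1, g).

Lemma sd_conj x g : (sd_inr g)^-1 * sd_inl x * sd_inr g = sd_inl (a g x).
Proof.
rewrite /mul /inv /= /sd_mul /sd_inv /sd_inl /sd_inr /=.
by rewrite invg1 !gact_one invgK !mulg1 mul1g mulVg.
Qed.

End SemidirectProduct.

Record incidence_system (I : Type) := IncidenceSystem {
  elt :> Type;
  ty : elt -> I;
  inc : elt -> elt -> Prop }.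

Definition isomorphism I J (t : I -> J) (A : incidence_system I)
    (B : incidence_system J) (f : A -> B) :=
  [/\ bijective f, forall x, ty (f x) = t (ty x)
    & forall x y, inc (f x) (f y) <-> inc x y].

Section Hypertopes.
Variables (I : Type) (A : incidence_system I).
Implicit Types (F C : set A).

Definition incidence_axioms :=
  [/\ forall x : A, inc x x, forall x y : A, inc x y -> inc y x
    & forall x y : A, inc x y -> ty x = ty y -> x = y].

Definition flag F := forall x y, F x -> F y -> inc x y.

Definition chamber C := flag C /\ forall i, exists2 x, C x & ty x = i.

Definition geometry := forall F, flag F -> exists2 C, chamber C & F `<=` C.

Definition thin := forall F i, flag F -> @ty _ A @` F = ~` [set i] ->
  exists C1 C2, C1 <> C2 /\ [set C | chamber C /\ F `<=` C] = [set C1; C2].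

Definition residue F : incidence_system I :=
  @IncidenceSystem I {x : A | ~ F x /\ forall y, F y -> inc x y}
    (fun x => ty (sval x)) (fun x y => inc (sval x) (sval y)).

(* The residue of [F] has rank at least 2 when at least two types are missing
   from [F]. *)
Definition residually_connected := forall F i j, flag F ->
  i <> j -> ~ (@ty _ A @` F) i -> ~ (@ty _ A @` F) j ->
  forall x y : residue F, clos_refl_trans _ (@inc _ (residue F)) x y.

Definition automorphism (f : A -> A) := isomorphism id f.

Definition flag_transitive := forall F1 F2, flag F1 -> flag F2 ->
  @ty _ A @` F1 = @ty _ A @` F2 -> exists2 f, automorphism f & f @` F1 = F2.

Definition regular_hypertope :=
  [/\ incidence_axioms, geometry, thin, residually_connected
    & flag_transitive].

End Hypertopes.

Section CosetSystems.
Variables (G : groupType) (I : Type) (H : set G) (K : I -> set G).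

Definition coset_elt := {i : I & {A : set G | rcosets H (K i) A}}.

Definition coset_of (x : coset_elt) : set G := sval (projT2 x).

Definition coset_system : incidence_system I :=
  @IncidenceSystem I coset_elt (fun x => projT1 x)
    (fun x y => coset_of x `&` coset_of y !=set0).

Definition right_translation (h : G) (f : coset_system -> coset_system) :=
  forall x, ty (f x) = ty x /\ coset_of (f x) = rcoset (coset_of x) h.

(* H is the group of type-preserving automorphisms: right translation is a
   bijection (hence an isomorphism) from H onto that group. *)
Definition automorphism_group_is :=
  (forall h, H h -> exists2 f, automorphism f & right_translation h f) /\
  (forall f : coset_system -> coset_system, automorphism f ->
     exists! h, H h /\ right_translation h f).

End CosetSystems.

Definition parabolic (G : groupType) I (r : I -> G) (i : I) : set G :=
  gen (r @` ~` [set i]).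

Definition parabolic_system (G : groupType) I (r : I -> G) :=
  coset_system (gen (range r)) (parabolic r).

Definition string_C_group (G : groupType) m (r : 'I_m -> G) :=
  [/\ gen (range r) = setT,
      forall i, r i <> 1 /\ r i ^+ 2 = 1,
      forall J K : set 'I_m,
        gen (r @` J) `&` gen (r @` K) = gen (r @` (J `&` K))
    & forall i j : 'I_m, (i.+1 < j)%N || (j.+1 < i)%N -> (r i * r j) ^+ 2 = 1].

Section Vertices.
Variables (G : groupType) (n : nat) (r : 'I_n.+1 -> G).

Definition vertex_set : set (set G) := rcosets setT (parabolic r ord0).

Definition vertex : choiceType := {F : set G | F \in vertex_set}.

Lemma base_vertex_subproof : parabolic r ord0 \in vertex_set.
Proof. by apply/mem_set; exists 1 => //; rewrite rcoset1. Qed.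

Definition base_vertex : vertex := exist (fun F => F \in vertex_set) _ base_vertex_subproof.

Lemma vertex_act_subproof (F : vertex) g : rcoset (sval F) g \in vertex_set.
Proof.
by case: F => F /= /set_mem[h _ <-]; apply/mem_set; exists (h * g);
  rewrite ?rcosetM.
Qed.

Definition vertex_act (F : vertex) (g : G) : vertex :=
  exist (fun F => F \in vertex_set) _ (vertex_act_subproof F g).

Lemma vertex_act1 F : vertex_act F 1 = F.
Proof. by apply: val_inj; rewrite /= rcoset1. Qed.

Lemma vertex_actM F g h :
  vertex_act F (g * h) = vertex_act (vertex_act F g) h.
Proof. by apply: val_inj; rewrite /= rcosetM. Qed.

End Vertices.

(* Centrally symmetric regular polytopes of rank [n.+1], as string C-groups
   with a proper central involution fixing no vertex. *)
Record cs_polytope (n : nat) := CsPolytope {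
  pgroup : groupType;
  tau : 'I_n.+1 -> pgroup;
  alpha : pgroup;
  tau_string_C : string_C_group tau;
  alpha_invol : alpha <> 1 /\ alpha ^+ 2 = 1;
  alpha_central : forall g, commute alpha g;
  alpha_free : forall F : vertex tau, vertex_act F alpha <> F }.

Section TwoPow.
Variables (n : nat) (P : cs_polytope n) (s : nat).

Local Notation V := (vertex (@tau n P)).
Local Notation "F @* g" := (vertex_act F g) (at level 40).

Inductive W_relator : word V -> Prop :=
| W_square F : W_relator (wexp (wgen F) 2)
| W_antipodal F : W_relator (wexp (wgen F ++ wgen (F @* alpha P)) s)
| W_commute F F' : F' <> F -> F' <> F @* alpha P ->
    W_relator (wexp (wgen F ++ wgen F') 2).

Definition W : groupType := presented_group W_relator.

Definition W_act (g : pgroup P) : W -> W :=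
  plift (fun F => pgen W_relator (F @* g)).

Lemma weval_wexp (G : groupType) (f : V -> G) w k :
  weval f (wexp w k) = weval f w ^+ k.
Proof.
elim: k => [|k IH]; first by rewrite /wexp /= /weval big_nil.
by rewrite /wexp /= -/(wexp w k) weval_cat IH expgS.
Qed.

Lemma weval_wgen (G : groupType) (f : V -> G) F : weval f (wgen F) = f F.
Proof. by rewrite /weval big_seq1. Qed.

Lemma vertex_act_inj g : injective (fun F : V => F @* g).
Proof.
by move=> F F' /(congr1 (fun E => E @* g^-1)) /=;
  rewrite -!vertex_actM mulgV !vertex_act1.
Qed.

Lemma W_act_rel g r :
  W_relator r -> weval (fun F => pgen W_relator (F @* g)) r = 1.
Proof.
have rel r' : W_relator r' -> weval (pgen W_relator) r' = 1.
  exact: weval_pgen_rel.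
have comm F : F @* alpha P @* g = F @* g @* alpha P.
  by rewrite -!vertex_actM alpha_central.
case=> [F|F|F F' nF nFa].
- have := rel _ (W_square (F @* g)).
  by rewrite !weval_wexp !weval_wgen.
- have := rel _ (W_antipodal (F @* g)).
  by rewrite !weval_wexp !weval_cat !weval_wgen comm.
have nF2 : F' @* g <> F @* g by move/vertex_act_inj.
have nFa2 : F' @* g <> F @* g @* alpha P.
  by rewrite -comm => /vertex_act_inj.
have := rel _ (W_commute nF2 nFa2).
by rewrite !weval_wexp !weval_cat !weval_wgen.
Qed.

Lemma W_act_gen g F : W_act g (pgen _ F) = pgen _ (F @* g).
Proof. exact/plift_gen/W_act_rel. Qed.

Lemma W_actM g : {morph W_act g : x y / x * y}.
Proof. exact/pliftM/W_act_rel. Qed.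

Lemma W_act1 x : W_act 1 x = x.
Proof.
apply: (pmorph_ext (W_actM 1) (psi := id)) => // F.
by rewrite W_act_gen vertex_act1.
Qed.

Lemma W_act_comp g h x : W_act (g * h) x = W_act h (W_act g x).
Proof.
apply: (pmorph_ext (W_actM _) (psi := W_act h \o W_act g)).
  by move=> y z /=; rewrite !W_actM.
by move=> F; rewrite /= !W_act_gen vertex_actM.
Qed.

Definition W_action : group_action W (pgroup P) :=
  GroupAction W_actM W_act1 W_act_comp.

(* The group of the polytope 2^{P,G(s)}. *)
Definition two_pow : groupType := semidirect W_action.

Definition two_pow_gen (i : 'I_n.+2) : two_pow :=
  if unlift ord0 i is Some j then sd_inr W_action (tau P j)
  else sd_inl W_action (pgen W_relator (base_vertex (@tau n P))).

End TwoPow.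

Definition halving_gen (G : groupType) n (r : 'I_n.+2 -> G) (i : 'I_n.+2) : G :=
  if i == ord0 then r (inord 0) * r (inord 1) * r (inord 0) else r i.

Definition m343 (i j : nat) : nat :=
  match minn i j, maxn i j with
  | 0, 1 => 3 | 1, 2 => 4 | 2, 3 => 3 | _, _ => 2
  end.

(* [P] is a copy of the 24-cell, given by the Coxeter group [3,4,3]. *)
Definition is_24cell (P : cs_polytope 3) :=
  presented_by (@tau 3 P) (coxeter_relator m343) /\
  alpha P = (tau P (inord 0) * tau P (inord 1) * tau P (inord 2)
             * tau P (inord 3)) ^+ 6.

Definition mH (i j : nat) : nat :=
  match minn i j, maxn i j with
  | 0, 2 => 3 | 1, 2 => 3 | 2, 3 => 4 | 3, 4 => 3 | _, _ => 2
  end.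

Definition beta : word 'I_5 := wseq 4 [:: 1; 2; 3; 4]%N.
Definition beta_tilde : word 'I_5 := wseq 4 [:: 0; 2; 3; 4]%N.

Inductive halving_relator (s : nat) : word 'I_5 -> Prop :=
| halving_coxeter w : coxeter_relator mH w -> halving_relator s w
| halving_comm (i : nat) : i \in [:: 3; 4]%N ->
    halving_relator s
      (wexp (wexp (winv beta_tilde) i ++ wexp beta i) 2)
| halving_power :
    halving_relator s (wexp (wexp beta_tilde 6 ++ wexp beta 6) s).

(* The group of the toroidal hypertope {{3 over 3}, 4}_(4,0,0). *)
Inductive toroidal_relator : word 'I_4 -> Prop :=
| toroidal_coxeter w : coxeter_relator mH w -> toroidal_relator w
| toroidal_translation : toroidal_relator (wexp (wseq 3 [:: 0; 2; 3; 2; 1]%N) 4).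

Definition toroidal_hypertope : incidence_system 'I_4 :=
  parabolic_system (pgen toroidal_relator).

(* For a group with generators [r 0], ..., [r 4]: the residue of the base
   element of type 4, together with its group < r 0, r 1, r 2, r 3 >, is the
   toroidal hypertope (with its group). The types 0, ..., 3 are matched by
   [lift ord_max : 'I_4 -> 'I_5], which preserves values. *)
Definition toroidal_residue_is_400 (G : groupType) (r : 'I_5 -> G) :=
  presented_by (r \o lift ord_max) toroidal_relator /\
  exists x : parabolic_system r,
    [/\ ty x = ord_max, coset_of x = parabolic r ord_max
      & exists f : toroidal_hypertope -> residue [set x],
          isomorphism (lift ord_max) f].

(* Main.v *)
From HB Require Import structures.
From mathcomp Require Import all_boot ssralg ssrint zify zmodp fingroup perm.
From mathcomp Require Import boolp classical_sets functions cardinality.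
From Stdlib Require Import Relation_Operators.
Require Import Defs.

Set Implicit Arguments.
Unset Strict Implicit.
Unset Printing Implicit Defensive.

Local Open Scope classical_set_scope.
Local Open Scope group_scope.
Local Open Scope card_scope.

(** Let [G] be the group of the 24-cell, [V] its set of 24 vertices, [W] the
    Coxeter group with one reflection for each vertex, and [rho0] the reflection
    at the base vertex. An element of the semidirect product of [W] and [G] is a
    pair [(x, g)]. Conjugation by [rho0] exchanges the first two generators of
    the halving group and fixes the other three, since these fix the base
    vertex. Hence the halving group together with its coset by [rho0] contains
    [rho0] and [G], so it is everything, and the parity of the first component
    shows that the halving group has index 2 and consists of the pairs with [x]
    even ([halving_index2]).

    Order. [W] is a direct product of 12 dihedral groups of order [2 s], one for
    each pair of antipodal vertices ([W_elt]). The group [G] has 1152 elements: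
    a table of coset representatives for the chain of standard parabolic
    subgroups, checked by rewriting with the Coxeter relations, gives at most
    that many normal forms, and the reflection representation separates them.

    Hypertope. A coset geometry of a group generated by involutions is a regular
    hypertope, with the group acting by right translations as its full
    type-preserving automorphism group, as soon as intersections of maximal
    parabolic subgroups are generated by the generators they contain, and cosets
    that meet in pairs have a common element ([coset_system_hypertope],
    [coset_system_automorphisms]). The elements of type 0 and 1 are the even and
    the odd vertices of the polytope, those of higher type are its faces. A
    parabolic subgroup of type at least 2 consists of even pairs [(x, g)] with
    [g] in the stabilizer of a face of the 24-cell and [x] in the subgroup of
    [W] generated by the vertices of this face. As these faces form a chain,
    everything reduces to the intersection property of [G] and to the fact that
    a vertex whose reflection lies in the subgroup generated by the vertices of
    a face is a vertex of the face ([sigma_gen]); this gives [halving_meets] and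
    [halving_helly].

    Presentation. Let [U] be the group presented by the relators. They are
    invariant under the exchange of the first two generators, so [U] embeds in
    its semidirect product [K] with a group of order 2, generated by [theta],
    say. In [K] the conjugates of [theta] by words in the last four generators
    depend only on the image of the base vertex, because [theta] commutes with
    the stabilizer of that vertex. Sending the reflection at a vertex to the
    corresponding conjugate of [theta] defines a morphism from [W] to [K]: the
    stabilizer of the base vertex has five orbits on the vertices, reached by
    the trivial word, by one generator, and by 3, 4 and 6 steps along a Petrie
    polygon, and the relators say exactly that the required relations hold at
    these places. A word then evaluates in [K] to a product of which one factor
    depends on the [W]-component and the other one on the [G]-component of its
    value in the semidirect product of [W] and [G], so a word that is trivial
    there is trivial in [U] ([trivial_halving_word]). The same argument applied
    to the octahedral facet, in whose group three orbits suffice, shows that the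
    toroidal residue has the claimed presentation ([toroidal_presentation]), and
    the residue of a base element is the coset geometry of its stabilizer
    ([base_residue_isomorphism]). *)

(** * Generated subgroups and cosets *)

Section Subgroups.
Variable G : groupType.
Implicit Types (A B K : set G) (x y g h : G).

Lemma gen_is_subgroup A : is_subgroup (gen A).
Proof.
split=> [B [[]]//|x y Ax Ay B sB].
by apply: (sB.1.2); [apply: Ax | apply: Ay].
Qed.

Lemma gen1 A : gen A 1. Proof. exact: (gen_is_subgroup A).1. Qed.

Lemma genV A x : gen A x -> gen A x^-1.
Proof.
by move=> Ax; rewrite -[_^-1]mul1g; apply: (gen_is_subgroup A).2 => //; apply: gen1.
Qed.

Lemma genM A x y : gen A x -> gen A y -> gen A (x * y).
Proof.
by move=> Ax /genV Ay; rewrite -[y]invgK; apply: (gen_is_subgroup A).2.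
Qed.

Lemma genMl A x y : gen A x -> gen A (x * y) -> gen A y.
Proof. by move=> /genV Ax /(genM Ax); rewrite mulKg. Qed.

Lemma sub_gen A : A `<=` gen A. Proof. exact: sub_gen_smallest. Qed.

Lemma gen_sub A B : A `<=` gen B -> gen A `<=` gen B.
Proof. by move=> AB; apply: smallest_sub AB; apply: gen_is_subgroup. Qed.

Lemma genS A B : A `<=` B -> gen A `<=` gen B.
Proof. by move=> AB; apply: gen_sub => x /AB /sub_gen. Qed.

Lemma gen_ind A (Q : G -> Prop) : Q 1 -> (forall x y, Q x -> Q y -> Q (x / y)) ->
  (forall x, A x -> Q x) -> forall x, gen A x -> Q x.
Proof. by move=> Q1 QF AQ x; apply: (smallest_sub (C := @is_subgroup G)). Qed.

Lemma rcosetP K g x : rcoset K g x <-> K (x / g).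
Proof.
split=> [[h Kh <-]|Kx]; first by rewrite mulgK.
by exists (x / g); rewrite ?mulgVK.
Qed.

Lemma rcoset_refl A g : rcoset (gen A) g g.
Proof. by apply/rcosetP; rewrite mulgV; apply: gen1. Qed.

Lemma rcoset_eq A g h : rcoset (gen A) g h -> rcoset (gen A) h = rcoset (gen A) g.
Proof.
move=> /rcosetP Ahg; apply/seteqP; split=> x /rcosetP Ax; apply/rcosetP.
  by rewrite -(divgKA h); apply: genM.
by rewrite -(divgKA g); apply: genM => //; rewrite -invgF; apply: genV.
Qed.

Lemma rcoset_sym A g h : rcoset (gen A) g h -> rcoset (gen A) h g.
Proof. by move=> /rcoset_eq ->; apply: rcoset_refl. Qed.

End Subgroups.

Arguments gen1 {G} A.

Lemma morph_one (G G' : groupType) (phi : G -> G') :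
  {morph phi : x y / x * y} -> phi 1 = 1.
Proof. by move=> phiM; apply: (mulgI (phi 1)); rewrite -phiM !mulg1. Qed.

Lemma morph_inv (G G' : groupType) (phi : G -> G') :
  {morph phi : x y / x * y} -> forall x, phi x^-1 = (phi x)^-1.
Proof.
move=> phiM x; apply: (mulgI (phi x)).
by rewrite -phiM !mulgV (morph_one phiM).
Qed.

Lemma gen_morph (G G' : groupType) (phi : G -> G') (A : set G) (B : set G') :
  {morph phi : x y / x * y} -> (forall x, A x -> gen B (phi x)) ->
  forall x, gen A x -> gen B (phi x).
Proof.
move=> phiM AB.
apply: (gen_ind (Q := fun x => gen B (phi x))) => // [|x y Bx By];
  first by rewrite (morph_one phiM); apply: gen1.
by rewrite phiM (morph_inv phiM); apply: genM => //; apply: genV.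
Qed.

(** * Coset geometries of groups generated by involutions *)

Section CosetGeometry.
Variables (G : groupType) (n : nat) (r : 'I_n.+1 -> G).
Implicit Types (K : set 'I_n.+1) (a : 'I_n.+1 -> G) (g h : G).

Local Notation H := (gen (range r)).
Local Notation P := (parabolic r).

(** Pairwise incident elements lie in a common chamber, in terms of cosets. *)
Definition coset_helly := forall K a, (forall i, K i -> H (a i)) ->
  (forall i j, K i -> K j -> exists y, rcoset (P i) (a i) y /\ rcoset (P j) (a j) y) ->
  exists2 h, H h & forall i, K i -> rcoset (P i) (a i) h.

(** The part of the intersection property that concerns residues: the
    stabilizers of flags are, up to conjugacy, intersections of maximal
    parabolic subgroups. *)
Definition parabolic_intersections := forall K g,
  H g -> (forall i, K i -> P i g) -> gen (r @` ~` K) g.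

Hypothesis r_invol : forall i, r i ^+ 2 = 1.
Hypothesis r_neq1 : forall i, r i <> 1.
Hypothesis helly : coset_helly.
Hypothesis meets : parabolic_intersections.

Local Notation sys := (coset_system H P).

Let rr i : r i * r i = 1. Proof. by rewrite -expg2. Qed.
Let rV i : (r i)^-1 = r i. Proof. exact/mulg1_eq. Qed.

Lemma parabolic_sub i g : P i g -> H g.
Proof. by apply: genS => _ [j _ <-]; exists j. Qed.

Lemma gen_range i : H (r i). Proof. by apply: sub_gen; exists i. Qed.

Lemma parabolic_gen i j : i <> j -> P i (r j).
Proof. by move=> ij; apply: sub_gen; exists j => //= ji; apply: ij. Qed.

Lemma gen_parabolic K i g : K i -> gen (r @` ~` K) g -> P i g.
Proof. by move=> Ki; apply: genS => _ [j nKj <-]; exists j => //= ji; apply: nKj;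
  rewrite ji. Qed.

Definition coset_at i g (Hg : H g) : sys :=
  existT _ i (exist (fun A => Defs.rcosets H (P i) A) (rcoset (P i) g)
    (ex_intro2 _ _ g Hg erefl)).

Lemma elt_eq (x y : sys) : ty x = ty y -> coset_of x = coset_of y -> x = y.
Proof.
case: x => i [A cA]; case: y => j [B cB] /= ij; case: j / ij cB => cB.
by rewrite /coset_of /= => AB; case: B / AB cB => cB; rewrite (Prop_irrelevance cA cB).
Qed.

Lemma coset_ofE (x : sys) : exists2 g, H g & coset_of x = rcoset (P (ty x)) g.
Proof. by case: x => i [A [g Hg gA]]; exists g. Qed.

Lemma coset_of_sub (x : sys) g : coset_of x g -> H g.
Proof.
case: (coset_ofE x) => h Hh -> /rcosetP /parabolic_sub Hgh.
by rewrite -[g](mulgVK h); apply: genM.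
Qed.

Lemma coset_of_eq (x : sys) g : coset_of x g -> coset_of x = rcoset (P (ty x)) g.
Proof. by case: (coset_ofE x) => h _ -> /rcoset_eq. Qed.

Lemma coset_atE (x : sys) g (Hg : H g) : coset_of x g -> x = coset_at (ty x) Hg.
Proof. by move=> xg; apply: elt_eq => //; apply: coset_of_eq. Qed.

Lemma coset_at_eq i g h (Hg : H g) (Hh : H h) :
  P i (g / h) -> coset_at i Hg = coset_at i Hh.
Proof. by move=> igh; apply: elt_eq => //; apply/rcoset_eq/rcosetP. Qed.

Lemma coset_at_inj i j g h (Hg : H g) (Hh : H h) :
  coset_at i Hg = coset_at j Hh -> i = j /\ P i (g / h).
Proof.
move=> e; have ij : i = j by have := congr1 (@ty _ sys) e.
split=> //; apply/rcosetP; have := congr1 (@coset_of _ _ _ _) e.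
by rewrite /coset_of /= -ij => <-; apply: rcoset_refl.
Qed.

Lemma inc_coset_at i j g (Hg : H g) : @inc _ sys (coset_at i Hg) (coset_at j Hg).
Proof. by exists g; split; apply: rcoset_refl. Qed.

Lemma coset_system_axioms : incidence_axioms sys.
Proof.
split=> [x|x y|x y [g [xg yg]] xy].
- case: (coset_ofE x) => g _ xg.
  by exists g; rewrite setIid xg; apply: rcoset_refl.
- by rewrite /= setIC.
apply: elt_eq => //.
by rewrite (coset_of_eq xg) (coset_of_eq yg) xy.
Qed.

(** A flag has at most one element of each type, so choosing a representative
    for each type that occurs puts it in the form required by the Helly
    property. *)
Lemma flag_common (F : set sys) : flag F ->
  exists2 h, H h & forall x, F x -> coset_of x h.
Proof.
move=> fF; pose K := @ty _ sys @` F.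
have /choice[a aP] i : exists g, K i ->
    H g /\ forall x, F x -> ty x = i -> coset_of x g.
  case: (pselect (K i)) => [[x Fx xi]|nKi]; last by exists 1.
  have [g Hg xg] := coset_ofE x; exists g => _; split=> // y Fy yi.
  have [_ _ same] := coset_system_axioms.
  rewrite (same y x (fF _ _ Fy Fx)) ?xi //.
  by rewrite xg; apply: rcoset_refl.
have aE x : F x -> coset_of x = rcoset (P (ty x)) (a (ty x)).
  move=> Fx; have [|_ xa] := aP (ty x); first by exists x.
  exact/coset_of_eq/xa.
have [i /aP[]//|_ _ [x Fx <-] [y Fy <-]|h Hh hP] := helly (K := K) (a := a).
  have [g [xg yg]] := fF _ _ Fx Fy.
  by exists g; rewrite -!aE.
by exists h => // x Fx; rewrite aE //; apply: hP; exists x.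
Qed.

Definition chamber_at g : set sys := [set x | coset_of x g].

Lemma chamber_atP g : H g -> chamber (chamber_at g).
Proof.
move=> Hg; split=> [x y xg yg|i]; first by exists g.
by exists (coset_at i Hg) => //; apply: rcoset_refl.
Qed.

Lemma chamberE (C : set sys) : chamber C -> exists2 g, H g & C = chamber_at g.
Proof.
move=> [fC tC]; have [g Hg gP] := flag_common fC.
exists g => //; apply/seteqP; split=> [x /gP //|x xg].
have [y Cy yx] := tC (ty x).
have [_ _ same] := coset_system_axioms.
by rewrite (same x y) //; exists g; split=> //; apply: gP.
Qed.

Lemma parabolic_meet1 g : H g -> (forall i, P i g) -> g = 1.
Proof.
move=> Hg Pg; have : gen (r @` ~` setT) g by apply: meets.
rewrite setCT image_set0; apply: (gen_ind (Q := fun g => g = 1)) => // x y -> ->.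
by rewrite divg1.
Qed.

Lemma parabolic_meet_rank1 i g : H g -> (forall j, j <> i -> P j g) -> g = 1 \/ g = r i.
Proof.
move=> Hg Pg; have : gen (r @` ~` ~` [set i]) g by apply: meets.
rewrite setCK image_set1.
apply: (gen_ind (Q := fun g => g = 1 \/ g = r i)) => [|x y [] -> [] ->|x ->].
- by left.
- by left; rewrite divg1.
- by right; rewrite rV mul1g.
- by right; rewrite divg1.
- by left; rewrite rV rr.
- by right.
Qed.

Lemma chamber_at_inj g h : H g -> H h -> chamber_at g = chamber_at h -> g = h.
Proof.
move=> Hg Hh gh; apply: divg1_eq; apply: parabolic_meet1.
  by apply: genM => //; apply: genV.
move=> i; apply/rcosetP.
have : chamber_at g (coset_at i Hh) by rewrite gh; apply: rcoset_refl.
exact.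
Qed.

Lemma coset_system_geometry : geometry sys.
Proof.
move=> F /flag_common[h Hh hP]; exists (chamber_at h); first exact: chamber_atP.
by move=> x /hP.
Qed.

(** The quotient of the two elements lies in all maximal parabolic subgroups but
    the one of type [i], hence in the group of order 2 generated by [r i]. *)
Lemma adjacent_chambers i g h : H g -> H h ->
  (forall x, ty x <> i -> chamber_at h x -> chamber_at g x) -> g = h \/ g = r i * h.
Proof.
move=> Hg Hh gh; have [||e|e] := @parabolic_meet_rank1 i (g / h).
- by apply: genM => //; apply: genV.
- move=> j ji; apply/rcosetP.
  by have := gh (coset_at j Hh) ji (rcoset_refl _ _).
- by left; apply: divg1_eq.
- by right; rewrite -e mulgVK.
Qed.

Lemma coset_of_mul k (x : sys) g : ty x <> k -> coset_of x g -> coset_of x (r k * g).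
Proof.
move=> xk xg; rewrite (coset_of_eq xg); apply/rcosetP; rewrite mulgK.
exact: parabolic_gen.
Qed.

Lemma r_notin_parabolic i : ~ P i (r i).
Proof.
move=> Pri; apply: (@r_neq1 i); apply: parabolic_meet1; first exact: gen_range.
move=> j; case: (pselect (j = i)) => [->//|ji]; exact: parabolic_gen.
Qed.

Lemma r_mul_neq i g : r i * g <> g.
Proof. by move=> /(congr1 (fun x => x / g)); rewrite mulgV mulgK => /r_neq1. Qed.

Lemma coset_system_thin : thin sys.
Proof.
move=> F i fF tF; have [h Hh hP] := flag_common fF.
have Hrh : H (r i * h) by apply: genM (gen_range i) Hh.
exists (chamber_at h), (chamber_at (r i * h)); split.
  by move=> /(chamber_at_inj Hh Hrh) /esym /r_mul_neq.
apply/seteqP; split=> C; last first.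
  case=> ->; split; [exact: chamber_atP | by move=> x /hP | exact: chamber_atP |].
  move=> x Fx; apply: coset_of_mul (hP _ Fx) => xi.
  have : (@ty _ sys @` F) (ty x) by exists x.
  by rewrite tF => /(_ xi).
case=> /chamberE[g Hg ->] FC.
have [x xi xh|->|->] := @adjacent_chambers i g h Hg Hh; [|by left|by right].
have : (@ty _ sys @` F) (ty x) by rewrite tF.
case=> y Fy yx; have [_ _ same] := coset_system_axioms.
rewrite -(same y x) //; first exact: FC.
by exists h; split=> //; apply: hP.
Qed.

(** In a residue of rank at least 2 each generator [r k] of its group lies in
    the stabilizer of some type [m <> k] that is still present, so the chambers
    of [r k * h] and [h] share an element; words in the generators then connect
    any two chambers. *)
Lemma coset_system_connected : residually_connected sys.
Proof.
move=> F i j fF ij nFi nFj x y; have [h Hh hP] := flag_common fF.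
set K := @ty _ sys @` F in nFi nFj.
have resP (z : residue F) : ~ K (ty z).
  case: z => z [nFz iz] /= [w Fw wz]; apply: nFz.
  by have [_ _ same] := coset_system_axioms; rewrite (same z w (iz _ Fw)).
pose Q := gen (r @` ~` K).
have QH c : Q c -> H (c * h).
  by move=> Qc; apply: genM Hh; apply: genS Qc => _ [k _ <-]; exists k.
have res_at k c (Hc : H (c * h)) : ~ K k -> Q c ->
    ~ F (coset_at k Hc) /\ forall z, F z -> @inc _ sys (coset_at k Hc) z.
  move=> nKk Qc; split=> [Fk|z Fz]; first by apply: nKk; exists (coset_at k Hc).
  exists (c * h); split; first exact: rcoset_refl.
  rewrite (coset_of_eq (hP _ Fz)); apply/rcosetP; rewrite mulgK.
  by apply: gen_parabolic Qc; exists z.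
pose e k c (nKk : ~ K k) (Qc : Q c) : residue F :=
  exist _ (coset_at k (QH c Qc)) (res_at k c (QH c Qc) nKk Qc).
have e_eq k c d nk nk' (Qc : Q c) (Qd : Q d) : P k (c / d) -> e k c nk Qc = e k d nk' Qd.
  move=> kcd; have ek : coset_at k (QH c Qc) = coset_at k (QH d Qd).
    by apply: coset_at_eq; rewrite mulgKA.
  rewrite /e; move: (res_at k c _ nk Qc); rewrite ek => q.
  by rewrite (Prop_irrelevance q (res_at k d (QH d Qd) nk' Qd)).
pose conn := clos_refl_trans _ (@inc _ (residue F)).
have symc u v : conn u v -> conn v u.
  have [_ isym _] := coset_system_axioms.
  elim=> {u v} [u v uv|u|u v w _ vu _ wv]; [exact/rt_step/isym|exact: rt_refl|].
  exact: rt_trans wv vu.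
have same k l c nk nl (Qc : Q c) : conn (e k c nk Qc) (e l c nl Qc).
  exact/rt_step/inc_coset_at.
pose good c := forall d k l nk nl (Qd : Q d) (Qcd : Q (c * d)),
  conn (e k _ nk Qcd) (e l d nl Qd).
have goodQ c : Q c -> Q c /\ good c.
  apply: (gen_ind (Q := fun c => Q c /\ good c)) => [|a b [Qa ga] [Qb gb]|_ [k nKk <-]].
  - split=> [|d k l nk nl Qd Qcd]; first exact: gen1.
    apply: rt_trans (same _ _ _ nk nl Qd).
    by rewrite (@e_eq k _ d nk nk Qcd Qd) ?mul1g ?mulgV; [apply: rt_refl | apply: gen1].
  - split=> [|d k l nk nl Qd Qcd]; first by apply: genM => //; apply: genV.
    have Qbd : Q (b^-1 * d) by apply: genM => //; apply: genV.
    have Qbbd : Q (b * (b^-1 * d)) by rewrite mulVKg.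
    have Qabd : Q (a * (b^-1 * d)) by apply: genM.
    have -> : e k _ nk Qcd = e k _ nk Qabd.
      by apply: e_eq; rewrite -(mulgA a) mulgV; apply: gen1.
    apply: rt_trans (ga _ k l nk nl Qbd Qabd) _; apply: symc.
    have -> : e l _ nl Qd = e l _ nl Qbbd.
      by apply: e_eq; rewrite mulVKg mulgV; apply: gen1.
    exact: gb.
  have Qk : Q (r k) by apply: sub_gen; exists k.
  split=> // d l l' nl nl' Qd Qkd.
  have [m nm mk] : exists2 m, ~ K m & m <> k.
    by case: (pselect (i = k)) => [ik|ik]; [exists j; rewrite // -ik => /esym | exists i].
  apply: rt_trans (same _ _ _ nl nm Qkd) _.
  rewrite (@e_eq m _ d nm nm Qkd Qd); first exact: same.
  by rewrite mulgK; apply: parabolic_gen.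
have eP (z : residue F) : exists c nk (Qc : Q c), z = e (ty z) c nk Qc.
  case: z (resP z) => z [nFz iz] /= nk.
  have fz : flag (F `|` [set z]).
    have [irefl isym _] := coset_system_axioms.
    by move=> u v [Fu|->] [Fv|->]; [apply: fF|apply/isym/iz|apply: iz|apply: irefl].
  have [g Hg gP] := flag_common fz.
  have Qc : Q (g / h).
    apply: meets; first by apply: genM => //; apply: genV.
    move=> _ [w Fw <-]; apply/rcosetP; rewrite -(coset_of_eq (hP _ Fw)).
    by apply: gP; left.
  have zE : z = coset_at (ty z) (QH _ Qc).
    by apply: coset_atE; rewrite mulgVK; apply: gP; right.
  exists (g / h), nk, Qc; rewrite /e.
  move: (res_at _ _ _ _ _); rewrite -zE => q.
  by rewrite (Prop_irrelevance q (conj nFz iz)).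
have [c [nk [Qc ->]]] := eP x; have [d [nl [Qd ->]]] := eP y.
have Qcd : Q (c / d * d) by rewrite mulgVK.
have Qc_d : Q (c / d) by apply: genM => //; apply: genV.
have [_ gcd] := goodQ _ Qc_d.
rewrite (@e_eq _ _ (c / d * d) nk nk Qc Qcd); first exact: gcd.
by rewrite mulgVK mulgV; apply: gen1.
Qed.

Definition translate h (Hh : H h) (x : sys) : sys :=
  coset_at (ty x) (genM (s2valP (cid2 (coset_ofE x))) Hh).

Lemma coset_of_translate h (Hh : H h) x :
  coset_of (translate Hh x) = rcoset (coset_of x) h.
Proof.
by rewrite (s2valP' (cid2 (coset_ofE x))) rcosetM.
Qed.

Lemma translateP h (Hh : H h) : right_translation h (translate Hh).
Proof. by move=> x; split=> //; apply: coset_of_translate. Qed.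

Lemma translateK h k (Hh : H h) (Hk : H k) : h * k = 1 ->
  cancel (translate Hh) (translate Hk).
Proof.
by move=> hk x; apply: elt_eq => //; rewrite !coset_of_translate rcosetM hk rcoset1.
Qed.

Lemma translate_automorphism h (Hh : H h) : automorphism (translate Hh).
Proof.
split=> // [|x y].
  by exists (translate (genV Hh)); apply: translateK; rewrite ?mulgV ?mulVg.
rewrite /inc /= !coset_of_translate; split=> -[z].
  by case=> -[u xu <-] [v yv] /mulIg vu; exists u; split; rewrite // -vu.
by case=> xz yz; exists (z * h); split; exists z.
Qed.

Lemma coset_system_flag_transitive : flag_transitive sys.
Proof.
move=> F1 F2 fF1 fF2 tF.
have [h1 Hh1 h1P] := flag_common fF1; have [h2 Hh2 h2P] := flag_common fF2.
have Hh : H (h1^-1 * h2) by apply: genM => //; apply: genV.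
exists (translate Hh); first exact: translate_automorphism.
have moved x y : F1 x -> F2 y -> ty x = ty y -> translate Hh x = y.
  move=> Fx Fy xy; apply: elt_eq => //.
  rewrite coset_of_translate (coset_of_eq (h1P _ Fx)) (coset_of_eq (h2P _ Fy)).
  by rewrite rcosetM mulVKg xy.
apply/seteqP; split=> [_ [x Fx <-]|y Fy].
  have : (@ty _ sys @` F2) (ty x) by rewrite -tF; exists x.
  by case=> y Fy yx; rewrite (moved x y).
have : (@ty _ sys @` F1) (ty y) by rewrite tF; exists y.
by case=> x Fx xy; exists x => //; apply: moved.
Qed.

Theorem coset_system_hypertope : regular_hypertope sys.
Proof.
split; [exact: coset_system_axioms | exact: coset_system_geometry |
  exact: coset_system_thin | exact: coset_system_connected |
  exact: coset_system_flag_transitive].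
Qed.

(** An automorphism is determined by the image of one chamber, since it maps the
    chamber adjacent to it at type [k] to the chamber adjacent to the image. *)
Theorem coset_system_automorphisms : automorphism_group_is H P.
Proof.
split=> [h Hh|f [bf tf incf]].
  by exists (translate Hh); [apply: translate_automorphism | apply: translateP].
have finj : injective f by apply: bij_inj.
have [irefl isym same] := coset_system_axioms.
have chf g : H g -> exists2 h, H h & forall x, coset_of x g -> coset_of (f x) h.
  move=> Hg; have : chamber (f @` chamber_at g).
    have [fg tg] := chamber_atP Hg.
    split=> [_ _ [x xg <-] [y yg <-]|i]; first exact/incf/fg.
    by have [x xg xi] := tg i; exists (f x); [exists x | rewrite tf].
  case/chamberE => h Hh fh; exists h => // x xg.
  have : (f @` chamber_at g) (f x) by exists x.
  by rewrite fh.
have [h0 Hh0 h0P] := chf _ (gen1 (range r)).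
pose good g := forall x, coset_of x g -> coset_of (f x) (g * h0).
have step k g : H g -> good g -> good (r k * g).
  move=> Hg gg; have Hkg : H (r k * g) by apply: genM (gen_range k) Hg.
  have Hgh0 : H (g * h0) by apply: genM.
  have [h Hh hP] := chf _ Hkg.
  have [x xk|hE|hE] := @adjacent_chambers k h (g * h0) Hh Hgh0.
  - rewrite /chamber_at /= => xgh.
    have [ty1 ck] : ty (f (coset_at (ty x) Hg)) = ty x /\
        coset_of (f (coset_at (ty x) Hg)) (g * h0).
      by split; [rewrite tf | apply: gg; apply: rcoset_refl].
    have -> : x = f (coset_at (ty x) Hg) by apply: same => //; exists (g * h0).
    by apply: hP; apply: coset_of_mul => //; apply: rcoset_refl.
  - have ek : coset_at k Hkg = coset_at k Hg.
      apply: finj; apply: same; last by rewrite !tf.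
      exists (g * h0); split; last by apply: gg; apply: rcoset_refl.
      by rewrite -hE; apply: hP; apply: rcoset_refl.
    case: (@coset_at_inj k k _ _ Hkg Hg ek) => _.
    by rewrite mulgK => /r_notin_parabolic.
  - by move=> x /hP; rewrite hE mulgA.
have goodH g : H g -> good g.
  have good1 : good 1 by move=> x /h0P; rewrite mul1g.
  move=> Hg; have : H g /\ forall c, H c -> (good c <-> good (g * c)).
    move: g Hg; apply: (gen_ind (Q := fun g => H g /\ forall c, H c ->
      (good c <-> good (g * c)))).
    - by split=> [|c Hc]; [apply: gen1 | rewrite mul1g].
    - move=> x y [Hx gx] [Hy gy]; split=> [|c Hc].
        by apply: genM => //; apply: genV.
      have Hyc : H (y^-1 * c) by apply: genM => //; apply: genV.
      by rewrite -mulgA -gx // (gy _ Hyc) mulVKg.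
    move=> _ [k _ <-]; split=> [|c Hc]; first exact: gen_range.
    split=> [|grc]; first exact: step.
    have := step k (r k * c) (genM (gen_range k) Hc) grc.
    by rewrite mulgA rr mul1g.
  by case=> _ /(_ 1 (gen1 _)); rewrite mulg1 => <-.
exists h0; split.
  split=> // x; split; first exact: tf.
  have [g Hg xg] := coset_ofE x.
  rewrite xg rcosetM -(tf x); apply: coset_of_eq; apply: goodH => //.
  by rewrite xg; apply: rcoset_refl.
move=> h [Hh hT]; apply: divg1_eq; apply: parabolic_meet1.
  by apply: genM => //; apply: genV.
move=> i; apply/rcosetP.
have := (hT (coset_at i (gen1 (range r)))).2; rewrite rcosetM mul1g => <-.
by have := h0P (coset_at i (gen1 (range r))) (rcoset_refl _ _).
Qed.

End CosetGeometry.

Lemma gen_preimage (T G : groupType) (phi : T -> G) (A : set T) (B : set G) :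
  {morph phi : x y / x * y} -> B `<=` phi @` A ->
  forall g, gen B g -> exists2 t, gen A t & phi t = g.
Proof.
move=> phiM BA.
apply: (gen_ind (Q := fun g => exists2 t, gen A t & phi t = g)).
- by exists 1; [apply: gen1 | apply: morph_one].
- move=> _ _ [x Ax <-] [y Ay <-]; exists (x / y); first by apply: genM => //; apply: genV.
  by rewrite phiM (morph_inv phiM).
by move=> g /BA[t At <-]; exists t => //; apply: sub_gen.
Qed.

(** The elements incident with a given element form the coset geometry of its
    stabilizer: by the Helly property a coset of [H_i] meeting [H_n] can be
    traced on [H_n], and two cosets that meet already meet inside [H_n]. *)
Lemma base_residue_isomorphism (T G : groupType) n (p : 'I_n.+1 -> T)
    (r : 'I_n.+2 -> G) (phi : T -> G) :
  {morph phi : x y / x * y} -> injective phi ->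
  (forall i, phi (p i) = r (lift ord_max i)) ->
  coset_helly r -> parabolic_intersections r ->
  exists x : parabolic_system r,
    [/\ ty x = ord_max, coset_of x = parabolic r ord_max
      & exists f : parabolic_system p -> residue [set x],
          isomorphism (lift ord_max) f].
Proof.
move=> phiM phi_inj phip helly meets.
have phiV := morph_inv phiM.
pose x0 : parabolic_system r := coset_at ord_max (gen1 (range r)).
have x0E : coset_of x0 = parabolic r ord_max by apply: rcoset1.
exists x0; split=> //.
have phi_base t : gen (range p) t -> parabolic r ord_max (phi t).
  apply: (gen_morph phiM) => _ [i _ <-]; rewrite phip; apply: parabolic_gen.
  by apply/eqP; rewrite neq_lift.
have phi_gen t : gen (range p) t -> gen (range r) (phi t).
  by move=> /phi_base/parabolic_sub.
have phi_par i t : parabolic p i t -> parabolic r (lift ord_max i) (phi t).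
  apply: (gen_morph phiM) => _ [j /= ji <-]; rewrite phip; apply: parabolic_gen.
  by move=> /lift_inj ij; apply: ji.
have par_phi i t : gen (range p) t ->
    parabolic r (lift ord_max i) (phi t) -> parabolic p i t.
  move=> pt rt; have : gen (r @` ~` [set lift ord_max i; ord_max]) (phi t).
    by apply: meets => [|j [] -> //]; [apply: phi_gen | apply: phi_base].
  case/(gen_preimage (A := p @` ~` [set i]) phiM) => [|u pu /phi_inj <- //].
  move=> _ [j nj <-]; have [k jk|jm] := unliftP ord_max j; last by case: nj; right.
  exists (p k); last by rewrite phip jk.
  by exists k => //= ki; apply: nj; left; rewrite jk ki.
have rep (x : parabolic_system p) : {t | gen (range p) t & coset_of x t}.
  apply: cid2; have [t pt xt] := coset_ofE x.
  by exists t; rewrite // xt; apply: rcoset_refl.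
pose lft (x : parabolic_system p) : parabolic_system r :=
  let: exist2 t pt _ := rep x in coset_at (lift ord_max (ty x)) (phi_gen t pt).
have ty_lft x : ty (lft x) = lift ord_max (ty x) by rewrite /lft; case: (rep x).
have lftP x t : gen (range p) t -> coset_of (lft x) (phi t) <-> coset_of x t.
  move=> pt; rewrite /lft; case: (rep x) => u pu xu.
  rewrite (coset_of_eq xu).
  have put : gen (range p) (t / u) by apply: genM => //; apply: genV.
  split=> /rcosetP; rewrite -?phiV -?phiM => tu; apply/rcosetP; rewrite -?phiV -?phiM.
    exact: par_phi.
  exact: phi_par.
have lft_res x : ~ [set x0] (lft x) /\ forall y, [set x0] y -> inc (lft x) y.
  split=> [/= e|_ ->].
    have := congr1 (@ty _ (parabolic_system r)) e; rewrite ty_lft => /eqP.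
    by rewrite eq_sym (negPf (neq_lift _ _)).
  have [t pt xt] := rep x; exists (phi t); split; first exact/lftP.
  by rewrite x0E; apply: phi_base.
pose f x : residue [set x0] := exist _ (lft x) (lft_res x).
have [_ isym same] := coset_system_axioms r.
have [_ _ samep] := coset_system_axioms p.
have base_phi g : parabolic r ord_max g -> exists2 t, gen (range p) t & phi t = g.
  apply: (gen_preimage phiM) => _ [j nj <-].
  have [k jk|jm] := unliftP ord_max j; last by case: nj.
  by exists (p k); [exists k | rewrite phip jk].
have res_eq (u v : residue [set x0]) : sval u = sval v -> u = v.
  case: u v => [u pu] [v pv] /= uv; case: v / uv pv => pv.
  by rewrite (Prop_irrelevance pu pv).
exists f; split; [rewrite -setTT_bijective; split=> // [x y _ _|z _] | exact: ty_lft |].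
- move=> /(congr1 sval) /= fxy; have [t pt xt] := rep x.
  apply: samep; last by apply: (@lift_inj _ ord_max); rewrite -!ty_lft fxy.
  by exists t; split=> //; apply/lftP => //; rewrite -fxy; apply/lftP.
- case: z => w [nw iw]; have [g [wg]] := iw x0 erefl.
  rewrite x0E => /base_phi[t pt tg].
  have [i wi|wm] := unliftP ord_max (ty w); last first.
    by case: nw; apply: same; [exact: iw | rewrite wm].
  exists (coset_at i pt) => //; apply: res_eq; apply: (same (lft _) w).
    2: by rewrite ty_lft wi.
  exists g; split=> //; rewrite -tg; apply/lftP => //; exact: rcoset_refl.
move=> x y; split=> [fxy|[t [xt yt]]]; last first.
  have pt : gen (range p) t by apply: coset_of_sub xt.
  by exists (phi t); split; apply/lftP.
have [irefl _ _] := coset_system_axioms r.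
have x0f z : inc x0 (lft z) by apply: isym; apply: (lft_res z).2.
have fl : flag ([set x0] `|` [set lft x; lft y]).
  move=> u v [->|[]->] [->|[]->] //; do ?exact: irefl; do ?exact/isym.
have [g _ gP] := flag_common helly fl.
have [|t pt tg] := base_phi g; first by rewrite -x0E; apply: gP; left.
by exists t; split; apply/lftP; rewrite // tg; apply: gP; right; [left|right].
Qed.

(** * Words in the Coxeter group [3,4,3] *)

(** Letters are natural numbers, so that words can be computed with. *)
Definition wval (K : groupType) (t : nat -> K) (w : seq nat) : K := \prod_(i <- w) t i.

Section WordValue.
Variables (K : groupType) (t : nat -> K).

Lemma wval_nil : wval t [::] = 1. Proof. exact: big_nil. Qed.

Lemma wval_cons i w : wval t (i :: w) = t i * wval t w. Proof. exact: big_cons. Qed.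

Lemma wval_cat w w' : wval t (w ++ w') = wval t w * wval t w'.
Proof. exact: big_cat. Qed.

Lemma wval1 i : wval t [:: i] = t i. Proof. exact: big_seq1. Qed.

Lemma wval_rcons w i : wval t (rcons w i) = wval t w * t i.
Proof. by rewrite -cats1 wval_cat wval1. Qed.

Lemma wval_rev w : (forall i, i \in w -> t i ^+ 2 = 1) -> wval t (rev w) = (wval t w)^-1.
Proof.
elim: w => [|i w IH] tt; first by rewrite wval_nil invg1.
rewrite rev_cons wval_rcons wval_cons invgM IH => [|j jw]; last first.
  by apply: tt; rewrite inE jw orbT.
by congr (_ * _); apply/esym/mulg1_eq; rewrite -expg2 tt ?mem_head.
Qed.

End WordValue.

(** Only the letters of [ls] are constrained, so that words can be compared in
    groups that realize a parabolic subgroup only. *)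
Definition coxeter_family (ls : seq nat) (K : groupType) (t : nat -> K) :=
  {in ls, forall i, t i ^+ 2 = 1} /\
  {in ls &, forall i j, i != j -> (t i * t j) ^+ m343 i j = 1}.

(** Quantifying over all groups makes the consequences of the Coxeter relations
    available in [G] and in presented groups alike. *)
Definition braid_equal (ls w w' : seq nat) :=
  forall (K : groupType) (t : nat -> K), coxeter_family ls t -> wval t w = wval t w'.

Fixpoint alt (i j n : nat) : seq nat := if n is n'.+1 then i :: alt j i n' else [::].

Lemma mem_alt i j n k : k \in alt i j n -> k = i \/ k = j.
Proof.
elim: n i j => //= n IH i j; rewrite inE => /predU1P[->|/IH[]]; by [left|right|left].
Qed.

(** By Tits, the Coxeter relations lead from a word to each of its reduced forms
    without ever lengthening it, so that a finite search is enough. *)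
Definition head_moves (w : seq nat) : seq (seq nat) :=
  if w is i :: j :: w' then
    if i == j then [:: w'] else
    let m := m343 i j in
    if take m w == alt i j m then [:: alt j i m ++ drop m w] else [::]
  else [::].

Fixpoint moves (w : seq nat) : seq (seq nat) :=
  head_moves w ++ (if w is i :: w' then [seq i :: u | u <- moves w'] else [::]).

Fixpoint reachable (n : nat) (seen new : seq (seq nat)) : seq (seq nat) :=
  if n is n'.+1 then
    let next := undup [seq u <- flatten (map moves new) | u \notin seen] in
    reachable n' (next ++ seen) next
  else seen.

Section Moves.
Variables (K : groupType) (t : nat -> K) (ls : seq nat).
Hypothesis cox : coxeter_family ls t.

Lemma coxeter_braid i j : i \in ls -> j \in ls -> i != j ->
  wval t (alt i j (m343 i j)) = wval t (alt j i (m343 i j)).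
Proof.
move=> li lj ij; have [tt braid] := cox.
have := braid _ _ li lj ij; move: (tt _ li) (tt _ lj); rewrite !expg2.
move=> /mulg1_eq iV /mulg1_eq jV.
have : m343 i j \in [:: 2; 3; 4]%N.
  by rewrite /m343; case: (minn i j) => [|[|[|a]]]; case: (maxn i j) => [|[|[|[|b]]]].
(* The relation splits into two alternating words of equal length, which are
   inverse to each other; inverting the first one reverses it. *)
rewrite !inE => /or3P[] /eqP ->;
  rewrite /= !wval_cons wval_nil !mulg1 !expgS expg0 !mulg1.
- by move=> /mulg1_eq; rewrite invgM iV jV.
- have -> : t i * t j * (t i * t j * (t i * t j)) = t i * (t j * t i) * (t j * (t i * t
  j)).
    by rewrite !mulgA.
  by move=> /mulg1_eq; rewrite !invgM iV jV !mulgA => ->.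
rewrite mulgA => /mulg1_eq; rewrite !invgM iV jV.
by rewrite !mulgA => ->.
Qed.

Lemma head_moves_sound w u : {subset w <= ls} -> u \in head_moves w ->
  {subset u <= ls} /\ wval t u = wval t w.
Proof.
case: w => [|i [|j w]] //= wl; have [tt _] := cox.
have li : i \in ls by apply: wl; rewrite mem_head.
have lj : j \in ls by apply: wl; rewrite !inE eqxx orbT.
have lw k : k \in w -> k \in ls by move=> kw; apply: wl; rewrite !inE kw !orbT.
case: eqP => [->|/eqP ij]; rewrite /= ?inE.
  by move=> /eqP ->; split=> //; rewrite !wval_cons mulgA -expg2 tt ?mul1g.
case: ifP => // /eqP tk; rewrite inE => /eqP ->; split.
  move=> k; rewrite mem_cat => /orP[|/mem_drop kw]; last by apply: wl.
  by case/mem_alt => ->.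
have mC : m343 j i = m343 i j by rewrite /m343 minnC maxnC.
by rewrite wval_cat -mC coxeter_braid 1?eq_sym // mC -tk -wval_cat cat_take_drop.
Qed.

Lemma moves_sound w u : {subset w <= ls} -> u \in moves w ->
  {subset u <= ls} /\ wval t u = wval t w.
Proof.
elim: w u => [|i w IH] u wl //=; rewrite mem_cat => /orP[hu|].
  exact: head_moves_sound.
have wl' : {subset w <= ls} by move=> k kw; apply: wl; rewrite inE kw orbT.
case/mapP => v /(IH _ wl')[vl vw] ->; split; last by rewrite !wval_cons vw.
by move=> k; rewrite inE => /predU1P[->|/vl//]; apply: wl; rewrite mem_head.
Qed.

Lemma reachable_sound n (seen new : seq (seq nat)) w :
  {in seen, forall u, {subset u <= ls} /\ wval t u = wval t w} ->
  {subset new <= seen} -> {in reachable n seen new, forall u, wval t u = wval t w}.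
Proof.
elim: n seen new => [|n IH] seen new seenP sub; first by move=> u /seenP[].
apply: IH => [u|u unew]; last by rewrite mem_cat unew.
rewrite mem_cat => /orP[|/seenP//]; rewrite mem_undup mem_filter => /andP[_].
case/flattenP => _ /mapP[v /sub /seenP[vl vw] ->] /(moves_sound vl)[ul ->].
by [].
Qed.

End Moves.

(** * Normal forms *)

(** [reps] lists representatives of the right cosets of the group on the letters
    [lower] in the group on the letters [k :: lower]. For shortest
    representatives, multiplication by a letter on the right gives another
    representative or amounts to multiplication by a letter on the left. For the
    tables below 20 rounds of moves are enough. *)
Definition coset_table (k : nat) (lower : seq nat) (reps : seq (seq nat)) :=
  ([::] \in reps) && all (fun v => all (fun j =>
    has (fun u => (u \in reps) || (if u is l :: u' then (l \in lower) && (u' \in reps)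
      else false))
      (reachable 20 [:: rcons v j] [:: rcons v j])) (k :: lower)) reps.

(** The letters of a word are pushed through the table one after the other;
    those that come out on the left form the word [q]. *)
Lemma coset_tableP (k : nat) (lower : seq nat) (reps : seq (seq nat)) : {in reps,
  forall v : seq nat, {subset v <= k :: lower}} ->
  coset_table k lower reps ->
  forall w : seq nat, {subset w <= k :: lower} ->
  exists q v : seq nat, [/\ {subset q <= lower}, v \in reps & braid_equal (k :: lower)
    w (q ++ v)].
Proof.
move=> repl /andP[nilr /allP tab] w; elim/last_ind: w => [|w j IH] wl.
  by exists [::], [::]; split.
have [|q [v [ql vr wqv]]] := IH.
  by move=> i iw; apply: wl; rewrite mem_rcons inE iw orbT.
have jl : j \in k :: lower by apply: wl; rewrite mem_rcons mem_head.
have /allP/(_ _ jl)/hasP[u ur uP] := tab _ vr.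
have uE (K : groupType) (t : nat -> K) : coxeter_family (k :: lower) t ->
  wval t u = wval t v * t j.
  move=> cox; rewrite -wval_rcons; apply: (reachable_sound cox _ _ ur);
    last by move=> ?; apply.
  move=> u'; rewrite inE => /eqP ->; split=> [i|]; last by reflexivity.
  by rewrite mem_rcons inE => /predU1P[->|/repl]; [exact: jl|apply].
move: uE uP; clear ur; move=> uE uP.
case: (boolP (u \in reps)) uP => [ur' _|_] /=.
  by exists q, u; split=> // K t cox;
    rewrite wval_rcons (wqv K t cox) !wval_cat uE // mulgA.
case: u uE => // l u uE /andP[ll ur'].
exists (rcons q l), u; split=> // [i|K t cox].
  by rewrite mem_rcons inE => /predU1P[->//|/ql].
have := uE K t cox; rewrite wval_rcons (wqv K t cox) !wval_cat wval_rcons wval_cons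
  -!mulgA.
by move=> <-.
Qed.

(** Normal forms for the group on the letters of the increasing sequence [ls],
    along the chain of the subgroups on its tails. *)
Fixpoint normal_forms (reps : nat -> seq (seq nat)) (ls : seq nat) : seq (seq nat) :=
  if ls is k :: ls' then [seq q ++ v | q <- normal_forms reps ls', v <- reps k]
  else [:: [::]].

Lemma braid_equalS ls ls' w w' : {subset ls <= ls'} ->
  braid_equal ls w w' -> braid_equal ls' w w'.
Proof.
move=> sub ww K t [tt cox]; apply: ww; split=> [i /sub/tt//|i j /sub il /sub jl].
exact: cox.
Qed.

(** * The reflection representation *)

(** Coordinates with respect to the fundamental weights. *)
Definition weight := (int * int * int * int)%type.

(** The reflection of index [i] subtracts from [x] its [i]-th coordinate times
    the [i]-th row of the Cartan matrix of type F4. The orbit of [fundamental 0]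
    is the set of vertices of a 24-cell, on which the reflections act as on
    [V]. *)
Definition reflect_weight (i : nat) (x : weight) : weight :=
  let: (a, b, c, d) := x in
  match i with
  | 0 => (- a, a + b, c, d)
  | 1 => (a + b, - b, c + b + b, d)
  | 2 => (a, b + c, - c, c + d)
  | _ => (a, b, c + d, - d)
  end%R.

Definition act (w : seq nat) (x : weight) : weight :=
  foldl (fun y i => reflect_weight i y) x w.

Definition fundamental (k : nat) : weight :=
  match k with
  | 0 => (1, 0, 0, 0) | 1 => (0, 1, 0, 0) | 2 => (0, 0, 1, 0) | _ => (0, 0, 0, 1)
  end%R.

Lemma reflect_weightK i : involutive (reflect_weight i).
Proof.
by case: i => [|[|[|i]]] [[[a b] c] d] /=; congr (_, _, _, _); lia.
Qed.

Lemma reflect_weight_braid (i j : 'I_4) x : i != j ->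
  act (flatten (nseq (m343 i j) [:: nat_of_ord i; nat_of_ord j])) x = x.
Proof.
case: i j x => [[|[|[|[|//]]]] ?] [[|[|[|[|//]]]] ?] [[[a b] c] d] // _;
  rewrite /act /m343 /=; congr (_, _, _, _); lia.
Qed.

(** * Tables of coset representatives *)

(** The shortest words leading to the 24, 8, 3 and 2 weights in the orbits of
    the fundamental weights under the groups on the letters from [k] on. *)
Definition reps_343 (k : nat) : seq (seq nat) :=
  (match k with
   | 0 =>
      [:: [::]; [:: 0]; [:: 0; 1]; [:: 0; 1; 2]; [:: 0; 1; 2; 1];
         [:: 0; 1; 2; 3]; [:: 0; 1; 2; 1; 0]; [:: 0; 1; 2; 1; 3];
         [:: 0; 1; 2; 1; 0; 3]; [:: 0; 1; 2; 1; 3; 2];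
         [:: 0; 1; 2; 1; 0; 3; 2]; [:: 0; 1; 2; 1; 3; 2; 1];
         [:: 0; 1; 2; 1; 0; 3; 2; 1]; [:: 0; 1; 2; 1; 3; 2; 1; 0];
         [:: 0; 1; 2; 1; 0; 3; 2; 1; 0]; [:: 0; 1; 2; 1; 0; 3; 2; 1; 2];
         [:: 0; 1; 2; 1; 0; 3; 2; 1; 0; 2]; [:: 0; 1; 2; 1; 0; 3; 2; 1; 2; 3];
         [:: 0; 1; 2; 1; 0; 3; 2; 1; 0; 2; 1];
         [:: 0; 1; 2; 1; 0; 3; 2; 1; 0; 2; 3];
         [:: 0; 1; 2; 1; 0; 3; 2; 1; 0; 2; 1; 3];
         [:: 0; 1; 2; 1; 0; 3; 2; 1; 0; 2; 1; 3; 2];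
         [:: 0; 1; 2; 1; 0; 3; 2; 1; 0; 2; 1; 3; 2; 1];
         [:: 0; 1; 2; 1; 0; 3; 2; 1; 0; 2; 1; 3; 2; 1; 0]]
   | 1 =>
      [:: [::]; [:: 1]; [:: 1; 2]; [:: 1; 2; 1]; [:: 1; 2; 3];
         [:: 1; 2; 1; 3]; [:: 1; 2; 1; 3; 2]; [:: 1; 2; 1; 3; 2; 1]]
   | 2 =>
      [:: [::]; [:: 2]; [:: 2; 3]]
   | _ =>
      [:: [::]; [:: 3]]
   end)%N.

(** The same for the octahedral facet, with orbits of 6, 4 and 2 weights. *)
Definition reps_34 (k : nat) : seq (seq nat) :=
  (match k with
   | 0 =>
      [:: [::]; [:: 0]; [:: 0; 1]; [:: 0; 1; 2]; [:: 0; 1; 2; 1];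
         [:: 0; 1; 2; 1; 0]]
   | 1 =>
      [:: [::]; [:: 1]; [:: 1; 2]; [:: 1; 2; 1]]
   | _ =>
      [:: [::]; [:: 2]]
   end)%N.

Fixpoint chain_tables (reps : nat -> seq (seq nat)) (ls : seq nat) : bool :=
  if ls is k :: ls' then
    [&& coset_table k ls' (reps k), all (all (mem ls)) (reps k),
        uniq [seq act v (fundamental k) | v <- reps k] & chain_tables reps ls']
  else true.

Lemma tables_343 : chain_tables reps_343 (iota 0 4).
Proof. by vm_compute. Qed.

Lemma tables_34 : chain_tables reps_34 (iota 0 3).
Proof. by vm_compute. Qed.

Lemma map_uniq_inj (T1 T2 : eqType) (f : T1 -> T2) (s : seq T1) :
  uniq (map f s) -> {in s &, injective f}.
Proof.
elim: s => // x s IH /= /andP[fx /IH inj] a b; rewrite !inE.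
move=> /predU1P[->|sa] /predU1P[->|sb] // ab; last exact: inj.
- by case/negP: fx; rewrite ab map_f.
by case/negP: fx; rewrite -ab map_f.
Qed.

Lemma act_cat w w' x : act (w ++ w') x = act w' (act w x).
Proof. exact: foldl_cat. Qed.

Lemma act_revK w x : act (rev w) (act w x) = x.
Proof.
elim: w x => //= i w IH x; rewrite rev_cons -cats1 act_cat IH.
exact: reflect_weightK.
Qed.

Lemma act_inj w : injective (act w).
Proof. exact: can_inj (act_revK w). Qed.

Lemma act_fundamental (k : nat) (w : seq nat) : k < 4 ->
  {in w, forall i, i != k /\ i < 4} -> act w (fundamental k) = fundamental k.
Proof.
move=> k4; elim: w => //= i w IH iw; rewrite -[RHS]IH; last first.
  by move=> j jw; apply: iw; rewrite inE jw orbT.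
have [ik i4] := iw i (mem_head _ _); congr (act _ _).
by case: k k4 ik {iw IH} => [|[|[|[|]]]] //; case: i i4 => [|[|[|[|]]]].
Qed.

Lemma chain_decompose reps k ls (w : seq nat) :
  chain_tables reps (k :: ls) -> {subset w <= k :: ls} ->
  exists q v : seq nat, [/\ {subset q <= ls}, v \in reps k, {subset v <= k :: ls}
    & braid_equal (k :: ls) w (q ++ v)].
Proof.
case/and4P=> tab /allP repl _ _ wl.
have repP v : v \in reps k -> {subset v <= k :: ls} by move=> /repl /allP vl i /vl.
have [q [v [ql vr wqv]]] := coset_tableP repP tab wl.
by exists q, v; split=> //; apply: repP.
Qed.

Lemma chain_inj reps k ls : chain_tables reps (k :: ls) ->
  {in reps k &, injective (fun v => act v (fundamental k))}.
Proof. by case/and4P=> _ _ /map_uniq_inj. Qed.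

Lemma chain_tail reps k ls : chain_tables reps (k :: ls) -> chain_tables reps ls.
Proof. by case/and4P. Qed.

Lemma chain_sub reps k ls (v : seq nat) : chain_tables reps (k :: ls) ->
  v \in reps k -> {subset v <= k :: ls}.
Proof. by case/and4P=> _ /allP repl _ _ /repl /allP vl i /vl. Qed.

Lemma normal_form_exists reps ls w : chain_tables reps ls -> {subset w <= ls} ->
  exists2 u, u \in normal_forms reps ls & braid_equal ls w u.
Proof.
elim: ls w => [|k ls IH] w /=.
  case: w => [_ _|i w _ wl]; first by exists [::]; rewrite ?mem_head.
  by have := wl i (mem_head _ _).
case/and4P=> tab /allP repl _ /IH{}IH wl.
have [|q [v [ql vr wqv]]] := coset_tableP _ tab wl.
  by move=> v /repl /allP vl i /vl.
have [u uq qu] := IH _ ql; exists (u ++ v); first exact: allpairs_f.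
move=> K t cox; rewrite (wqv K t cox) !wval_cat; congr (_ * _).
by apply: (braid_equalS (ls := ls)) qu _ _ cox => i il; rewrite inE il orbT.
Qed.

Lemma normal_forms_sub reps ls u : chain_tables reps ls ->
  u \in normal_forms reps ls -> {subset u <= ls}.
Proof.
elim: ls u => [|k ls IH] u /= tab; first by rewrite inE => /eqP ->.
case/and4P: tab => _ /allP repl _ /IH{}IH.
case/allpairsP => -[q v] /= [/IH ql /repl/allP vl ->] i.
by rewrite mem_cat => /orP[/ql il|/vl//]; rewrite inE il orbT.
Qed.

(** Since the words on the smaller letters fix the weight of index [k], a normal
    form is recovered from its action on the fundamental weights, one coset
    representative at a time. *)
Lemma normal_forms_inj reps ls : chain_tables reps ls -> uniq ls -> all (ltn^~ 4) ls ->
  {in normal_forms reps ls &, forall u u', act u =1 act u' -> u = u'}.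
Proof.
elim: ls => [|k ls IH] /= tab; first by move=> _ _ u u' /[!inE] /eqP -> /eqP ->.
case/and4P: tab => _ _ inj tab /andP[kls uls] /andP[k4 ls4] u u'.
case/allpairsP => -[q v] /= [qn vr ->]; case/allpairsP => -[q' v'] /= [qn' vr' ->] uu'.
have fixk p : p \in normal_forms reps ls -> act p (fundamental k) = fundamental k.
  move=> /(normal_forms_sub tab) pl; apply: act_fundamental => // i /pl il.
  by split; [apply: contraNneq kls => <- | exact: (allP ls4)].
have vv' : v = v'.
  apply: (map_uniq_inj inj vr vr').
  by have := uu' (fundamental k); rewrite !act_cat (fixk _ qn) (fixk _ qn').
rewrite vv' in uu' *; congr (_ ++ _); apply: IH => // x.
by apply: (@act_inj v'); rewrite -!act_cat.
Qed.

Lemma normal_forms_uniq reps ls : chain_tables reps ls -> uniq ls -> all (ltn^~ 4) ls ->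
  uniq (normal_forms reps ls).
Proof.
elim: ls => //= k ls IH /and4P[_ _ inj tab] /andP[kls uls] /andP[k4 ls4].
apply: allpairs_uniq; [exact: IH | exact: map_uniq inj |].
move=> [q v] [q' v'] /= /allpairsP[[a b] /= [aq bv [-> ->]]] /allpairsP[[a' b'] /= [aq'
  bv' [-> ->]]].
rewrite /uncurry /= => e.
have fixk p : p \in normal_forms reps ls -> act p (fundamental k) = fundamental k.
  move=> /(normal_forms_sub tab) pl; apply: act_fundamental => // i /pl il.
  by split; [apply: contraNneq kls => <- | exact: (allP ls4)].
have bb : b = b'.
  apply: (map_uniq_inj inj bv bv').
  by have := congr1 (act^~ (fundamental k)) e; rewrite !act_cat (fixk _ aq) (fixk _ aq').
move: e; rewrite bb => e; have := congr1 size e; rewrite !size_cat => /addIn saa.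
by move/eqP: e; rewrite eqseq_cat // => /andP[/eqP ->].
Qed.

Lemma size_normal_forms reps ls :
  size (normal_forms reps ls) = (\prod_(k <- ls) size (reps k))%N.
Proof.
elim: ls => [|k ls IH] /=; first by rewrite big_nil.
by rewrite size_allpairs IH big_cons mulnC.
Qed.

(** * The action of the Coxeter group on weights *)

Definition letters_of (w : word 'I_4) : seq nat := [seq nat_of_ord l.1 | l <- w].

Lemma letters_wseq w : {subset w <= iota 0 4} -> letters_of (wseq 3 w) = w.
Proof.
move=> w4; rewrite /letters_of /wseq -map_comp -[RHS]map_id.
by apply/eq_in_map => i /w4; rewrite mem_iota /= => i4; rewrite inordK.
Qed.

Lemma letters_cat u v : letters_of (u ++ v) = letters_of u ++ letters_of v.
Proof. exact: map_cat. Qed.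

Lemma letters_wexp w n : letters_of (wexp w n) = flatten (nseq n (letters_of w)).
Proof. by rewrite /letters_of map_flatten map_nseq. Qed.

(** Each relator acts as the identity on weights. *)
Lemma weq_act u v : weq (coxeter_relator m343) u v ->
  act (letters_of u) =1 act (letters_of v).
Proof.
elim=> {u v} [//|u v _ uv x|u v w _ uv _ vw x|u v i b x|u v r rR x].
- by rewrite uv.
- by rewrite uv vw.
- by rewrite !letters_cat !act_cat /= reflect_weightK.
rewrite !letters_cat !act_cat; congr (act _ _); case: rR => [i|i j ij].
  by rewrite letters_wexp /= reflect_weightK.
by rewrite letters_wexp letters_cat /=; apply: reflect_weight_braid.
Qed.

(** * Vertices of the 24-cell and of its facets *)

(** The powers of the Coxeter element move the base vertex along a Petrie
    polygon, a 12-gon; the sixth power is the central involution. *)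
Definition petrie (n : nat) : seq nat := flatten (nseq n (iota 0 4)).

Definition same_vertex (w w' : seq nat) : bool :=
  act w (fundamental 0) == act w' (fundamental 0).

Definition in_vertex_orbit (reps : nat ->
  seq (seq nat)) (ls : seq nat) (x v : seq nat) : bool :=
  has (fun q => same_vertex (x ++ q) v) (normal_forms reps ls).

(** Words leading from the base vertex to one vertex in each orbit of its
    stabilizer: the vertex itself, a neighbour, two vertices at intermediate
    distances, and the antipode. *)
Definition pairs_343 : seq (seq nat) :=
  ([:: [::]; [:: 0]; petrie 3; petrie 4; petrie 6])%N.

(** The base vertex, a neighbour and the opposite vertex of an octahedron. *)
Definition pairs_34 : seq (seq nat) := ([:: [::]; [:: 0]; [:: 0; 1; 2; 1; 0]])%N.

Lemma pairs_343_complete :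
  all (fun v => has (in_vertex_orbit reps_343 (iota 1 3) ^~ v) pairs_343) (reps_343 0).
Proof. by vm_compute. Qed.

Lemma pairs_34_complete :
  all (fun v => has (in_vertex_orbit reps_34 (iota 1 2) ^~ v) pairs_34) (reps_34 0).
Proof. by vm_compute. Qed.

(** The representatives are sorted by length, which is between 0 and 15; a
    vertex at length [l] has its antipode at length [15 - l], so the first half
    contains one vertex of each antipodal pair. *)
Definition half_vertices : seq (seq nat) := take 12 (reps_343 0).

Lemma half_vertices_complete :
  all (fun v => has (fun u => same_vertex u v || same_vertex (u ++ petrie 6) v)
    half_vertices)
    (reps_343 0).
Proof. by vm_compute. Qed.

Lemma half_vertices_uniq :
  uniq [seq act u (fundamental 0) | u <- half_vertices].
Proof. by vm_compute. Qed.

Lemma half_vertices_opp :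
  all (fun u => all (fun v => ~~ same_vertex u (v ++ petrie 6)) half_vertices)
    half_vertices.
Proof. by vm_compute. Qed.

(** By transitivity it is enough to compare with the antipode of the base
    vertex. *)
Lemma facet_antipode_free : ~~ has (same_vertex (petrie 6)) (reps_34 0).
Proof. by vm_compute. Qed.

Lemma petrie_vertices :
  [/\ ~~ same_vertex [:: 0]%N [::], ~~ same_vertex [:: 0]%N (petrie 6),
     ~~ same_vertex [:: 0; 1; 2; 1; 0]%N [::], ~~ same_vertex [:: 0; 1; 2; 1;
       0]%N (petrie 6)
   & all (fun i => ~~ same_vertex (petrie i) [::] && ~~ same_vertex (petrie i) (petrie 6))
       [:: 3; 4]%N].
Proof. by split; vm_compute. Qed.

(** A normal form that acts trivially on weights is empty. *)
Lemma trivial_reflection_word reps ls (w : seq nat) : chain_tables reps ls ->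
  uniq ls -> {subset ls <= iota 0 4} -> {subset w <= ls} ->
  (forall u, {subset u <= ls} -> braid_equal ls w u -> act u =1 id) ->
  braid_equal ls w [::].
Proof.
move=> tab uls l4 wl wid; have [u un wu] := normal_form_exists tab wl.
have ls4 : all (ltn^~ 4) ls by apply/allP => i /l4; rewrite mem_iota.
have nil_nf : [::] \in normal_forms reps ls.
  elim: ls tab {uls l4 wl wid wu un ls4} => // k ls IH tab /=;
    have nf := IH (chain_tail tab).
  apply/allpairsP; exists ([::], [::]); split=> //=.
  by have /and4P[/andP[]] := tab.
suff <- : u = [::] by [].
apply: (normal_forms_inj tab uls ls4) => // x; rewrite wid //.
exact: normal_forms_sub un.
Qed.

(** * The group of the 24-cell *)

Section WordValues.
Variables (X : choiceType) (G : groupType) (f : X -> G).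

Lemma weval_exp w k : weval f (wexp w k) = weval f w ^+ k.
Proof.
elim: k => [|k IH]; first by rewrite /wexp /= /weval big_nil.
by rewrite /wexp /= -/(wexp w k) weval_cat IH expgS.
Qed.

Lemma weval_letter x : weval f (wgen x) = f x.
Proof. by rewrite /weval big_seq1. Qed.

Lemma weval_winv w : weval f (winv w) = (weval f w)^-1.
Proof.
elim: w => [|[x b] w IH]; first by rewrite /winv /weval !big_nil invg1.
rewrite -cat1s winv_cat !weval_cat IH invgM; congr (_ * _).
by rewrite /winv /weval /= !big_seq1 /=; case: b => /=; rewrite ?invgK.
Qed.

End WordValues.

Lemma coxeter_relatorsP n (m : nat -> nat -> nat) (G : groupType) (f : 'I_n -> G) :
  (forall i, f i ^+ 2 = 1) -> (forall i j : 'I_n, i != j -> (f i * f j) ^+ m i j = 1) ->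
  forall w, coxeter_relator m w -> weval f w = 1.
Proof.
move=> sq br w [i|i j ij]; first by rewrite weval_exp weval_letter.
by rewrite weval_exp weval_cat !weval_letter br.
Qed.

Section Cell24.
Variable P : cs_polytope 3.
Hypothesis hP : is_24cell P.

Local Notation G := (pgroup P).
Local Notation V := (vertex (tau P)).

(** The generators of [G], indexed by the letters of words. *)
Definition tau_nat (i : nat) : G := tau P (inord i).

Lemma tau_nat_ord (i : 'I_4) : tau_nat i = tau P i.
Proof. by rewrite /tau_nat inord_val. Qed.

Lemma tau_nat_coxeter : coxeter_family (iota 0 4) tau_nat.
Proof.
have rel w : coxeter_relator m343 w -> weval (tau P) w = 1.
  by move=> rw; apply/hP.1; have := weq_rel [::] [::] rw; rewrite cats0.
split=> [i _|i j].
  by have := rel _ (cox_square _ (inord i)); rewrite weval_exp weval_letter.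
rewrite !mem_iota /= => i4 j4 ij.
have ij' : inord i != inord j :> 'I_4 by rewrite -val_eqE /= !inordK.
by have := rel _ (cox_braid _ ij'); rewrite weval_exp weval_cat !weval_letter !inordK.
Qed.

Lemma tau_nat_sq i : tau_nat i ^+ 2 = 1.
Proof. by case: (tau_string_C P) => _ /(_ (inord i))[]. Qed.

Lemma tau_natV i : (tau_nat i)^-1 = tau_nat i.
Proof. by apply: mulg1_eq; rewrite -expg2 tau_nat_sq. Qed.

Lemma wval_gt w : wval tau_nat w = weval (tau P) (wseq 3 w).
Proof. by rewrite /wval /weval /wseq big_map. Qed.

Lemma wval_act w w' : {subset w <= iota 0 4} -> {subset w' <= iota 0 4} ->
  wval tau_nat w = wval tau_nat w' -> act w =1 act w'.
Proof.
move=> w4 w4' ww' x.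
have : weq (coxeter_relator m343) (wseq 3 w ++ wseq 3 (rev w')) [::].
  apply/hP.1; rewrite weval_cat -!wval_gt ww' wval_rev ?mulgV // => i _.
  exact: tau_nat_sq.
move/weq_act => /(_ x); rewrite letters_cat !letters_wseq ?act_cat //; last first.
  by move=> i; rewrite mem_rev => /w4'.
by move=> e; have := act_revK (rev w') (act w x); rewrite revK e.
Qed.

Lemma gen_word (ls : seq nat) (J : set 'I_4) g : {subset ls <= iota 0 4} ->
  (forall i : 'I_4, J i -> nat_of_ord i \in ls) ->
  gen (tau P @` J) g -> exists2 w, {subset w <= ls} & wval tau_nat w = g.
Proof.
move=> l4 Jl; apply: (gen_ind (Q := fun g =>
  exists2 w, {subset w <= ls} & wval tau_nat w = g)).
- by exists [::]; rewrite ?wval_nil.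
- move=> _ _ [u ul <-] [v vl <-]; exists (u ++ rev v).
    by move=> i; rewrite mem_cat mem_rev => /orP[/ul|/vl].
  by rewrite wval_cat wval_rev // => i _; apply: tau_nat_sq.
move=> _ [i /Jl il <-]; exists [:: nat_of_ord i]; last by rewrite wval1 tau_nat_ord.
by move=> j; rewrite inE => /eqP ->.
Qed.

Lemma word_gen (J : set 'I_4) w : {in w, forall i, i < 4 /\ J (inord i)} ->
  gen (tau P @` J) (wval tau_nat w).
Proof.
elim: w => [|i w IH] wJ; first by rewrite wval_nil; apply: gen1.
rewrite wval_cons; apply: genM; last first.
  by apply: IH => j jw; apply: wJ; rewrite inE jw orbT.
by apply: sub_gen; have [_ Ji] := wJ _ (mem_head _ _); exists (inord i).
Qed.

Lemma all_word g : exists2 w, {subset w <= iota 0 4} & wval tau_nat w = g.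
Proof.
apply: (@gen_word _ setT) => //.
  by move=> i _; rewrite mem_iota /=.
by case: (tau_string_C P) => ->.
Qed.

Lemma vertex_act_base g h :
  vertex_act (base_vertex (tau P)) g = vertex_act (base_vertex (tau P)) h <->
  parabolic (tau P) ord0 (g / h).
Proof.
split=> [/(congr1 sval) /= e|gh].
  by apply/rcosetP; rewrite -e; apply: rcoset_refl.
by apply: val_inj => /=; apply/rcoset_eq/rcosetP.
Qed.

Definition vertex_of_word (w : seq nat) : V := vertex_act (base_vertex (tau P)) (wval
  tau_nat w).

Lemma base_stabilizer g : parabolic (tau P) ord0 g <->
  exists2 q, {subset q <= iota 1 3} & wval tau_nat q = g.
Proof.
split.
  apply: gen_word; first by move=> i; rewrite !mem_iota; lia.
  by move=> i /eqP i0; rewrite mem_iota /= ltn_ord andbT lt0n.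
case=> q q3 <-; apply: word_gen => i /q3; rewrite mem_iota => /andP[i1 i4].
split=> //= i0; have := congr1 val i0; rewrite /= inordK //; lia.
Qed.

(** The stabilizer of the base vertex and that of the weight [fundamental 0] are
    both generated by the letters other than 0, so vertices can be compared by
    computing with weights. *)
Lemma vertex_of_word_act w w' : {subset w <= iota 0 4} -> {subset w' <= iota 0 4} ->
  vertex_of_word w = vertex_of_word w' <-> act w (fundamental 0) = act w' (fundamental 0).
Proof.
move=> w4 w4'; split=> [/vertex_act_base/base_stabilizer[q q3 qE]|].
  have qs : {subset q <= iota 0 4} by move=> i /q3; rewrite !mem_iota; lia.
  have -> := wval_act (w := w) (w' := q ++ w') w4.
  - rewrite act_cat; congr (act _ _); apply: act_fundamental => // i /q3.
    by rewrite mem_iota; lia.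
  - by move=> i; rewrite mem_cat => /orP[/qs|/w4'].
  by rewrite wval_cat qE mulgVK.
have fixq q : {subset q <= iota 1 3} -> act q (fundamental 0) = fundamental 0.
  by move=> q3; apply: act_fundamental => // i /q3; rewrite mem_iota; lia.
have [q [v [q3 vr v4 wqv]]] := chain_decompose tables_343 w4.
have [q' [v' [q3' vr' v4' wqv']]] := chain_decompose tables_343 w4'.
have sub u p : {subset p <= iota 1 3} -> {subset u <= iota 0 4} ->
  {subset p ++ u <= iota 0 4}.
  move=> p3 u4 i; rewrite mem_cat => /orP[/p3|/u4 //].
  by rewrite !mem_iota; lia.
have wE := wqv _ _ tau_nat_coxeter; have wE' := wqv' _ _ tau_nat_coxeter.
rewrite (wval_act w4 (sub _ _ q3 v4) wE) (wval_act w4' (sub _ _ q3' v4') wE').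
rewrite !act_cat (fixq q) // (fixq q') // => e; have vv' := chain_inj tables_343 vr vr' e.
apply/vertex_act_base/base_stabilizer; exists (q ++ rev q').
  by move=> i; rewrite mem_cat mem_rev => /orP[/q3|/q3'].
rewrite wE wE' vv' !wval_cat mulgKA wval_rev // => i _; exact: tau_nat_sq.
Qed.

Lemma same_vertexP w w' : {subset w <= iota 0 4} -> {subset w' <= iota 0 4} ->
  reflect (vertex_of_word w = vertex_of_word w') (same_vertex w w').
Proof. by move=> w4 w4'; apply: (equivP eqP); split=> /vertex_of_word_act; apply. Qed.

(** Normal forms are reached by the Coxeter relations among the letters of [ls]
    alone, and the value of a word in [G] determines its action on weights. *)
Lemma trivial_word reps (ls w : seq nat) : chain_tables reps ls -> uniq ls ->
  {subset ls <= iota 0 4} -> {subset w <= ls} -> wval tau_nat w = 1 ->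
    braid_equal ls w [::].
Proof.
move=> tab uls l4 wl w1; apply: (trivial_reflection_word tab uls l4 wl) => u ul wu x.
have := wval_act (w := u) (w' := [::]) _ _ _ x; apply=> // [i /ul/l4 //|].
rewrite wval_nil -w1 (wu _ tau_nat) //.
have [sq br] := tau_nat_coxeter; split=> [i /l4/sq //|i j /l4 il /l4 jl]; exact: br.
Qed.

Lemma petrie_sub n : {subset petrie n <= iota 0 4}.
Proof. by move=> i /flattenP[s]; rewrite mem_nseq => /andP[_ /eqP ->]. Qed.

Lemma wval_petrie n : wval tau_nat (petrie n) = (tau_nat 0 * tau_nat 1 * tau_nat 2 *
  tau_nat 3) ^+ n.
Proof.
elim: n => [|n IH]; first by rewrite wval_nil.
by rewrite /petrie /= -/(petrie n) !wval_cons IH expgS !mulgA.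
Qed.

Lemma alpha_petrie : alpha P = wval tau_nat (petrie 6).
Proof. by rewrite wval_petrie hP.2. Qed.

Lemma vertex_of_word_alpha w : vertex_act (vertex_of_word w) (alpha P) = vertex_of_word
  (w ++ petrie 6).
Proof. by rewrite /vertex_of_word -vertex_actM wval_cat alpha_petrie. Qed.

Lemma vertex_of_word_cat w w' : vertex_of_word (w ++ w') = vertex_act (vertex_of_word
  w) (wval tau_nat w').
Proof. by rewrite /vertex_of_word -vertex_actM wval_cat. Qed.

Lemma vertex_of_word_stable q w : {subset q <= iota 1 3} ->
  vertex_of_word (q ++ w) = vertex_of_word w.
Proof.
move=> q3; rewrite vertex_of_word_cat /vertex_of_word; congr vertex_act.
rewrite -[RHS]vertex_act1; apply/vertex_act_base/base_stabilizer.
by exists q; rewrite // invg1 mulg1.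
Qed.

Lemma vertex_of_word_nil : vertex_of_word [::] = base_vertex (tau P).
Proof. by rewrite /vertex_of_word wval_nil vertex_act1. Qed.

Lemma vertex_of_word_surj (F : V) : exists2 w, {subset w <= iota 0 4} & F =
  vertex_of_word w.
Proof.
case: F => F Fv; have [g _ gF] := set_mem Fv.
have [w w4 wg] := all_word g; exists w => //.
by apply: val_inj; rewrite /= wg gF.
Qed.

(** A vertex is given by a coset representative, and for each of the finitely
    many representatives the orbit is found by computing with weights. *)
Lemma vertex_orbits_gen reps (ls : seq nat) (xs : seq (seq nat)) w :
  chain_tables reps (0%N :: ls) -> {subset 0%N :: ls <= iota 0 4} ->
    {subset ls <= iota 1 3} ->
  all (fun v => has (in_vertex_orbit reps ls ^~ v) xs) (reps 0) ->
  {in xs, forall x : seq nat, {subset x <= 0%N :: ls}} ->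
  {subset w <= 0%N :: ls} ->
  exists x q, [/\ x \in xs, {subset q <= ls} & vertex_of_word w = vertex_of_word (x ++
    q)].
Proof.
move=> tab l4 l3 orb xsl wl.
have [q [v [ql vr vl wqv]]] := chain_decompose tab wl.
have cox : coxeter_family (0%N :: ls) tau_nat.
  by have [sq br] := tau_nat_coxeter; split=> [i /l4/sq //|i j /l4 il /l4 jl]; apply: br.
have /allP/(_ v vr)/hasP[x xxs /hasP[u un xuv]] := orb.
have ul := normal_forms_sub (chain_tail tab) un.
have sub (p : seq nat) : {subset p <= ls} -> {subset p <= 0%N :: ls}.
  by move=> pl i /pl; rewrite inE orbC => ->.
have q3 : {subset q <= iota 1 3} by move=> i iq; apply: l3; apply: ql.
have -> : vertex_of_word w = vertex_of_word v by rewrite -(vertex_of_word_stable v q3)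
  /vertex_of_word (wqv _ _ cox).
exists x, u; split=> //.
symmetry; apply/same_vertexP => //; last by move=> i iv; apply: l4; apply: vl.
move=> i; rewrite mem_cat => /orP[ix|iu]; apply: l4.
  exact: xsl ix.
exact: (sub u).
Qed.

Lemma vertex_orbits w : {subset w <= iota 0 4} ->
  exists x q, [/\ x \in pairs_343, {subset q <= iota 1 3} & vertex_of_word w =
    vertex_of_word (x ++ q)].
Proof.
apply: (vertex_orbits_gen tables_343 _ _ pairs_343_complete) => // x.
rewrite !inE => /orP[/eqP->|/orP[/eqP->|/or3P[] /eqP->]] //; try exact: petrie_sub.
by move=> i; rewrite !inE => ->.
Qed.

Lemma facet_vertex_orbits w : {subset w <= iota 0 3} ->
  exists x q, [/\ x \in pairs_34, {subset q <= iota 1 2} & vertex_of_word w =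
    vertex_of_word (x ++ q)].
Proof.
apply: (vertex_orbits_gen tables_34 _ _ pairs_34_complete) => //.
- by move=> i; rewrite ?(inE, mem_iota); lia.
- by move=> i; rewrite ?(inE, mem_iota); lia.
by move=> x; rewrite !inE => /or3P[] /eqP -> i; rewrite ?inE; lia.
Qed.

Lemma facet_antipode w : {subset w <= iota 0 3} ->
  vertex_of_word w <> vertex_of_word (petrie 6).
Proof.
move=> w3 e; have [q [v [q2 vr v3 wqv]]] := chain_decompose tables_34 w3.
have s34 (p : seq nat) : {subset p <= iota 0 3} -> {subset p <= iota 0 4}.
  by move=> pl i /pl; rewrite !mem_iota; lia.
have cox : coxeter_family (iota 0 3) tau_nat.
  by have [sq br] := tau_nat_coxeter; split=> [i|i j] il; [apply: sq|move=> jl;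
    apply: br];
    move: il; rewrite ?(mem_iota _ _ j) ?mem_iota; try lia; move: jl; rewrite mem_iota;
      lia.
have := facet_antipode_free; case/negP; apply/hasP; exists v => //.
apply/same_vertexP; [exact: petrie_sub | exact: s34 |].
rewrite -e /vertex_of_word (wqv _ _ cox) -/(vertex_of_word _) vertex_of_word_stable //
  => i /q2.
by rewrite ?(inE, mem_iota); lia.
Qed.

Lemma same_vertexF w w' : {subset w <= iota 0 4} -> {subset w' <= iota 0 4} ->
  ~~ same_vertex w w' -> vertex_of_word w <> vertex_of_word w'.
Proof. by move=> w4 w4' /negP n /same_vertexP h; apply: n; apply: h. Qed.

End Cell24.

(** * The group of order 2 and the dihedral groups *)

Definition sign_group : Type := bool.
HB.instance Definition _ := Choice.on sign_group.
HB.instance Definition _ := isGroup.Build sign_group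
  addbA addFb addbF addbb addbb.

Lemma sign_mulE (x y : sign_group) : x * y = x (+) y. Proof. by []. Qed.

Section Dihedral.
Variable s : nat.
Hypothesis hs : 2 <= s.

(** The vertices of a [2 s]-gon that are joined, alternately, by edges of two
    kinds; the dihedral group acts by exchanging the ends of the edges. *)
Definition gon : Type := ('Z_s * bool)%type.
HB.instance Definition _ := Finite.on gon.

Definition flip_a (x : gon) : gon := (x.1, ~~ x.2).
Definition flip_b (x : gon) : gon :=
  if x.2 then ((x.1 + 1)%R, false) else ((x.1 - 1)%R, true).

Lemma flip_aK : involutive flip_a. Proof. by case=> k []. Qed.

Lemma flip_bK : involutive flip_b.
Proof. by case=> k []; rewrite /flip_b /= ?GRing.addrK ?GRing.subrK. Qed.

Definition dih_a : {perm gon} := perm (can_inj flip_aK).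
Definition dih_b : {perm gon} := perm (can_inj flip_bK).

Lemma dih_a2 : dih_a ^+ 2 = 1.
Proof. by apply/permP => x; rewrite expg2 permM perm1 !permE flip_aK. Qed.

Lemma dih_b2 : dih_b ^+ 2 = 1.
Proof. by apply/permP => x; rewrite expg2 permM perm1 !permE flip_bK. Qed.

Lemma dih_rotation m x : ((dih_a * dih_b) ^+ m) x =
  (if x.2 then (x.1 - m%:R)%R else (x.1 + m%:R)%R, x.2) :> gon.
Proof.
elim: m x => [|m IH] [k b]; first by rewrite perm1 /= GRing.subr0 GRing.addr0 if_same.
rewrite expgS permM IH permM !permE /flip_b /flip_a /=.
by case: b => /=; rewrite GRing.mulrS ?GRing.opprD GRing.addrA.
Qed.

Lemma dih_ab : (dih_a * dih_b) ^+ s = 1.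
Proof.
apply/permP => x; rewrite dih_rotation perm1 -(Zp_nat_mod hs) modnn.
by rewrite GRing.subr0 GRing.addr0 if_same; case: x.
Qed.

Lemma dih_ba : (dih_b * dih_a) ^+ s = 1.
Proof.
have aV : dih_a^-1 = dih_a by apply: mulg1_eq; rewrite -expg2 dih_a2.
have bV : dih_b^-1 = dih_b by apply: mulg1_eq; rewrite -expg2 dih_b2.
by have := congr1 (fun x => x^-1) dih_ab; rewrite invg1 -expVgn invgM aV bV.
Qed.

End Dihedral.

(** * The Coxeter group of a centrally symmetric polytope *)

Lemma commute_expg2 (G : groupType) (x y : G) : x ^+ 2 = 1 -> y ^+ 2 = 1 ->
  (x * y) ^+ 2 = 1 -> commute x y.
Proof.
rewrite !expg2 => /mulg1_eq xV /mulg1_eq yV /mulg1_eq.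
by rewrite invgM xV yV => /esym.
Qed.

Section CoxeterGroup.
Variables (n : nat) (P : cs_polytope n) (s : nat).
Hypothesis hs : 2 <= s.

Local Notation V := (vertex (tau P)).
Local Notation W := (W P s).
Local Notation opp F := (vertex_act F (alpha P)).
Implicit Types (F E : V) (S : set V).

Definition vertex_reflection (F : V) : W := pgen (@W_relator n P s) F.

Lemma opp_opp F : opp (opp F) = F.
Proof. by rewrite -vertex_actM -expg2 (alpha_invol P).2 vertex_act1. Qed.

Lemma opp_neq F : opp F <> F. Proof. exact: alpha_free. Qed.

Lemma opp_act F g : opp (vertex_act F g) = vertex_act (opp F) g.
Proof. by rewrite -!vertex_actM alpha_central. Qed.

Lemma sigma_sq F : vertex_reflection F ^+ 2 = 1.
Proof.
by have := weval_pgen_rel (W_square s F); rewrite weval_wexp weval_wgen.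
Qed.

Lemma sigma_opp F : (vertex_reflection F * vertex_reflection (opp F)) ^+ s = 1.
Proof.
by have := weval_pgen_rel (W_antipodal s F); rewrite weval_wexp weval_cat !weval_wgen.
Qed.

Lemma sigma_comm F E : E <> F -> E <> opp F ->
  (vertex_reflection F * vertex_reflection E) ^+ 2 = 1.
Proof.
move=> EF EoF.
by have := weval_pgen_rel (W_commute s EF EoF); rewrite weval_wexp weval_cat !weval_wgen.
Qed.

(** The universal property of [W], with the relators spelled out. *)
Lemma W_lift (K : groupType) (f : V -> K) :
  (forall F, f F ^+ 2 = 1) -> (forall F, (f F * f (opp F)) ^+ s = 1) ->
  (forall F E, E <> F -> E <> opp F -> (f F * f E) ^+ 2 = 1) ->
  {morph plift (R := @W_relator n P s) f : x y / x * y} /\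
  forall F, plift (R := @W_relator n P s) f (vertex_reflection F) = f F.
Proof.
move=> f2 fs fc; have fR w : W_relator s w -> weval f w = 1.
  by case=> [F|F|F E EF EoF]; rewrite weval_wexp ?weval_cat !weval_wgen; auto.
by split=> [|F]; [apply: pliftM | apply: plift_gen].
Qed.

Lemma W_ind (Q : W -> Prop) : Q 1 -> (forall x F, Q x ->
  Q (x * vertex_reflection F)) -> forall x, Q x.
Proof.
move=> Q1 QM; elim/clW => w; rewrite cl_weval; elim/last_ind: w => [|w [F b] IH].
  by rewrite /weval big_nil.
rewrite -cats1 weval_cat; suff ->
  : weval (pgen _) [:: (F, b)] = vertex_reflection F :> W by apply: QM.
rewrite /weval big_seq1; case: b => //=; apply: mulg1_eq.
by rewrite -expg2; apply: sigma_sq.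
Qed.

Definition parity : W -> sign_group := plift (fun _ => true : sign_group).

Lemma parityM : {morph parity : x y / x * y}.
Proof. by apply: (W_lift _ _ _).1 => * //; apply: expg1n. Qed.

Lemma parity_sigma F : parity (vertex_reflection F) = true.
Proof. by apply: (W_lift _ _ _).2 => * //; apply: expg1n. Qed.

Lemma parity_act g (x : W) : parity (W_act g x) = parity x.
Proof.
apply: (pmorph_ext (phi := parity \o W_act g) (psi := parity)).
- by move=> y z /=; rewrite W_actM parityM.
- exact: parityM.
by move=> F; rewrite /= W_act_gen !parity_sigma.
Qed.

(** The projection of [W] onto its dihedral factor generated by
    [vertex_reflection F] and [vertex_reflection (opp F)]. *)
Definition dih_gen F E : {perm gon s} :=
  if E == F then dih_a s else if E == opp F then dih_b s else 1.

Definition dih_proj F : W -> {perm gon s} := plift (dih_gen F).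

Lemma dih_gen_rel F :
  [/\ forall E, dih_gen F E ^+ 2 = 1, forall E, (dih_gen F E * dih_gen F (opp E)) ^+ s = 1
    & forall E E', E' <> E -> E' <> opp E -> (dih_gen F E * dih_gen F E') ^+ 2 = 1].
Proof.
have sq E : dih_gen F E ^+ 2 = 1.
  by rewrite /dih_gen; do 2?case: ifP => _; rewrite ?dih_a2 ?dih_b2 ?expg1n.
split=> // [E|E E' E'E E'oE].
  rewrite /dih_gen; case: eqP => [->|EF].
    by rewrite eqxx; case: eqP => [/opp_neq//|_]; apply: dih_ab.
  case: eqP => [->|EoF]; first by rewrite opp_opp eqxx; apply: dih_ba.
  case: eqP => [oEF|_]; first by case: EoF; rewrite -oEF opp_opp.
  case: eqP => [oEoF|_]; last by rewrite mul1g expg1n.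
  by case: EF; rewrite -(opp_opp E) oEoF opp_opp.
have [EF|EF] := eqVneq E F.
  have -> : dih_gen F E' = 1.
    by rewrite /dih_gen; case: eqP => [e|_]; [case: E'E; rewrite e|case: eqP => // e;
      case: E'oE; rewrite EF].
  by rewrite mulg1.
have [EoF|EoF] := eqVneq E (opp F); last first.
  by have -> : dih_gen F E = 1; rewrite ?mul1g // /dih_gen (negPf EF) (negPf EoF).
have -> : dih_gen F E' = 1.
  by rewrite /dih_gen; case: eqP => [e|_]; [case: E'oE;
    rewrite EoF opp_opp|case: eqP => // e; case: E'E; rewrite EoF].
by rewrite mulg1.
Qed.

Lemma dih_projM F : {morph dih_proj F : x y / x * y}.
Proof. by have [? ? ?] := dih_gen_rel F; apply: (W_lift _ _ _).1. Qed.

Lemma dih_proj_sigma F E : dih_proj F (vertex_reflection E) = dih_gen F E.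
Proof. by have [? ? ?] := dih_gen_rel F; apply: (W_lift _ _ _).2. Qed.

(** If [F] is not in [S], then projecting [gen (vertex_reflection @` S)] to the
    dihedral factor of [F] gives at most the two elements [1] and [dih_b], since
    only the antipode of [F] contributes. *)
Lemma sigma_gen S F : gen (vertex_reflection @` S) (vertex_reflection F) -> S F.
Proof.
move=> SF; apply: contrapT => nSF.
have : dih_proj F (vertex_reflection F) = 1 \/ dih_proj F (vertex_reflection F) = dih_b s.
  move: SF; move: (vertex_reflection F); have bV : (dih_b s)^-1 = dih_b s.
    by apply: mulg1_eq; rewrite -expg2 dih_b2.
  have pV := morph_inv (dih_projM F).
  apply: (gen_ind (Q := fun x => dih_proj F x = 1 \/ dih_proj F x = dih_b s)).
  - by left; apply: morph_one (dih_projM F).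
  - move=> x y; rewrite dih_projM pV => -[->|->] [->|->]; rewrite ?invg1 ?bV.
    + by left; rewrite mulg1.
    + by right; rewrite mul1g.
    + by right; rewrite mulg1.
    + by left; rewrite -expg2 dih_b2.
  move=> _ [E SE <-]; rewrite dih_proj_sigma /dih_gen.
  case: eqP => [EF|_]; first by case: nSF; rewrite -EF.
  by case: eqP => _; [right|left].
rewrite dih_proj_sigma /dih_gen eqxx => -[] /permP /(_ (0%R, false)).
  by rewrite perm1 permE.
rewrite !permE /flip_a /flip_b /= => /(congr1 (fun x : gon s => - x.1)%R) /=.
rewrite GRing.oppr0 GRing.sub0r GRing.opprK => e.
by have := @GRing.oner_neq0 'Z_s; rewrite -e eqxx.
Qed.

Lemma sigma_inj : injective vertex_reflection.
Proof.
move=> F E FE; have : gen (vertex_reflection @` [set E]) (vertex_reflection E) by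
  apply: sub_gen; exists E.
by rewrite -FE => /sigma_gen.
Qed.

End CoxeterGroup.

(** * Parabolic subgroups of string C-groups *)

Lemma gen_commute (G : groupType) (A B : set G) :
  (forall a b, A a -> B b -> commute a b) ->
  forall a b, gen A a -> gen B b -> commute a b.
Proof.
move=> AB; have Ab a b : A a -> gen B b -> commute a b.
  move=> Aa; apply: (gen_ind (Q := fun b => commute a b)).
  - exact: commute1.
  - by move=> x y ax ay; apply: commuteM => //; apply: commuteV.
  by move=> b' Bb; apply: AB.
move=> a b Aa Bb; apply/commute_sym; move: a Aa.
apply: (gen_ind (Q := fun a => commute b a)).
- exact: commute1.
- by move=> x y ax ay; apply: commuteM => //; apply: commuteV.
by move=> a Aa; apply/commute_sym/Ab.
Qed.

Lemma gen_split (G : groupType) (A B C : set G) :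
  (forall a b, A a -> B b -> commute a b) -> (forall x, C x -> A x \/ B x) ->
  forall x, gen C x -> exists a b, [/\ gen A a, gen B b & x = a * b].
Proof.
move=> AB CAB; have comm := gen_commute AB.
apply: (gen_ind (Q := fun x => exists a b, [/\ gen A a, gen B b & x = a * b])).
- by exists 1, 1; split; rewrite ?mulg1 //; apply: gen1.
- move=> _ _ [a [b [Aa Bb ->]]] [c [d [Ac Bd ->]]].
  exists (a / c), (b / d); split; do ?by apply: genM => //; apply: genV.
  have cbd : commute c^-1 (b / d).
    by apply: comm; [apply: genV | apply: genM => //; apply: genV].
  by rewrite invgM -[RHS]mulgA cbd !mulgA.
move=> x /CAB[Ax|Bx]; [exists x, 1|exists 1, x]; split; rewrite ?mulg1 ?mul1g //;
  by [apply: sub_gen|apply: gen1].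
Qed.

Section StringCGroup.
Variables (G : groupType) (n : nat) (t : 'I_n.+1 -> G).
Hypothesis tC : string_C_group t.

(** The intersection property of two subgroups is applied to one maximal
    parabolic subgroup after the other. *)
Lemma C_group_meet (K : set 'I_n.+1) g :
  (forall k, K k -> parabolic t k g) -> gen (t @` ~` K) g.
Proof.
have [tT _ tI _] := tC; move=> Kg.
suff H (s : seq 'I_n.+1) : (forall k, k \in s -> parabolic t k g) ->
    gen (t @` [set j | j \notin s]) g.
  have : gen (t @` [set j | j \notin [seq k <- enum 'I_n.+1 | `[< K k >]]]) g.
    by apply: H => k; rewrite mem_filter => /andP[/asboolP Kk _]; apply: Kg.
  apply: genS => _ [j nj <-]; exists j => // Kj; move: nj.
  by rewrite /= mem_filter mem_enum andbT => /asboolP.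
elim: s => [|k s IH] sg.
  have -> : [set j : 'I_n.+1 | j \notin [::]] = setT by apply/seteqP; split.
  by rewrite tT.
have -> : [set j | j \notin k :: s] = ~` [set k] `&` [set j | j \notin s].
  apply/seteqP; split=> j /=; rewrite inE negb_or.
    by move=> /andP[/eqP].
  by case=> /eqP -> ->.
rewrite -tI; split; first by apply: sg; rewrite mem_head.
by apply: IH => j js; apply: sg; rewrite inE js orbT.
Qed.

Lemma string_commute (i j : 'I_n.+1) : i.+1 < j -> commute (t i) (t j).
Proof.
move=> ij; have [_ tt _ tij] := tC.
apply: commute_expg2; [exact: (tt i).2 | exact: (tt j).2 |].
by apply: tij; rewrite ij.
Qed.

(** The generators on one side of [k] commute with those on the other side. *)
Lemma parabolic_split (k : 'I_n.+1) g : parabolic t k g -> exists a b,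
  [/\ gen (t @` [set i : 'I_n.+1 | i < k]) a, gen (t @` [set i : 'I_n.+1 | k < i]) b &
    g = a * b].
Proof.
apply: gen_split => [_ _ [i ik <-] [j jk <-]|_ [i ik <-]].
  by apply: string_commute; apply: leq_trans jk; rewrite ltnS.
by case: (ltngtP i k) => [ltik|ltki|/val_inj //]; [left|right]; exists i.
Qed.

End StringCGroup.

(** * The halving group *)

Section Halving.
Variables (n : nat) (P : cs_polytope n) (s : nat).
Hypothesis hs : 2 <= s.

Local Notation V := (vertex (tau P)).
Local Notation W := (Defs.W P s).
Local Notation L := (two_pow P s).
Local Notation F0 := (base_vertex (tau P)).
Local Notation inl x := (sd_inl (W_action P s) x : L).
Local Notation inr g := (sd_inr (W_action P s) g : L).
Local Notation r := (halving_gen (two_pow_gen P s)).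
Local Notation sigma := (@vertex_reflection n P s).
Implicit Types (y z : L) (x : W) (g h : pgroup P).

Definition rho0 : L := inl (sigma F0).

Lemma sd_mulE y z : y * z = (y.1 * W_act y.2^-1 z.1, y.2 * z.2) :> L. Proof. by []. Qed.

Lemma sd_invE y : y^-1 = (W_act y.2 y.1^-1, y.2^-1) :> L. Proof. by []. Qed.

Lemma sd_split y : y = inl y.1 * inr y.2.
Proof. by case: y => x g; rewrite sd_mulE /= invg1 W_act1 mulg1 mul1g. Qed.

Lemma inlM x x' : inl (x * x') = inl x * inl x'.
Proof. by rewrite sd_mulE /= invg1 W_act1 mul1g. Qed.

Lemma W_act_one g : W_act g (1 : W) = 1.
Proof. exact: (gact_one (W_action P s)). Qed.

Lemma inrM g h : inr (g * h) = inr g * inr h.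
Proof. by rewrite sd_mulE /= W_act_one mulg1. Qed.

Lemma inrV g : inr g^-1 = (inr g)^-1.
Proof. by rewrite sd_invE /= invg1 W_act_one. Qed.

Lemma inr_inj g h : inr g = inr h -> g = h. Proof. by case. Qed.

Lemma inl_sigma g : (inr g)^-1 * rho0 * inr g = inl (sigma (vertex_act F0 g)).
Proof. by rewrite sd_conj /= /vertex_reflection W_act_gen. Qed.

Lemma rho0_sq : rho0 * rho0 = 1.
Proof. by rewrite -inlM -expg2 sigma_sq. Qed.

Lemma rho0V : rho0^-1 = rho0. Proof. exact/mulg1_eq/rho0_sq. Qed.

Lemma base_vertex_stable g : parabolic (tau P) ord0 g <-> vertex_act F0 g = F0.
Proof.
split=> [g0|/(congr1 sval) /= e].
  apply: val_inj; rewrite /= -[RHS]rcoset1; apply/rcoset_eq/rcosetP.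
  by rewrite divg1.
have := rcoset_refl ((tau P) @` ~` [set ord0]) g.
by rewrite -/(parabolic _ _) e.
Qed.

Lemma rho0_commute g : parabolic (tau P) ord0 g -> commute rho0 (inr g).
Proof.
move=> /base_vertex_stable g0; have := inl_sigma g; rewrite g0 => e.
by have := congr1 (fun y => inr g * y) e; rewrite /= !mulgA mulgV mul1g.
Qed.

Definition conj0 y := rho0 * y * rho0.

Lemma conj0M y z : conj0 (y * z) = conj0 y * conj0 z.
Proof. by rewrite /conj0 !mulgA -(mulgA _ rho0 rho0) rho0_sq mulg1. Qed.

Lemma conj0K y : conj0 (conj0 y) = y.
Proof. by rewrite /conj0 !mulgA rho0_sq mul1g -mulgA rho0_sq mulg1. Qed.

Lemma halving_gen0 : r ord0 = conj0 (inr (tau P ord0)).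
Proof.
rewrite /halving_gen eqxx /two_pow_gen.
have -> : inord 0 = ord0 :> 'I_n.+2 by apply: val_inj; rewrite /= inordK.
have -> : inord 1 = lift ord0 ord0 :> 'I_n.+2 by apply: val_inj; rewrite /= inordK.
by rewrite unlift_none liftK.
Qed.

Lemma halving_gen_lift j : r (lift ord0 j) = inr (tau P j).
Proof. by rewrite /halving_gen /two_pow_gen liftK. Qed.

Definition swap01 : 'I_n.+2 -> 'I_n.+2 := tperm ord0 (lift ord0 ord0).

Lemma swap01K : involutive swap01. Proof. exact: tpermK. Qed.

Lemma tau_stab j : j != ord0 -> parabolic (tau P) ord0 (tau P j).
Proof. by move=> j0; apply: sub_gen; exists j => //; apply/eqP. Qed.

(** The reflection [rho0] commutes with the generators that fix the base
    vertex. *)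
Lemma conj0_halving_gen i : conj0 (r i) = r (swap01 i).
Proof.
have [->|i0] := eqVneq i ord0;
  first by rewrite /swap01 tpermL halving_gen0 conj0K halving_gen_lift.
have [j ij|i0'] := unliftP ord0 i; last by rewrite i0' eqxx in i0.
have [j0|j0] := eqVneq j ord0.
  by rewrite ij j0 /swap01 tpermR halving_gen0 halving_gen_lift.
have -> : swap01 i = i.
  by apply: tpermD; rewrite ij // (inj_eq lift_inj) eq_sym.
by rewrite ij halving_gen_lift /conj0 (rho0_commute (tau_stab j0)) -mulgA rho0_sq mulg1.
Qed.

Lemma conj0_gen (J J' : set 'I_n.+2) y : (forall i, J i -> J' (swap01 i)) ->
  gen (r @` J) y -> gen (r @` J') (conj0 y).
Proof.
move=> JJ'; apply: gen_morph; first exact: conj0M.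
by move=> _ [i Ji <-]; rewrite conj0_halving_gen; apply: sub_gen;
  exists (swap01 i) => //; apply: JJ'.
Qed.

Lemma tau_sq j : tau P j ^+ 2 = 1.
Proof. by have [_ /(_ j)[]] := tau_string_C P. Qed.

Lemma halving_gen_sq i : r i ^+ 2 = 1.
Proof.
have sq j : r (lift ord0 j) ^+ 2 = 1 by rewrite halving_gen_lift expg2 -inrM -expg2
  tau_sq.
have [j ->//|->] := unliftP ord0 i.
have -> : r ord0 = conj0 (r (lift ord0 ord0)) by rewrite halving_gen_lift halving_gen0.
by rewrite expg2 -conj0M -expg2 sq /conj0 mulg1 rho0_sq.
Qed.

Lemma halving_gen_neq1 i : r i <> 1.
Proof.
have ne j : r (lift ord0 j) <> 1.
  rewrite halving_gen_lift => /inr_inj.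
  by have [_ /(_ j)[]] := tau_string_C P.
have [j ->//|->] := unliftP ord0 i.
move=> /(congr1 conj0); rewrite halving_gen0 conj0K -halving_gen_lift /conj0 mulg1
  rho0_sq.
exact: ne.
Qed.

Lemma parity_mul y z : parity (y * z).1 = parity y.1 * parity z.1.
Proof. by rewrite sd_mulE /= parityM parity_act. Qed.

Lemma parity_conj0 y : parity (conj0 y).1 = parity y.1.
Proof. by rewrite /conj0 !parity_mul /= parity_sigma !sign_mulE addbC addKb. Qed.

Lemma parity1 : parity (1 : W) = 1.
Proof. exact: morph_one (@parityM n P s). Qed.

Lemma halving_even y : gen (range r) y -> parity y.1 = 1.
Proof.
have V z : parity z.1 = 1 -> parity (z^-1).1 = 1.
  by move=> pz; have := parity_mul z z^-1; rewrite mulgV pz mul1g => <-; apply: parity1.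
apply: (gen_ind (Q := fun y => parity y.1 = 1)) => [|y1 z py /V pz|_ [i _ <-]].
- exact: parity1.
- by rewrite parity_mul py pz.
have lft j : parity (r (lift ord0 j)).1 = 1 by rewrite halving_gen_lift; apply: parity1.
have [j ->//|->] := unliftP ord0 i.
by rewrite halving_gen0 parity_conj0; apply: parity1.
Qed.

Lemma conj0_inr g : conj0 (inr g) = inl (sigma F0 * sigma (vertex_act F0 g^-1)) * inr g.
Proof.
by rewrite inlM -inl_sigma inrV invgK /conj0 -!mulgA mulVg mulg1.
Qed.

(** When [K] omits a single index [k], these are the vertices of the base
    [k]-face. *)
Definition face_vertices (K : set 'I_n.+1) : set V :=
  [set vertex_act F0 g | g in gen (tau P @` K)].

Lemma face_vertices_act K F g : face_vertices K F -> gen (tau P @` K) g ->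
  face_vertices K (vertex_act F g).
Proof.
by move=> [h Kh <-] Kg; exists (h * g); [apply: genM | rewrite vertex_actM].
Qed.

Lemma base_face_vertex K : face_vertices K F0.
Proof. by exists 1; [apply: gen1 | rewrite vertex_act1]. Qed.

(** The group of a face permutes its vertices, so together with their
    reflections it generates a semidirect product; the first generator of the
    halving group is the product of two such reflections and a generator of
    [G]. *)
Lemma halving_parabolic_sub (J : set 'I_n.+2)
    (K := [set j | J (lift ord0 j) \/ j = ord0 /\ J ord0]) y :
  gen (r @` J) y -> gen (tau P @` K) y.2 /\ gen (sigma @` face_vertices K) y.1.
Proof.
have Wact g x : gen (tau P @` K) g -> gen (sigma @` face_vertices K) x ->
    gen (sigma @` face_vertices K) (W_act g x).
  move=> Kg; apply: gen_morph; first exact: W_actM.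
  move=> _ [F KF <-]; rewrite /vertex_reflection W_act_gen.
  by apply: sub_gen; exists (vertex_act F g) => //; apply: face_vertices_act.
apply: (gen_ind (Q := fun y =>
  gen (tau P @` K) y.2 /\ gen (sigma @` face_vertices K) y.1)).
- by split; apply: gen1.
- move=> [x g] [x' g'] [Kg Kx] [Kg' Kx']; rewrite sd_mulE sd_invE /=.
  split; first by apply: genM => //; apply: genV.
  apply: genM => //; apply: (Wact); first exact: genV.
  by apply: (Wact) => //; apply: genV.
move=> _ [i Ji <-]; have [j ij|i0] := unliftP ord0 i.
  rewrite ij halving_gen_lift; split; last exact: gen1.
  by apply: sub_gen; exists j => //; left; rewrite -ij.
have K0 : gen (tau P @` K) (tau P ord0).
  by apply: sub_gen; exists ord0 => //; right; rewrite -i0.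
rewrite i0 halving_gen0 conj0_inr sd_mulE /= invg1 W_act1 mulg1 mul1g; split=> //.
apply: genM; apply: sub_gen; first by exists F0 => //; apply: base_face_vertex.
exists (vertex_act F0 (tau P ord0)^-1) => //; apply: face_vertices_act;
  first exact: base_face_vertex.
exact: genV.
Qed.

Lemma halving_parabolic_lift (k : 'I_n.+1) y : k != ord0 ->
  parabolic r (lift ord0 k) y ->
  parabolic (tau P) k y.2 /\ gen (sigma @` face_vertices (~` [set k])) y.1.
Proof.
move=> k0 /halving_parabolic_sub[yg yx].
set K := [set j | _] in yg yx.
have Kk : K `<=` ~` [set k].
  by move=> j [jk e|[-> _] e]; [apply: jk; rewrite e | rewrite e eqxx in k0].
split; first by apply: genS yg => _ [j /Kk jk <-]; exists j.
apply: genS yx => _ [F [g Kg <-] <-]; exists (vertex_act F0 g) => //; exists g => //.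
by apply: genS Kg => _ [j /Kk jk <-]; exists j.
Qed.

Lemma halving_parabolic0 (J : set 'I_n.+2) y : ~ J ord0 -> gen (r @` J) y -> y = inr y.2.
Proof.
move=> nJ0; apply: (gen_ind (Q := fun y => y = inr y.2)) => // [z w -> ->|_ [i Ji <-]].
  by rewrite -inrV -inrM.
by have [j ->|i0] := unliftP ord0 i; [rewrite halving_gen_lift | case: nJ0; rewrite -i0].
Qed.

Lemma inr_gen (K : set 'I_n.+1) (J : set 'I_n.+2) g : (forall j, K j ->
  J (lift ord0 j)) ->
  gen (tau P @` K) g -> gen (r @` J) (inr g).
Proof.
move=> KJ; apply: (gen_morph (phi := fun g => inr g)); first exact: inrM.
move=> _ [j Kj <-]; rewrite -halving_gen_lift; apply: sub_gen.
by exists (lift ord0 j) => //; apply: KJ.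
Qed.

(** A vertex of the base [k]-face is reached by the generators of index less
    than [k], since those of larger index commute with them and fix the base
    vertex. *)
Lemma face_vertices_low (k : 'I_n.+1) F : k != ord0 -> face_vertices (~` [set k]) F ->
  exists2 g, gen (tau P @` [set i : 'I_n.+1 | i < k]) g & F = vertex_act F0 g.
Proof.
move=> k0 [g /genV gk <-].
have [a [b [aA bB ab]]] := parabolic_split (tau_string_C P) gk.
exists a^-1; first exact: genV.
rewrite -[g]invgK ab invgM vertex_actM; congr vertex_act.
apply: (base_vertex_stable _).1; apply: genV; apply: genS bB => _ [j kj <-];
  exists j => //= j0.
by move: kj; rewrite /= j0.
Qed.

(** As conjugation by [rho0] preserves the subgroup, adding [rho0] at most
    doubles it. *)
Lemma halving_ext (J : set 'I_n.+2) z : (forall i, J i -> J (swap01 i)) ->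
  gen ((r @` J) `|` [set rho0]) z -> gen (r @` J) z \/ gen (r @` J) (z * rho0).
Proof.
move=> Jsw; have conjJ w : gen (r @` J) w -> gen (r @` J) (conj0 w).
  exact: conj0_gen.
have rr w : w * rho0 * rho0 = w by rewrite -mulgA rho0_sq mulg1.
apply: (gen_ind (Q := fun z => gen (r @` J) z \/ gen (r @` J) (z * rho0))).
- by left; apply: gen1.
- move=> x y [Jx|Jx] [Jy|Jy].
  + by left; apply: genM => //; apply: genV.
  + right; have -> : x / y * rho0 = x * conj0 (y * rho0)^-1.
      by rewrite invgM rho0V /conj0 !mulgA -(mulgA x rho0 rho0) rho0_sq mulg1.
    by apply: genM => //; apply: (conjJ); apply: genV.
  + right; have -> : x / y * rho0 = x * rho0 * conj0 y^-1.
      by rewrite /conj0 !mulgA rr.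
    by apply: genM => //; apply: (conjJ); apply: genV.
  + left; have -> : x / y = x * rho0 / (y * rho0).
      by rewrite mulgKA.
    by apply: genM => //; apply: genV.
by move=> x [Jx|->]; [left; apply: sub_gen | right; rewrite rho0_sq; apply: gen1].
Qed.

(** The reflection at the image of the base vertex under [g] is the conjugate of
    [rho0] by [g]. *)
Lemma sigma_gen_ext (J : set 'I_n.+2) (S : set V) x :
  (forall F, S F -> exists2 g, gen (r @` J) (inr g) & F = vertex_act F0 g) ->
  gen (sigma @` S) x -> gen ((r @` J) `|` [set rho0]) (inl x).
Proof.
move=> SJ; apply: (gen_morph (phi := fun x => inl x)); first exact: inlM.
have up z : gen (r @` J) z -> gen ((r @` J) `|` [set rho0]) z.
  by apply: genS => w Jw; left.
move=> _ [F /SJ[g /up Jg ->] <-]; rewrite -inl_sigma.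
apply: genM => //; apply: genM; first exact: genV.
by apply: sub_gen; right.
Qed.

Lemma swap01_lift (k : 'I_n.+1) : k != ord0 -> swap01 (lift ord0 k) = lift ord0 k.
Proof. by move=> k0; apply: tpermD; rewrite // (inj_eq lift_inj) eq_sym. Qed.

(** An intersection that involves type 0 lies in [G], where the intersection
    property of the polytope applies; type 1 contributes the stabilizer of the
    base vertex, because different vertices have different reflections. *)
Lemma halving_meet0 (K : set 'I_n.+2) y : K ord0 ->
  (forall i, K i -> parabolic r i y) -> gen (r @` ~` K) y.
Proof.
move=> K0 Ky; have yE : y = inr y.2 by apply: halving_parabolic0 (Ky _ K0); apply.
rewrite yE; apply: (inr_gen (K := ~` [set k | K (lift ord0 k)])) => //.
apply: C_group_meet; first exact: tau_string_C.
move=> k /= Kk; have [k0|k0] := eqVneq k ord0;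
  last by have [] := halving_parabolic_lift k0 (Ky _ Kk).
rewrite k0 in Kk *; have : gen (r @` ~` [set ord0]) (conj0 y).
  apply: conj0_gen (Ky _ Kk) => i /= i1 i0; apply: i1.
  by rewrite -[i]swap01K i0 /swap01 tpermL.
move/halving_parabolic0 => /(_ (fun f => f erefl)) /(congr1 fst).
rewrite [y in conj0 y]yE conj0_inr sd_mulE /= W_act_one mulg1 => /mulg1_eq.
have -> : (sigma F0)^-1 = sigma F0 by apply: mulg1_eq; rewrite -expg2 sigma_sq.
move/(sigma_inj hs)/esym/base_vertex_stable/genV; by rewrite invgK.
Qed.

(** If type 1 occurs but not type 0, conjugation by [rho0] exchanges the two. If
    neither occurs, the smallest type [k] decides: the [W]-component is
    generated by vertices of the base face of that type, all of which are images
    of the base vertex under elements of the intersection. *)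
Theorem halving_meets : parabolic_intersections r.
Proof.
move=> K y Hy Ky; case: (pselect (K ord0)) => [K0|nK0]; first exact: halving_meet0.
case: (pselect (K (lift ord0 ord0))) => [K1|nK1].
  rewrite -[y]conj0K; apply: (conj0_gen (J := ~` (swap01 @^-1` K))).
    by move=> i /= nKi Ki; apply: nKi.
  apply: halving_meet0; first by rewrite /= /swap01 tpermL.
  move=> i /= Ki; apply: conj0_gen (Ky _ Ki) => j /= ji e; apply: ji.
  by rewrite -e swap01K.
have Klift i : K i -> exists2 k : 'I_n.+1, k != ord0 & i = lift ord0 k.
  move=> Ki; have [k ik|i0] := unliftP ord0 i; last by case: nK0; rewrite -i0.
  by exists k => //; apply/eqP => k0; apply: nK1; rewrite -k0 -ik.
case: (pselect (exists i, K i)) => [[i0 Ki0]|nK]; last first.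
  by apply: genS Hy => _ [i _ <-]; exists i => // Ki; apply: nK; exists i.
have Kstab i : (~` K) i -> (~` K) (swap01 i).
  move=> /= nKi Ks; apply: nKi; have [k k0 e] := Klift _ Ks.
  by rewrite -[i]swap01K e swap01_lift // -e.
have [k0 k00 i0E] := Klift _ Ki0.
have [|k /andP[k_0 /asboolP Kk] kmin] :=
  @arg_minnP _ k0 (fun k => (k != ord0) && `[< K (lift ord0 k) >]) (@nat_of_ord _).
  by rewrite k00; apply/asboolP; rewrite -i0E.
have Jg : gen (r @` ~` K) (inr y.2).
  apply: (inr_gen (K := ~` [set k | K (lift ord0 k)])) => //.
  apply: C_group_meet => [|j /= Kj]; first exact: tau_string_C.
  have [j' j0 /lift_inj jE] := Klift _ Kj.
  by rewrite jE in Kj *; have [] := halving_parabolic_lift j0 (Ky _ Kj).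
have [_ yx] := halving_parabolic_lift k_0 (Ky _ Kk).
have Jx : gen ((r @` ~` K) `|` [set rho0]) (inl y.1).
  apply: sigma_gen_ext yx => F /(face_vertices_low k_0)[g gk ->]; exists g => //.
  apply: inr_gen gk => j /= jk Kj.
  have [j' j0 /lift_inj jE] := Klift _ Kj; rewrite jE in jk Kj.
  have := kmin j'; rewrite j0 leqNgt jk /= => /(_ _)/negP; apply=> //.
  exact/asboolP.
rewrite [y]sd_split; apply: genM Jg.
case: (halving_ext Kstab Jx) => // bad.
have := halving_even (genS (image_subset _ (@subsetT _ _)) bad).
by rewrite parity_mul /= parity_sigma (halving_even Hy).
Qed.

Lemma halving_split (k : 'I_n.+2) y : 1 < k -> parabolic r k y -> exists a b,
  [/\ gen (r @` [set i : 'I_n.+2 | i < k]) a, gen (r @` [set i : 'I_n.+2 | k < i]) b &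
    y = a * b].
Proof.
move=> k1; apply: gen_split => [_ _ [i /= ik <-] [j /= kj <-]|_ [i ik <-]]; last first.
  by case: (ltngtP i k) => [ltik|ltki|/val_inj //]; [left|right]; exists i.
have [j' jE|j0] := unliftP ord0 j; last by move: kj; rewrite j0.
have j'1 : 1 < j' by move: kj; rewrite jE /= /bump /= add1n ltnS; apply: leq_trans.
have tcomm (i' : 'I_n.+1) : i'.+1 < j' -> commute (inr (tau P i')) (inr (tau P j')).
  by move=> ij; rewrite /commute -!inrM (string_commute (tau_string_C P) ij).
rewrite jE halving_gen_lift; have [i' iE|i0] := unliftP ord0 i.
  rewrite iE halving_gen_lift; apply: tcomm.
  by move: ik kj; rewrite iE jE /= /bump /= !add1n => ik; rewrite ltnS; apply: leq_trans.
rewrite i0 halving_gen0 /conj0; apply/commute_sym.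
have rj : commute (inr (tau P j')) rho0.
  apply/commute_sym; apply: rho0_commute; apply: tau_stab; apply/eqP => j'0.
  by move: j'1; rewrite j'0.
by do ?apply: commuteM => //; apply/commute_sym/tcomm.
Qed.

(** When the types 0 and 1 do not both occur, the diagram restricted to the
    occurring types behaves like a string: adding the types in increasing order,
    only the incidence with the preceding type matters. *)
Lemma helly_chain (K : set 'I_n.+2) (a : 'I_n.+2 -> L) :
  ~ (K ord0 /\ K (lift ord0 ord0)) -> (forall i, K i -> gen (range r) (a i)) ->
  (forall i j, K i -> K j ->
     exists y, rcoset (parabolic r i) (a i) y /\ rcoset (parabolic r j) (a j) y) ->
  forall m, exists2 h, gen (range r) h &
    forall i : 'I_n.+2, K i -> i < m -> rcoset (parabolic r i) (a i) h.
Proof.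
move=> n01 Ha meet; elim=> [|m [h Hh hP]]; first by exists 1; first exact: gen1.
case: (pselect (exists2 i : 'I_n.+2, K i & i = m :> nat)) => [[k Kk km]|nKm]; last first.
  exists h => // i Ki; rewrite ltnS leq_eqVlt => /predU1P[im|/hP]; last exact.
  by case: nKm; exists i.
have Hcoset i y z : gen (range r) y -> rcoset (parabolic r i) y z -> gen (range r) z.
  by move=> Hy /rcosetP/parabolic_sub Hzy; rewrite -[z](mulgVK y); apply: genM.
case: (pselect (exists2 j : 'I_n.+2, K j & 1 < j < m)) => [[j0 Kj0 j0m]|nbig].
  have [|j /andP[/andP[j1 jm] /asboolP Kj] jmax] :=
    @arg_maxnP _ j0 (fun j => (1 < j < m) && `[< K j >]) (@nat_of_ord _).
    by rewrite j0m; apply/asboolP.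
  have [y [yj yk]] := meet j k Kj Kk.
  have yh : parabolic r j (y / h).
    by apply/rcosetP; rewrite (rcoset_eq (hP _ Kj jm)).
  have [u [v [uA vB uv]]] := halving_split j1 yh.
  have low (i : 'I_n.+2) : i <= j -> parabolic r i v.
    by move=> ij; apply: genS vB => _ [l /= jl <-]; exists l => //= li; move: jl;
      rewrite li ltnNge ij.
  have Hv : gen (range r) v by apply: parabolic_sub (low j _).
  exists (v * h); first exact: genM.
  move=> i Ki; rewrite ltnS leq_eqVlt => /predU1P[im|im].
    have -> : i = k by apply: val_inj; rewrite /= im km.
    apply/rcosetP; have uk : parabolic r k u.
      by apply: genS uA => _ [l /= lj <-]; exists l => //= lk; move: lj;
        rewrite lk km ltnNge ltnW.
    have -> : v * h / a k = u^-1 * (y / a k) by rewrite -[y](mulgVK h) uv !mulgA mulVg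
      mul1g.
    by apply: genM; [apply: genV | apply/rcosetP].
  rewrite (rcoset_eq (rcoset_sym (hP _ Ki im))); apply/rcosetP; rewrite mulgK.
  apply: low; case: (ltnP 1 i) => i1; last exact: leq_trans i1 (ltnW j1).
  by apply: jmax; rewrite i1 im; apply/asboolP.
case: (pselect (exists2 j : 'I_n.+2, K j & j < m)) => [[j Kj jm]|nlow]; last first.
  exists (a k); first exact: Ha.
  move=> i Ki; rewrite ltnS leq_eqVlt => /predU1P[im|im]; last by case: nlow; exists i.
  have -> : i = k by apply: val_inj; rewrite /= im km.
  exact: rcoset_refl.
have [y [yj yk]] := meet j k Kj Kk; exists y; first exact: Hcoset (Ha _ Kj) yj.
have small (i : 'I_n.+2) : K i -> i < m -> i <= 1.
  by move=> Ki im; rewrite leqNgt; apply/negP => i1; apply: nbig; exists i; rewrite ?i1.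
move=> i Ki; rewrite ltnS leq_eqVlt => /predU1P[im|im].
  by have -> : i = k by apply: val_inj; rewrite /= im km.
suff -> : i = j by [].
have v01 (l : 'I_n.+2) : l <= 1 -> l = ord0 \/ l = lift ord0 ord0.
  by case: l => [[|[|//]] lt] _; [left|right]; apply: val_inj.
case: (v01 i (small _ Ki im)) (v01 j (small _ Kj jm)) => [iE|iE] [jE|jE];
  rewrite iE jE //.
  by case: n01; split; [rewrite -iE | rewrite -jE].
by case: n01; split; [rewrite -jE | rewrite -iE].
Qed.

(** Elements of types 0 and 1 are vertices of different parity. Two incident
    ones are joined by an edge, and when both lie on a face the reflection
    between them is in the group of the face, so the edge belongs to the face
    too. *)
Theorem halving_helly : coset_helly r.
Proof.
move=> K a Ha meet; case: (pselect (K ord0 /\ K (lift ord0 ord0))) => [[K0 K1]|n01];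
  last first.
  have [h Hh hP] := helly_chain n01 Ha meet n.+2.
  by exists h => // i Ki; apply: hP.
set one := lift ord0 ord0 in K1 *.
pose K' := K `\` [set one].
have n01' : ~ (K' ord0 /\ K' one) by case=> _ [_ /= ne]; apply: ne.
have Ha' i : K' i -> gen (range r) (a i) by case=> Ki _; apply: Ha.
have meet' i j : K' i -> K' j ->
    exists y, rcoset (parabolic r i) (a i) y /\ rcoset (parabolic r j) (a j) y.
  by move=> [Ki _] [Kj _]; apply: meet.
have [h Hh hP] := helly_chain n01' Ha' meet' n.+2.
have {}hP i : K i -> i <> one -> rcoset (parabolic r i) (a i) h.
  by move=> Ki i1; apply: hP.
have [y [y0 y1]] := meet _ _ K0 K1.
have h0 : rcoset (parabolic r ord0) (a ord0) h by apply: hP.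
have yg : parabolic r ord0 (y / h) by apply/rcosetP; rewrite (rcoset_eq h0).
have [g gE] : exists g, y / h = inr g by exists (y / h).2;
  apply: halving_parabolic0 yg; apply.
(* The edge at the base vertex of [h] towards the vertex of type 1 leads to the
   vertex [F0 g]; it belongs to each face that meets both ends. *)
have face k : k != ord0 -> K (lift ord0 k) ->
  face_vertices (~` [set k]) (vertex_act F0 g).
  move=> k0 Kk; have [z [z1 zk]] := meet _ _ K1 Kk.
  have p1 : parabolic r one (z / y) by apply/rcosetP; rewrite (rcoset_eq y1).
  have pk : parabolic r (lift ord0 k) (z / h).
    apply/rcosetP; rewrite (rcoset_eq (hP _ Kk _)) // => /lift_inj k0'.
    by rewrite k0' eqxx in k0.
  have q0 : gen (r @` ~` [set ord0]) (conj0 (z / y)).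
    apply: conj0_gen p1 => i /= i1 i0; apply: i1.
    by rewrite -[i]swap01K i0 /swap01 tpermL.
  have [g' g'E] : exists g', z / y = conj0 (inr g').
    exists (conj0 (z / y)).2; rewrite -[LHS]conj0K; congr conj0.
    by apply: halving_parabolic0 q0; apply.
  have [] := halving_parabolic_lift k0 pk.
  rewrite -(divgKA y) g'E gE conj0_inr !sd_mulE /= invg1 !(W_act1, W_act_one, mulg1,
    mul1g).
  move=> g'g; have F0in := base_face_vertex (~` [set k]).
  have : gen (sigma @` face_vertices (~` [set k])) (sigma F0) by apply: sub_gen;
    exists F0.
  move=> s0 /(genMl s0) /(sigma_gen hs) F'in.
  have := face_vertices_act F'in g'g.
  by rewrite -vertex_actM mulKg.
suff [v [v0 v1 vK]] : exists v, [/\ parabolic r ord0 (inr v), parabolic (tau P) ord0 (v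
  / g)
    & forall k, k != ord0 -> K (lift ord0 k) -> parabolic r (lift ord0 k) (inr v)].
  have Hv : gen (range r) (inr v) by apply: parabolic_sub v0.
  exists (inr v * h); first exact: genM.
  have pass i : i <> one -> K i -> parabolic r i (inr v) ->
    rcoset (parabolic r i) (a i) (inr v * h).
    move=> i1 Ki iv; rewrite (rcoset_eq (rcoset_sym (hP _ Ki i1))); apply/rcosetP.
    by rewrite mulgK.
  move=> i Ki; have [k ik|i0] := unliftP ord0 i; last by apply: pass; rewrite ?i0.
  have [k0|k0] := eqVneq k ord0; last first.
    apply: pass => //; last by rewrite ik; apply: vK; rewrite // -ik.
    by rewrite ik => /lift_inj k0'; rewrite k0' eqxx in k0.
  rewrite ik k0 -/one (rcoset_eq (rcoset_sym y1)); apply/rcosetP.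
  have -> : inr v * h / y = inr (v / g).
    by rewrite inrM inrV -gE invgF mulgA.
  apply: inr_gen v1 => j /= j0 /lift_inj; exact: j0.
case: (pselect (exists2 k, k != ord0 & K (lift ord0 k))) => [[k0 k00 Kk0]|nK]; last first.
  exists g; split; [by rewrite -gE|by rewrite mulgV; apply: gen1|].
  by move=> k k0 Kk; case: nK; exists k.
have [|k /andP[k_0 /asboolP Kk] kmin] :=
  @arg_minnP _ k0 (fun k => (k != ord0) && `[< K (lift ord0 k) >]) (@nat_of_ord _).
  by rewrite k00; apply/asboolP.
have [v vk gv] := face_vertices_low k_0 (face k k_0 Kk).
exists v; split.
- by apply: inr_gen vk.
- have := (base_vertex_stable (v / g)).2; apply.
  by rewrite vertex_actM -gv -vertex_actM mulgV vertex_act1.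
move=> j j0 Kj; apply: inr_gen vk => l /= lk /lift_inj lj.
have := kmin j; rewrite j0 -lj leqNgt lk => /(_ _)/negP; apply=> //.
by apply/asboolP; rewrite lj.
Qed.

(** Parity separates the halving group from its coset by [rho0]; the two of them
    make up the whole group, as their union contains [rho0] and [G]. *)
Lemma halving_index2 y : gen (range r) y <-> ~ gen (range r) (y * rho0).
Proof.
split=> [Hy Hy0|].
  by have := halving_even Hy0; rewrite parity_mul /= parity_sigma (halving_even Hy).
have Lall : gen (range r `|` [set rho0]) y.
  rewrite [y]sd_split; apply: genM.
    apply: (sigma_gen_ext (S := setT)).
      move=> F _; case: F => F Fv; have [g _ gF] := set_mem Fv; exists g.
        apply: (inr_gen (K := setT)) => //; by have [-> _ _ _] := tau_string_C P.
      by apply: val_inj; rewrite /= -gF.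
    move: (y.1); apply: W_ind; first exact: gen1.
    by move=> x F Sx; apply: genM => //; apply: sub_gen; exists F.
  have : gen (range r) (inr y.2).
    by apply: (inr_gen (K := setT)) => //; have [-> _ _ _] := tau_string_C P.
  by apply: genS => z; left.
by case: (halving_ext _ Lall).
Qed.

End Halving.

(** * Presentations *)

(** The involution of the generators extends to the presented group, and [theta]
    realizes it as a conjugation in the semidirect product with a group of order
    2. *)
Lemma extend_by_involution (X : choiceType) (R : word X -> Prop) (sw : X -> X) :
  involutive sw -> (forall w, R w -> weval (pgen R \o sw) w = 1) ->
  exists (K : groupType) (iota : presented_group R -> K) (theta : K),
    [/\ {morph iota : x y / x * y}, injective iota, theta * theta = 1
      & forall x, theta * iota (pgen R x) * theta = iota (pgen R (sw x))].
Proof.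
move=> swK swR; pose f := plift (R := R) (pgen R \o sw).
have fM : {morph f : x y / x * y} := pliftM swR.
have f_gen x : f (pgen R x) = pgen R (sw x) := plift_gen swR x.
have fK : involutive f.
  apply: (pmorph_ext (phi := f \o f) (psi := id)) => // [x y|x] /=; first by rewrite !fM.
  by rewrite !f_gen swK.
pose act (b : sign_group) x := if b then f x else x.
have actM b : {morph act b : x y / x * y} by case: b => x y //; apply: fM.
have act_comp b c x : act (b * c) x = act c (act b x) by case: b c => [] [] //=;
  rewrite fK.
pose a := GroupAction actM (fun x => erefl) act_comp.
exists (semidirect a), (sd_inl a), (sd_inr a true); split.
- by move=> x y; rewrite /mul /= /sd_mul /= mul1g.
- by move=> x y [].
- by change (sd_mul (sd_inr a true) (sd_inr a true) = sd_one a);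
  rewrite /sd_mul gact_one mul1g.
move=> x; have tV : (sd_inr a true)^-1 = sd_inr a true 
  by change (sd_inv (sd_inr a true) = sd_inr a true); rewrite /sd_inv invg1 gact_one.
by rewrite -{1}tV sd_conj /= f_gen.
Qed.

(** Below, [t] and [theta] stand for the images in [K] of the generators of [G]
    and of [rho0]. The words are restricted to the letters [ls], to cover both
    the whole group and the group of a facet. *)
Section Doubling.
Variables (P : cs_polytope 3) (s : nat) (ls : seq nat).
Hypothesis hP : is_24cell P.
Hypothesis ls4 : {subset ls <= iota 0 4}.

Local Notation V := (vertex (tau P)).
Local Notation W := (Defs.W P s).
Local Notation L := (two_pow P s).
Local Notation gt := (tau_nat P).
Local Notation vx := (vertex_of_word P).
Local Notation opp F := (vertex_act F (alpha P)).
Local Notation sigma := (@vertex_reflection 3 P s).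
Local Notation inr g := (sd_inr (W_action P s) g : L).

Variables (K : groupType) (theta : K) (t : nat -> K).
Hypothesis t_trivial : forall w : seq nat, {subset w <= ls} -> wval gt w = 1 ->
  wval t w = 1.
Hypothesis theta2 : theta * theta = 1.
Hypothesis theta_comm : {in ls, forall i, i != 0%N -> commute theta (t i)}.

Lemma sub_cat (u v : seq nat) : {subset u <= ls} -> {subset v <= ls} ->
  {subset u ++ v <= ls}.
Proof. by move=> ul vl i; rewrite mem_cat => /orP[/ul|/vl]. Qed.

Lemma sub_rev (u : seq nat) : {subset u <= ls} -> {subset rev u <= ls}.
Proof. by move=> ul i; rewrite mem_rev => /ul. Qed.

Lemma tau_nat_rev w : wval gt (rev w) = (wval gt w)^-1.
Proof. by apply: wval_rev => i _; apply: tau_nat_sq. Qed.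

Lemma t_sq i : i \in ls -> t i ^+ 2 = 1.
Proof.
move=> il; rewrite expg2; have := @t_trivial [:: i; i];
  rewrite !wval_cons !wval_nil !mulg1; apply.
  by move=> j; rewrite !inE orbb => /eqP ->.
by rewrite -expg2 tau_nat_sq.
Qed.

Lemma t_rev (w : seq nat) : {subset w <= ls} -> wval t (rev w) = (wval t w)^-1.
Proof. by move=> wl; apply: wval_rev => i /wl; apply: t_sq. Qed.

Lemma vertex_of_word_move w u : vx (w ++ rev u) = vertex_act (vx w) (wval gt u)^-1.
Proof. by rewrite vertex_of_word_cat tau_nat_rev. Qed.

Lemma vertex_of_word_back w : vertex_act (vx w) (wval gt w)^-1 = base_vertex (tau P).
Proof. by rewrite /vertex_of_word -vertex_actM mulgV vertex_act1. Qed.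

(** Two words leading to the same vertex differ by an element of its stabilizer,
    which by the intersection property is a word in letters of [ls] other than
    0, and these commute with [theta]. *)
Lemma theta_vertex (w w' : seq nat) : {subset w <= ls} -> {subset w' <= ls} ->
  vx w = vx w' -> theta ^ wval t w = theta ^ wval t w'.
Proof.
move=> wl wl' ww'; pose J := [set i : 'I_4 | (i : nat) \in ls].
have gJ : gen (tau P @` J) (wval gt (w ++ rev w')).
  apply: word_gen => i /(sub_cat wl (sub_rev wl')) il.
  have i4 : i < 4 by have := ls4 il; rewrite mem_iota.
  by split=> //; rewrite /J /= inordK.
have g0 : parabolic (tau P) ord0 (wval gt (w ++ rev w')).
  by rewrite wval_cat tau_nat_rev; apply/vertex_act_base.
have : gen (tau P @` (J `&` ~` [set ord0])) (wval gt (w ++ rev w')).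
  by have [_ _ <- _] := tau_string_C P; split.
case/(@gen_word P [seq i <- ls | i != 0%N]).
- by move=> i; rewrite mem_filter => /andP[_ /ls4].
- by move=> i [/= il i0]; rewrite mem_filter il andbT; apply/eqP => e; apply: i0;
  apply: val_inj.
move=> q qls qE; have ql : {subset q <= ls} by move=> i /qls;
  rewrite mem_filter => /andP[].
have tq : wval t w = wval t q * wval t w'.
  have := @t_trivial (w ++ rev w' ++ rev q).
  rewrite !wval_cat !tau_nat_rev !t_rev // => h; apply: divg1_eq;
    rewrite invgM mulgA -[LHS]mulgA.
  rewrite mulgA -mulgA h //; last by rewrite -tau_nat_rev mulgA -wval_cat -qE mulgV.
  by do ?apply: sub_cat => //; apply: sub_rev.
have cq : commute theta (wval t q).
  elim: q qls {qE ql tq} => [|i q IH] qls; first by rewrite wval_nil; apply: commute1.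
  rewrite wval_cons; apply: commuteM.
    by have := qls _ (mem_head _ _); rewrite mem_filter => /andP[i0 il];
      apply: theta_comm.
  by apply: IH => j jq; apply: qls; rewrite inE jq orbT.
by rewrite tq conjgM; congr (_ ^ _); apply/conjg_fixP/commgP.
Qed.

Hypothesis theta_edge : forall w : seq nat, {subset w <= ls} -> vx w <> vx [::] ->
  vx w <> vx (petrie 6) -> (theta * theta ^ wval t w) ^+ 2 = 1.
Hypothesis theta_antipode : forall w : seq nat, {subset w <= ls} ->
  vx w = vx (petrie 6) -> (theta * theta ^ wval t w) ^+ s = 1.

Lemma vertex_of_word_petrie6 : vx (petrie 6) = opp (base_vertex (tau P)).
Proof. by rewrite -vertex_of_word_nil (vertex_of_word_alpha hP). Qed.

(** A vertex outside the orbit of the base vertex gets the same value as its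
    antipode, so that the antipodal relation holds for every exponent. *)
Lemma W_to_double : exists psi : W -> K, {morph psi : x y / x * y} /\
  forall w : seq nat, {subset w <= ls} -> psi (sigma (vx w)) = theta ^ wval t w.
Proof.
pose orb F w := {subset w <= ls} /\ F = vx w.
have /choice[f fP] (F : V) : exists k : K,
    [\/ exists w, orb F w /\ k = theta ^ wval t w,
        (forall w, ~ orb F w) /\ exists w, orb (opp F) w /\ k = theta ^ wval t w
      | [/\ forall w, ~ orb F w, forall w, ~ orb (opp F) w & k = 1]].
  case: (pselect (exists w, orb F w)) => [[w Fw]|nF].
    by exists (theta ^ wval t w); constructor 1; exists w.
  have nF' w : ~ orb F w by move=> Fw; apply: nF; exists w.
  case: (pselect (exists w, orb (opp F) w)) => [[w Fw]|noF].
    by exists (theta ^ wval t w); constructor 2; split=> //; exists w.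
  by exists 1; constructor 3; split=> // w Fw; apply: noF; exists w.
have th2 w : (theta ^ wval t w) ^+ 2 = 1 by rewrite -conjXg expg2 theta2 conj1g.
have orb_same F w w' : orb F w -> orb F w' -> theta ^ wval t w = theta ^ wval t w'.
  by move=> [wl e] [wl' e']; apply: theta_vertex => //; rewrite -e.
have [|||psiM psi_sigma] := @W_lift 3 P s K f.
- by move=> F; case: (fP F) => [[w [_ ->]]|[_ [w [_ ->]]]|[_ _ ->]] //; apply: expg1n.
- move=> F; case: (fP F) => [[w [Fw ->]]|[nF [w [Fw ->]]]|[nF noF ->]].
  + case: (fP (opp F)) => [[w' [[wl' Fw'] ->]]|[_ [w' [Fw' ->]]]|[_ no _]].
    * have [wl FE] := Fw.
      have -> : theta ^ wval t w * theta ^ wval t w'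
          = (theta * theta ^ wval t (w' ++ rev w)) ^ wval t w.
        by rewrite wval_cat t_rev // conjMg -conjgM mulgVK.
      rewrite -conjXg theta_antipode ?conj1g //; first by apply: sub_cat => //;
        apply: sub_rev.
      by rewrite vertex_of_word_move -Fw' -opp_act FE vertex_of_word_petrie6
        vertex_of_word_back.
    * rewrite opp_opp in Fw'; rewrite (orb_same _ _ _ Fw Fw') -expg2 th2.
      exact: expg1n.
    * by case: (no w); rewrite opp_opp.
  + case: (fP (opp F)) => [[w' [Fw' ->]]|[no _]|[no _ _]];
    [|by case: (no w)|by case: (no w)].
    by rewrite (orb_same _ _ _ Fw Fw') -expg2 th2; apply: expg1n.
  + case: (fP (opp F)) => [[w' [Fw' _]]|[_ [w' [Fw' _]]]|[_ _ ->]].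
    * by case: (noF w').
    * by rewrite opp_opp in Fw'; case: (nF w').
    * by rewrite mulg1; apply: expg1n.
- move=> F E EF EoF.
  have oE (F' E' : V) : E' <> F' -> E' <> opp F' -> opp E' <> F'.
    by move=> _ no e; apply: no; rewrite -e opp_opp.
  have key F' E' w w' : orb F' w -> orb E' w' -> E' <> F' -> E' <> opp F' ->
      (theta ^ wval t w * theta ^ wval t w') ^+ 2 = 1.
    move=> [wl FE] [wl' EE] ne no.
    have -> : theta ^ wval t w * theta ^ wval t w'
        = (theta * theta ^ wval t (w' ++ rev w)) ^ wval t w.
      by rewrite wval_cat t_rev // conjMg -conjgM mulgVK.
    have wlE : {subset w' ++ rev w <= ls} by apply: sub_cat => //; apply: sub_rev.
    have back F1 : vx (w' ++ rev w) = F1 -> E' = vertex_act F1 (wval gt w).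
      by move=> <-; rewrite vertex_of_word_move -vertex_actM mulVg vertex_act1.
    rewrite -conjXg theta_edge ?conj1g //.
      by move=> /back; rewrite vertex_of_word_nil -/(vx w) -FE.
    by move=> /back; rewrite vertex_of_word_petrie6 -opp_act -/(vx w) -FE.
  have EoF' : opp E <> F by apply: oE.
  have EoF2 : opp E <> opp F.
    by move=> e; apply: EF; rewrite -(opp_opp E) e opp_opp.
  case: (fP F) => [[w [Fw ->]]|[_ [w [Fw ->]]]|[_ _ ->]];
  case: (fP E) => [[w' [Ew ->]]|[_ [w' [Ew ->]]]|[_ _ ->]];
  rewrite ?mulg1 ?mul1g ?expg1n ?th2 //; apply: key Fw Ew _ _; rewrite ?opp_opp //.
exists (plift f); split=> // w wl; rewrite psi_sigma.
have Fw : orb (vx w) w by [].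
case: (fP (vx w)) => [[w' [Fw' ->]]|[no _]|[no _ _]]; [|by case: (no w)|by case: (no w)].
exact: orb_same Fw' Fw.
Qed.

Section Words.
Variables (X : choiceType) (letter : X -> nat) (tw : X -> bool).
Variables (f : X -> L) (u : X -> K).
Hypothesis letter_ls : forall x, letter x \in ls.
Hypothesis fE : forall x, f x = if tw x then conj0 (inr (gt (letter x))) else inr (gt
  (letter x)).
Hypothesis uE : forall x, u x = if tw x then theta * t (letter x) * theta else t
  (letter x).

(** Every word takes in [K] the value [psi x * wval t v], where [x] is the
    [W]-component of its value in the semidirect product and [v] is the word of
    its letters in [G]. *)
Lemma trivial_halving_word (w : word X) : weval f w = 1 -> weval u w = 1.
Proof.
have [psi [psiM psi_sigma]] := W_to_double.
have psi1 := morph_one psiM.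
pose lw (w : word X) := [seq letter l.1 | l <- w].
have lwl w' : {subset lw w' <= ls} by move=> _ /mapP[l _ ->].
have ti x : t (letter x) * t (letter x) = 1 by rewrite -expg2 t_sq.
have fV x : (f x)^-1 = f x.
  apply: mulg1_eq; rewrite fE; case: (tw x); last by rewrite -inrM -expg2 tau_nat_sq.
  by rewrite -conj0M -inrM -expg2 tau_nat_sq /conj0 mulg1 rho0_sq.
have uV x : (u x)^-1 = u x.
  apply: mulg1_eq; rewrite uE; case: (tw x) => //.
  by rewrite !mulgA -(mulgA _ theta theta) theta2 mulg1 -(mulgA theta) ti mulg1.
have main w' : (weval f w').2 = wval gt (lw w') /\
    weval u w' = psi (weval f w').1 * wval t (lw w').
  elim/last_ind: w' => [|w' [x b] [IH2 IHu]].
    by rewrite /weval !big_nil /= !wval_nil psi1 mulg1.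
  have lwE : lw (rcons w' (x, b)) = rcons (lw w') (letter x) by rewrite /lw map_rcons.
  rewrite lwE !wval_rcons -cats1 !weval_cat IHu.
  have -> : weval f [:: (x, b)] = f x by rewrite /weval big_seq1 /= fV if_same.
  have -> : weval u [:: (x, b)] = u x by rewrite /weval big_seq1 /= uV if_same.
  rewrite fE uE; case: (tw x);
    rewrite ?conj0_inr !sd_mulE /= ?invg1 ?W_act1 ?W_act_one ?mulg1 ?mul1g IH2.
    split=> //; set g := wval gt (lw w').
    rewrite psiM -[LHS]mulgA -[RHS]mulgA; congr (_ * _).
    have vE : vertex_act (base_vertex (tau P)) g^-1 = vx (rev (lw w')).
      by rewrite /vertex_of_word tau_nat_rev.
    have vE' : vertex_act (base_vertex (tau P)) ((gt (letter x))^-1 * g^-1) = vx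
      (letter x :: rev (lw w')).
      by rewrite /vertex_of_word wval_cons tau_nat_rev tau_natV.
    rewrite W_actM /vertex_reflection !W_act_gen -vertex_actM -!/(vertex_reflection _
      _) vE vE'.
    have rl : {subset rev (lw w') <= ls} by apply: sub_rev.
    have xrl : {subset letter x :: rev (lw w') <= ls}.
      by move=> i; rewrite inE => /predU1P[->|/rl].
    rewrite psiM !psi_sigma // wval_cons t_rev // conjgM -conjMg !conjgE invgK.
    rewrite -!mulgA; congr (_ * (_ * _)); rewrite mulKg ti mulg1.
    by rewrite (mulg1_eq (ti x)).
  by split=> //; rewrite mulgA.
move=> w1; have [g1 ->] := main w; rewrite w1 /= psi1 mul1g.
by apply: t_trivial => //; rewrite -g1 w1.
Qed.

End Words.
End Doubling.

Lemma expg_mulC (G : groupType) (x y : G) m : x ^+ 2 = 1 -> y ^+ 2 = 1 ->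
  (x * y) ^+ m = 1 -> (y * x) ^+ m = 1.
Proof.
rewrite !expg2 => /mulg1_eq xV /mulg1_eq yV xy.
by rewrite -[y]yV -[x]xV -invgM expVgn xy invg1.
Qed.

Lemma weval_wseq n (G : groupType) (f : 'I_n.+1 -> G) w :
  weval f (wseq n w) = wval (fun i => f (inord i)) w.
Proof. by rewrite /weval /wval /wseq big_map. Qed.

Lemma wval_succ (G : groupType) (t : nat -> G) w :
  wval (fun i => t i.+1) w = wval t [seq i.+1 | i <- w].
Proof. by rewrite /wval big_map. Qed.

Lemma swap01_val n (i : 'I_n.+2) :
  swap01 i = match nat_of_ord i with 0 => 1 | 1 => 0 | k => k end%N :> nat.
Proof.
have [->|i0] := eqVneq i ord0; first by rewrite /swap01 tpermL.
have [->|i1] := eqVneq i (lift ord0 ord0); first by rewrite /swap01 tpermR.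
rewrite /swap01 tpermD 1?eq_sym //.
by case: i i0 i1 => [[|[|k]] lt].
Qed.

Lemma mH_sym i j : mH i j = mH j i.
Proof. by rewrite /mH minnC maxnC. Qed.

Lemma mH_swap01 n (i j : 'I_n.+2) : n <= 3 -> i != j ->
  mH (swap01 i) (swap01 j) = mH i j.
Proof.
move=> n3; rewrite !swap01_val; case: i j => [i li] [j lj]; rewrite -val_eqE /=.
have i5 : i < 5 by apply: leq_trans li _.
have j5 : j < 5 by apply: leq_trans lj _.
by move: i j i5 j5 {li lj} => [|[|[|[|[|]]]]] // [|[|[|[|[|]]]]].
Qed.

Lemma mH_succ i j : i < 4 -> j < 4 -> i != j -> mH i.+1 j.+1 = m343 i j.
Proof. by case: i j => [|[|[|[|]]]] // [|[|[|[|]]]]. Qed.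

Lemma expg_conj (G : groupType) (x y : G) m : x * x = 1 ->
  (x * y * x) ^+ m = x * y ^+ m * x.
Proof.
move=> xx; have xV := mulg1_eq xx.
by have := conjXg y x m; rewrite !conjgE xV !mulgA => <-.
Qed.

(** For [x = rho0] the left-hand side is the square of a glide reflection of the
    toroidal group, and the right-hand side is the product of the reflections at
    the base vertex and at its image under [a * c * a], the opposite vertex of
    the octahedron. *)
Lemma glide_square (G : groupType) (x a c : G) :
  x * x = 1 -> a * a = 1 -> commute x c -> commute (x * a * x) a ->
  (x * a * x * c * a) ^+ 2 = x * (a * c * a) * x * (a * c * a).
Proof.
move=> xx aa xc ta.
have -> : x * (a * c * a) * x = x * a * x * c * (x * a * x).
  have -> : x * a * x * c * (x * a * x) = x * a * (x * c * x) * (a * x) by rewrite !mulgA.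
  by rewrite xc -(mulgA c) xx mulg1 !mulgA.
set t := x * a * x in ta *.
have -> : t * c * t * (a * c * a) = t * c * (t * a) * (c * a) by rewrite !mulgA.
by rewrite ta expg2 !mulgA.
Qed.

Section Presentation.
Variables (P : cs_polytope 3) (s : nat).
Hypothesis hP : is_24cell P.
Hypothesis hs : 2 <= s.

Local Notation V := (vertex (tau P)).
Local Notation W := (Defs.W P s).
Local Notation L := (two_pow P s).
Local Notation gt := (tau_nat P).
Local Notation vx := (vertex_of_word P).
Local Notation opp F := (vertex_act F (alpha P)).
Local Notation sigma := (@vertex_reflection 3 P s).
Local Notation inl x := (sd_inl (W_action P s) x : L).
Local Notation inr g := (sd_inr (W_action P s) g : L).
Local Notation r := (halving_gen (two_pow_gen P s)).

Lemma halving_gen_gt0 : r ord0 = conj0 (inr (gt 0)).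
Proof. by rewrite halving_gen0 -(tau_nat_ord P ord0). Qed.

Lemma halving_gen_gt (i : 'I_5) : i != ord0 -> r i = inr (gt i.-1).
Proof.
have [j ->|->] := unliftP ord0 i => // _.
by rewrite halving_gen_lift -tau_nat_ord.
Qed.

Lemma halving_genE (i : 'I_5) :
  r i = if i == ord0 then conj0 (inr (gt i.-1)) else inr (gt i.-1).
Proof. by case: eqVneq => [->|i0]; rewrite ?halving_gen_gt0 // halving_gen_gt. Qed.

Lemma conj0_inr_mul g : conj0 (inr g^-1) * inr g = inl (sigma (base_vertex (tau P)) *
  sigma (vertex_act (base_vertex (tau P)) g)).
Proof. by rewrite conj0_inr -mulgA -inrM mulVg invgK [inr 1]sd_split /= -inlM mulg1
  mulg1. Qed.

Lemma edge_square (w : seq nat) : {subset w <= iota 0 4} -> ~~ same_vertex w [::] ->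
  ~~ same_vertex w (petrie 6) -> (conj0 (inr (wval gt w)^-1) * inr (wval gt w)) ^+ 2 = 1.
Proof.
move=> w4 w0 w6; rewrite conj0_inr_mul expg2 -inlM -expg2 -/(vx w) sigma_comm //.
  have n0 : {subset [::] <= iota 0 4} by [].
  by rewrite -vertex_of_word_nil; apply: (same_vertexF hP w4 n0).
by rewrite -(vertex_of_word_petrie6 hP); apply: (same_vertexF hP w4) => //;
  apply: petrie_sub.
Qed.

Lemma halving_gen_coxeter (i j : 'I_5) : i != j -> (r i * r j) ^+ mH i j = 1.
Proof.
have lft (a b : 'I_4) : a != b -> (r (lift ord0 a) * r (lift ord0 b)) ^+ m343 a b = 1.
  move=> ab; rewrite !halving_gen_lift -inrM.
  have [sq br] := tau_nat_coxeter hP.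
  have -> k (g : pgroup P) : (inr g) ^+ k = inr (g ^+ k).
    elim: k => [//|k IH]; by rewrite !expgS IH inrM.
  by rewrite -!tau_nat_ord br // mem_iota /=.
have pos (a b : 'I_5) : a != ord0 -> b != ord0 -> a != b -> (r a * r b) ^+ mH a b = 1.
  have [a' ->|->] := unliftP ord0 a => // _; have [b' ->|->] := unliftP ord0 b => // _ ab.
  by rewrite [mH _ _]mH_succ ?lft // -?val_eqE //; move: ab; rewrite (inj_eq lift_inj).
have zero (b : 'I_5) : b != ord0 -> (r ord0 * r b) ^+ mH ord0 b = 1.
  have [b' ->|->] := unliftP ord0 b => // _; have [->|b'0] := eqVneq b' ord0.
    rewrite halving_gen_lift halving_gen_gt0 -(tau_nat_ord P ord0).
    have [n1 n6 _ _ _] := petrie_vertices.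
    have := @edge_square [:: 0%N] _ n1 n6; rewrite wval1 tau_natV; apply.
    by move=> k; rewrite inE => /eqP ->.
  have -> : r ord0 * r (lift ord0 b') = conj0 (r (lift ord0 ord0) * r (lift ord0 b')).
    have e1 : swap01 (lift ord0 ord0) = ord0 :> 'I_5 by apply: tpermR.
    by rewrite conj0M !conj0_halving_gen e1 swap01_lift.
  have m1 : mH ord0 (lift ord0 b') = mH (lift ord0 ord0 : 'I_5) (lift ord0 b').
    by move: b'0; case: b' => [[|[|[|[|]]]]].
  rewrite /conj0 expg_conj ?rho0_sq // m1 pos ?mulg1 ?rho0_sq //.
  by rewrite (inj_eq lift_inj) eq_sym.
move=> ij; have [i0|i0] := eqVneq i ord0; first by rewrite i0 zero // -i0 eq_sym.
have [j0|j0] := eqVneq j ord0; last exact: pos.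
rewrite j0 mH_sym; apply: expg_mulC; [exact: halving_gen_sq | exact: halving_gen_sq |].
by rewrite zero.
Qed.

Lemma weval_beta_gen : weval r beta = inr (wval gt (iota 0 4)).
Proof.
have -> : weval r beta = wval (fun i => inr (gt i)) (iota 0 4).
  rewrite /beta weval_wseq /wval /= !big_cons !big_nil.
  by rewrite !halving_gen_gt -?val_eqE /= ?inordK.
rewrite /wval; elim: (iota 0 4) => [|i w IH]; first by rewrite !big_nil.
by rewrite !big_cons IH inrM.
Qed.

Lemma weval_beta_tilde_gen : weval r beta_tilde = conj0 (inr (wval gt (iota 0 4))).
Proof.
rewrite -weval_beta_gen /beta /beta_tilde !weval_wseq !wval_cons !wval_nil !mulg1 !conj0M.
rewrite !conj0_halving_gen; congr (r _ * (r _ * (r _ * r _)));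
  by apply: val_inj; rewrite /= swap01_val !inordK.
Qed.

Lemma conj0X y m : conj0 (y : L) ^+ m = conj0 (y ^+ m).
Proof. by rewrite /conj0 expg_conj // rho0_sq. Qed.

Lemma inrX g m : (inr g) ^+ m = inr (g ^+ m).
Proof. by elim: m => [//|m IH]; rewrite !expgS IH inrM. Qed.

Lemma wval_petrieE m : wval gt (iota 0 4) ^+ m = wval gt (petrie m).
Proof. by rewrite wval_petrie !wval_cons wval_nil mulg1 !mulgA. Qed.

Lemma halving_relations w : halving_relator s w -> weval r w = 1.
Proof.
case=> {w} [w|i|].
- apply: coxeter_relatorsP; [exact: halving_gen_sq | exact: halving_gen_coxeter].
- move=> i34; rewrite weval_exp weval_cat !weval_exp weval_winv.
  rewrite weval_beta_gen weval_beta_tilde_gen expVgn conj0X inrX wval_petrieE.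
  have -> y : (conj0 (y : L))^-1 = conj0 y^-1 by rewrite /conj0 !invgM rho0V mulgA.
  rewrite -inrV edge_square //; first exact: petrie_sub.
    by have [_ _ _ _ /allP/(_ _ i34)/andP[]] := petrie_vertices.
  by have [_ _ _ _ /allP/(_ _ i34)/andP[]] := petrie_vertices.
rewrite weval_exp weval_cat !weval_exp weval_beta_gen weval_beta_tilde_gen conj0X !inrX.
rewrite wval_petrieE -(alpha_petrie hP).
have aV : (alpha P)^-1 = alpha P by apply: mulg1_eq; rewrite -expg2 (alpha_invol P).2.
rewrite -{1}aV conj0_inr_mul.
have -> k x : (inl x) ^+ k = inl (x ^+ k).
  by elim: k => [//|k IH]; rewrite !expgS IH inlM.
by rewrite sigma_opp.
Qed.

End Presentation.

Section PresentationConverse.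
Variables (P : cs_polytope 3) (s : nat).
Hypothesis hP : is_24cell P.
Hypothesis hs : 2 <= s.

Local Notation L := (two_pow P s).
Local Notation gt := (tau_nat P).
Local Notation vx := (vertex_of_word P).
Local Notation opp F := (vertex_act F (alpha P)).
Local Notation inr g := (sd_inr (W_action P s) g : L).
Local Notation r := (halving_gen (two_pow_gen P s)).

(** Common part of the two presentations: it remains to derive from the
    relators, in any group [K] where an involution [theta] exchanges the first
    two generators, the relations of [W] at the vertices that words in the other
    generators lead to. *)
Lemma presentation_from_double n (R : word 'I_n.+2 -> Prop) reps (f : 'I_n.+2 -> L) :
  n <= 3 -> chain_tables reps (iota 0 n.+1) ->
  (forall w, coxeter_relator mH w -> R w) ->
  (forall w, R w -> weval (pgen R \o @swap01 n) w = 1) ->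
  (forall i, f i = if i == ord0 then conj0 (inr (gt i.-1)) else inr (gt i.-1)) ->
  (forall (K : groupType) (kappa : 'I_n.+2 -> K) (theta : K)
      (t := fun i : nat => kappa (inord i.+1)),
    (forall w, R w -> weval kappa w = 1) -> theta * theta = 1 ->
    (forall i, theta * kappa i * theta = kappa (swap01 i)) ->
    coxeter_family (iota 0 n.+1) t ->
    {in iota 1 n, forall i, commute theta (t i)} ->
    (forall w : seq nat, {subset w <= iota 0 n.+1} -> wval gt w = 1 -> wval t w = 1) ->
    (forall w w' : seq nat, {subset w <= iota 0 n.+1} -> {subset w' <= iota 0 n.+1} ->
       vx w = vx w' -> theta ^ wval t w = theta ^ wval t w') ->
    forall w : seq nat, {subset w <= iota 0 n.+1} ->
      (vx w <> vx [::] -> vx w <> vx (petrie 6) -> (theta * theta ^ wval t w) ^+ 2 = 1) /\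
      (vx w = vx (petrie 6) -> (theta * theta ^ wval t w) ^+ s = 1)) ->
  forall w, weval f w = 1 -> weq R w [::].
Proof.
move=> n3 tab Rcox Rsw fE rel w w1.
have [K [iota_ [theta [iM iinj th2 thg]]]] := extend_by_involution (@swap01K n) Rsw.
pose kappa i := iota_ (pgen R i).
have kw v : weval kappa v = iota_ (weval (pgen R) v) by rewrite weval_morph.
have i1 := morph_one iM.
have kR v : R v -> weval kappa v = 1 by move=> Rv; rewrite kw weval_pgen_rel.
pose t i := kappa (inord i.+1).
have ls4 : {subset iota 0 n.+1 <= iota 0 4}.
  by move=> i; rewrite !mem_iota /= add0n => /leq_trans; apply.
have cox : coxeter_family (iota 0 n.+1) t.
  split=> [i _|i j].
    by have := kR _ (Rcox _ (cox_square _ (inord i.+1))); rewrite weval_exp weval_letter.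
  rewrite !mem_iota /= !add0n => li lj ij.
  have ij' : inord i.+1 != inord j.+1 :> 'I_n.+2.
    by rewrite -val_eqE /= !inordK.
  have := kR _ (Rcox _ (cox_braid _ ij'));
    rewrite weval_exp weval_cat !weval_letter !inordK //.
  by rewrite mH_succ //; [apply: leq_trans li _ | apply: leq_trans lj _].
have comm : {in iota 1 n, forall i, commute theta (t i)}.
  move=> i; rewrite mem_iota add1n => /andP[i1' ni].
  have := thg (inord i.+1); have -> : swap01 (inord i.+1) = inord i.+1 :> 'I_n.+2.
    by apply: val_inj; rewrite /= swap01_val !inordK //; case: i i1' {ni}.
  rewrite -/(kappa _) -/(t i) => e.
  by rewrite /commute -{2}e -(mulgA _ theta theta) th2 mulg1.
have ttriv v : {subset v <= iota 0 n.+1} -> wval gt v = 1 -> wval t v = 1.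
  move=> vl v1; rewrite (trivial_word hP tab _ ls4 vl v1 cox) ?wval_nil //.
  exact: iota_uniq.
have comm' : {in iota 0 n.+1, forall i, i != 0%N -> commute theta (t i)}.
  move=> i il i0; apply: comm; move: il; rewrite !mem_iota add0n add1n /= => ->.
  by rewrite lt0n i0.
have same := theta_vertex ls4 ttriv comm'.
have {}rel := rel K kappa theta kR th2 thg cox comm ttriv same.
have w_k : weval kappa w = 1.
  apply: (@trivial_halving_word P s (iota 0 n.+1) hP ls4 K theta t ttriv th2 comm' _ _
     'I_n.+2 (fun i => i.-1) (fun i => i == ord0) f kappa) => //.
  - by move=> v vl; have [] := rel v vl.
  - by move=> v vl; have [] := rel v vl.
  - by move=> i; rewrite mem_iota /= add0n; case: i => [[|i] li].
  move=> i; case: eqVneq => [->|i0]; rewrite /t /=.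
    rewrite thg; congr (iota_ (pgen R _)); apply: val_inj.
    by rewrite /= swap01_val inordK.
  by congr kappa; apply: val_inj; rewrite /= inordK ?prednK ?lt0n.
have : weval (pgen R) w = 1 by apply: iinj; rewrite -kw w_k i1.
by rewrite -cl_weval => /clP.
Qed.

Lemma coxeter_swap n (R : word 'I_n.+2 -> Prop) w : n <= 3 ->
  (forall w, coxeter_relator mH w -> R w) ->
  coxeter_relator mH w -> weval (pgen R \o @swap01 n) w = 1.
Proof.
move=> n3 Rcox; have rel v : R v -> weval (pgen R) v = 1 by apply: weval_pgen_rel.
apply: coxeter_relatorsP => [i|i j ij] /=.
  by have := rel _ (Rcox _ (cox_square _ (swap01 i))); rewrite weval_exp weval_letter.
have sij : swap01 i != swap01 j by rewrite (inj_eq (inv_inj (@swap01K n))).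
have := rel _ (Rcox _ (cox_braid _ sij)).
by rewrite weval_exp weval_cat !weval_letter mH_swap01.
Qed.

End PresentationConverse.

Lemma expg_swap (G : groupType) (x y : G) m : (x * y) ^+ m = 1 -> (y * x) ^+ m = 1.
Proof.
have -> : y * x = (x * y) ^ x by rewrite conjgE !mulgA mulVg mul1g.
by rewrite -conjXg => ->; apply: conj1g.
Qed.

Lemma mulg_conj (G : groupType) (x g : G) : x * x ^ g = x * g^-1 * x * g.
Proof. by rewrite conjgE !mulgA. Qed.

Section Presentations.
Variables (P : cs_polytope 3) (s : nat).
Hypothesis hP : is_24cell P.
Hypothesis hs : 2 <= s.

Local Notation L := (two_pow P s).
Local Notation gt := (tau_nat P).
Local Notation vx := (vertex_of_word P).
Local Notation opp F := (vertex_act F (alpha P)).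
Local Notation inl x := (sd_inl (W_action P s) x : L).
Local Notation inr g := (sd_inr (W_action P s) g : L).
Local Notation r := (halving_gen (two_pow_gen P s)).

(** Exchanging [beta] and its tilde inverts the bases of the first two extra
    relators and conjugates that of the third. *)
Lemma halving_relator_swap w : halving_relator s w ->
  weval (pgen (halving_relator s) \o @swap01 3) w = 1.
Proof.
set R := halving_relator s; set f := _ \o _.
have rel v : R v -> weval (pgen R) v = 1 by apply: weval_pgen_rel.
have fb : weval f beta = weval (pgen R) beta_tilde.
  rewrite /beta /beta_tilde !weval_wseq !wval_cons !wval_nil /f /=.
  by congr (pgen R _ * (pgen R _ * (pgen R _ * (pgen R _ * _))));
    apply: val_inj; rewrite /= swap01_val !inordK.
have fbt : weval f beta_tilde = weval (pgen R) beta.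
  rewrite /beta /beta_tilde !weval_wseq !wval_cons !wval_nil /f /=.
  by congr (pgen R _ * (pgen R _ * (pgen R _ * (pgen R _ * _))));
    apply: val_inj; rewrite /= swap01_val !inordK.
case=> {w} [w|i i34|].
- by apply: coxeter_swap => // v; apply: halving_coxeter.
- have := rel _ (halving_comm s i34); move: beta beta_tilde fb fbt => b bt fb fbt.
  rewrite !weval_exp !weval_cat !weval_exp !weval_winv fb fbt !expVgn => h.
  by rewrite -[X in (_ * X) ^+ _]invgK -invgM expVgn h invg1.
have := rel _ (halving_power s); move: beta beta_tilde fb fbt => b bt fb fbt.
rewrite !weval_exp !(weval_cat _ (wexp bt _)) (weval_exp _ bt) (weval_exp _ b).
by rewrite (weval_exp _ bt) (weval_exp _ b) fb fbt => /expg_swap.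
Qed.

(** The five cases for the orbit of a vertex: the base vertex is excluded, a
    neighbour gives the commutation of the first two generators, 3 and 4 Petrie
    steps give the first two extra relators, and 6 steps give the third. *)
Theorem halving_presentation : presented_by r (halving_relator s).
Proof.
move=> w; split=> [|wR]; last first.
  by have := weval_weq (@halving_relations P s hP) wR; rewrite /weval big_nil.
apply: (presentation_from_double hP _ tables_343) => //.
- by move=> v; apply: halving_coxeter.
- exact: halving_relator_swap.
- exact: halving_genE.
move=> K kappa theta t kR th2 thg cox comm ttriv same v v4.
have [x [q [xx q3 vE]]] := vertex_orbits hP v4.
have q4 : {subset q <= iota 0 4} by move=> i /q3; rewrite !mem_iota; lia.
have x4 : {subset x <= iota 0 4}.
  move: xx; rewrite !inE => /orP[/eqP->|/orP[/eqP->|/or3P[] /eqP->]] //;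
    try exact: petrie_sub.
  by move=> i; rewrite !inE => ->.
have cq : theta ^ wval t q = theta.
  apply/conjg_fixP/commgP; elim: q q3 {q4 vE} => [|i q IH] q3.
    by rewrite wval_nil; apply: commute1.
  rewrite wval_cons; apply: commuteM; first by apply: comm; apply: q3; rewrite mem_head.
  by apply: IH => j jq; apply: q3; rewrite inE jq orbT.
have -> : theta * theta ^ wval t v = (theta * theta ^ wval t x) ^ wval t q.
  rewrite (same v (x ++ q)) //; last by move=> i; rewrite mem_cat => /orP[/x4|/q4].
  by rewrite wval_cat conjMg cq conjgM.
have thV : theta^-1 = theta := mulg1_eq th2.
have comm34 i : i \in [:: 3; 4]%N ->
    ((weval kappa beta_tilde)^-1 ^+ i * weval kappa beta ^+ i) ^+ 2 = 1.
  move=> i34; have := kR _ (halving_comm s i34); move: beta beta_tilde => b bt.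
  by rewrite weval_exp weval_cat !weval_exp weval_winv.
have pow6 : (weval kappa beta_tilde ^+ 6 * weval kappa beta ^+ 6) ^+ s = 1.
  have := kR _ (halving_power s); move: beta beta_tilde => b bt.
  by rewrite weval_exp (weval_cat _ (wexp bt _)) (weval_exp _ bt) (weval_exp _ b).
have bE : wval t (iota 0 4) = weval kappa beta 
  by rewrite /beta weval_wseq; apply: (wval_succ (fun i => kappa (inord i)) (iota 0 4)).
have btE : weval kappa beta_tilde = theta * wval t (iota 0 4) * theta.
  have thM x1 x2 : theta * (x1 * x2) * theta = (theta * x1 * theta) * (theta * x2 *
    theta).
    by rewrite !mulgA -(mulgA _ theta theta) th2 mulg1.
  rewrite /beta_tilde weval_wseq !wval_cons !wval_nil !mulg1 !thM /t !thg.
  by congr (kappa _ * (kappa _ * (kappa _ * kappa _))); apply: val_inj;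
    rewrite /= swap01_val !inordK.
move: (weval kappa beta) (weval kappa beta_tilde) comm34 pow6 bE btE =>
  B T comm34 pow6 bE btE.
have petE m : wval t (petrie m) = B ^+ m.
  elim: m => [|m IH]; first by rewrite wval_nil.
  have -> : petrie m.+1 = iota 0 4 ++ petrie m by [].
  by rewrite wval_cat IH bE expgS.
have thB m : theta * B ^+ m * theta = T ^+ m by rewrite btE bE expg_conj.
have thpet m : theta * theta ^ wval t (petrie m) = T^-1 ^+ m * B ^+ m.
  by rewrite mulg_conj petE expVgn -thB !invgM thV mulgA.
split=> [v0 v6|v6].
  rewrite -conjXg; move: xx vE;
    rewrite !inE => /orP[/eqP->|/orP[/eqP->|/or3P[] /eqP->]] vE.
  - by case: v0; rewrite vE /= -[q]cats0 vertex_of_word_stable.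
  - rewrite mulg_conj wval1 (mulg1_eq (y := t 0%N)) -?expg2 ?(cox.1 0%N) //.
    have ij : inord 0 != inord 1 :> 'I_5 by rewrite -val_eqE /= !inordK.
    have := kR _ (halving_coxeter s (cox_braid mH ij)).
    rewrite weval_exp weval_cat !weval_letter !inordK //.
    have <- : theta * t 0%N * theta = kappa (inord 0).
      by rewrite thg; congr kappa; apply: val_inj; rewrite /= swap01_val !inordK.
    by move=> ->; apply: conj1g.
  - by rewrite thpet comm34 // conj1g.
  - by rewrite thpet comm34 // conj1g.
  by case: v6; rewrite vE vertex_of_word_cat (vertex_of_word_petrie6 hP) -opp_act -/(vx
    q) -[q]cats0 vertex_of_word_stable // vertex_of_word_nil.
have p6 : {subset petrie 6 <= iota 0 4} by exact: petrie_sub.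
have -> : (theta * theta ^ wval t x) ^ wval t q = theta * theta ^ wval t (petrie 6).
  rewrite -(same v (petrie 6)) // (same v (x ++ q)) //.
    by rewrite wval_cat conjMg cq conjgM.
  by move=> i; rewrite mem_cat => /orP[/x4|/q4].
rewrite thpet; have T12 : T ^+ 12 = 1.
  have : wval t (petrie 12) = 1.
    apply: ttriv; first exact: petrie_sub.
    by rewrite wval_petrie -[12]/(6 * 2)%N expgnA -wval_petrie -(alpha_petrie hP)
      (alpha_invol P).2.
  by rewrite petE -thB => ->; rewrite mulg1 th2.
have -> : T^-1 ^+ 6 = T ^+ 6 by rewrite expVgn; apply: mulg1_eq; rewrite -expgnDr.
exact: pow6.
Qed.

End Presentations.

Section ToroidalResidue.
Variables (P : cs_polytope 3) (s : nat).
Hypothesis hP : is_24cell P.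
Hypothesis hs : 2 <= s.

Local Notation L := (two_pow P s).
Local Notation gt := (tau_nat P).
Local Notation vx := (vertex_of_word P).
Local Notation opp F := (vertex_act F (alpha P)).
Local Notation inl x := (sd_inl (W_action P s) x : L).
Local Notation inr g := (sd_inr (W_action P s) g : L).
Local Notation r := (halving_gen (two_pow_gen P s)).
Local Notation rt := (r \o lift (@ord_max 4)).

Lemma toroidal_relator_swap w : toroidal_relator w ->
  weval (pgen toroidal_relator \o @swap01 2) w = 1.
Proof.
set R := toroidal_relator.
have rel v : R v -> weval (pgen R) v = 1 by apply: weval_pgen_rel.
case=> {w} [w|]; first by apply: coxeter_swap => // v; apply: toroidal_coxeter.
have := rel _ toroidal_translation; rewrite !weval_exp !weval_wseq.
set p := fun i => pgen R (inord i); set q := fun i => _.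
have qE : wval q [:: 0; 2; 3; 2; 1]%N = wval p (rev [:: 0; 2; 3; 2; 1])%N.
  rewrite !wval_cons !wval_nil /p /q /=.
  by congr (pgen R _ * (pgen R _ * (pgen R _ * (pgen R _ * (pgen R _ * _)))));
    apply: val_inj; rewrite /= swap01_val !inordK.
have sq i : p i ^+ 2 = 1.
  by have := rel _ (toroidal_coxeter (cox_square _ (inord i)));
    rewrite weval_exp weval_letter.
by rewrite qE wval_rev ?expVgn => [->|i _]; rewrite ?invg1.
Qed.

Lemma rtE (i : 'I_4) : rt i = if i == ord0 then conj0 (inr (gt i.-1)) else inr (gt i.-1).
Proof.
have e : (lift ord_max i == ord0 :> 'I_5) = (i == ord0).
  by rewrite -!val_eqE; have := lift_max i; move=> /= ->.
by rewrite /= halving_genE e lift_max.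
Qed.

Lemma toroidal_relations w : toroidal_relator w -> weval rt w = 1.
Proof.
case=> {w} [w|].
  apply: coxeter_relatorsP => [i|i j ij] /=; first exact: halving_gen_sq.
  have := halving_gen_coxeter s hP (i := lift ord_max i) (j := lift ord_max j).
  by rewrite (inj_eq lift_inj) !lift_max; apply.
rewrite weval_exp weval_wseq !wval_cons !wval_nil mulg1.
have -> : rt (inord 0) = conj0 (inr (gt 0)) by rewrite rtE -val_eqE /= inordK.
have pos i : i.+1 < 4 -> rt (inord i.+1) = inr (gt i).
  by move=> i4; rewrite rtE -val_eqE /= inordK.
rewrite !pos //; set a := inr (gt 0); set c := inr (wval gt [:: 1; 2; 1]%N).
have gt2 i : gt i * gt i = 1 by rewrite -expg2 tau_nat_sq.
have aa : a * a = 1 by rewrite -inrM gt2.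
have rc : commute (rho0 P s) c.
  apply: rho0_commute; apply: word_gen => i.
  rewrite !inE => /or3P[] /eqP ->; split=> //= /(congr1 val) /=; rewrite inordK //.
have ta : commute (conj0 a) a.
  have := halving_gen_coxeter s hP (i := ord0) (j := lift ord0 ord0) isT.
  rewrite halving_gen_lift halving_gen_gt0 -(tau_nat_ord P ord0) -/a => e.
  by apply: commute_expg2 e; rewrite ?conj0X expg2 aa // /conj0 mulg1 rho0_sq.
have -> : conj0 a * (inr (gt 1) * (inr (gt 2) * (inr (gt 1) * inr (gt 0)))) = conj0 a *
  c * a.
  by rewrite /c !wval_cons !wval_nil mulg1 !inrM !mulgA.
rewrite -[4]/(2 * 2)%N expgnA (glide_square (rho0_sq P s) aa rc ta).
have -> : a * c * a = inr (wval gt [:: 0; 1; 2; 1; 0]%N).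
  by rewrite -!inrM !wval_cons !wval_nil !mulg1 !mulgA.
have [_ _ n1 n6 _] := petrie_vertices.
have := @edge_square P s hP [:: 0; 1; 2; 1; 0]%N _ n1 n6.
rewrite -tau_nat_rev /=; apply.
by move=> i; rewrite ?(inE, mem_iota); lia.
Qed.

(** No two vertices of the facet are antipodal, so only commutation relations
    are needed: for neighbours it is a Coxeter relation, for opposite vertices
    of the octahedron it is the extra relation, by [glide_square]. *)
Theorem toroidal_presentation : presented_by rt toroidal_relator.
Proof.
move=> w; split=> [|wR]; last first.
  by have := weval_weq toroidal_relations wR; rewrite /weval big_nil.
apply: (presentation_from_double hP _ tables_34) => //.
- by move=> v; apply: toroidal_coxeter.
- exact: toroidal_relator_swap.
- exact: rtE.
move=> K kappa theta t kR th2 thg cox comm ttriv same v v3.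
have [x [q [xx q2 vE]]] := facet_vertex_orbits hP v3.
have q3 : {subset q <= iota 0 3} by move=> i /q2; rewrite !mem_iota; lia.
have q13 : {subset q <= iota 1 3} by move=> i /q2; rewrite !mem_iota; lia.
have x3 : {subset x <= iota 0 3}.
  by move: xx; rewrite !inE => /or3P[] /eqP -> i; rewrite !inE; lia.
have cq : theta ^ wval t q = theta.
  apply/conjg_fixP/commgP; elim: q q2 {q3 q13 vE} => [|i q IH] q2.
    by rewrite wval_nil; apply: commute1.
  rewrite wval_cons; apply: commuteM; first by apply: comm; apply: q2; rewrite mem_head.
  by apply: IH => j jq; apply: q2; rewrite inE jq orbT.
have thV : theta^-1 = theta := mulg1_eq th2.
split=> [v0 v6|v6]; last by case: (facet_antipode hP v3 v6).
have -> : theta * theta ^ wval t v = (theta * theta ^ wval t x) ^ wval t q.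
  rewrite (same v (x ++ q)) //; last by move=> i; rewrite mem_cat => /orP[/x3|/q3].
  by rewrite wval_cat conjMg cq conjgM.
rewrite -conjXg.
have t2 i : i < 3 -> t i * t i = 1 by move=> i3; rewrite -expg2 (cox.1 i) // mem_iota.
have ttE : theta * t 0%N * theta = kappa (inord 0).
  by rewrite thg; congr kappa; apply: val_inj; rewrite /= swap01_val !inordK.
have edge : (theta * t 0%N * theta * t 0%N) ^+ 2 = 1.
  have ij : inord 0 != inord 1 :> 'I_4 by rewrite -val_eqE /= !inordK.
  have := kR _ (toroidal_coxeter (cox_braid mH ij)).
  by rewrite weval_exp weval_cat !weval_letter !inordK // ttE.
have t0V : (t 0%N)^-1 = t 0%N by apply: mulg1_eq; apply: t2.
move: xx vE; rewrite !inE => /or3P[] /eqP -> vE.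
- by case: v0; rewrite vE /= -[q]cats0 vertex_of_word_stable.
- by rewrite mulg_conj wval1 t0V edge conj1g.
rewrite mulg_conj -wval_rev /=; last first.
  by move=> i; rewrite !inE => il; apply: cox.1; rewrite ?(inE, mem_iota); lia.
set c := wval t [:: 1; 2; 1]%N.
have -> : wval t [:: 0; 1; 2; 1; 0]%N = t 0%N * c * t 0%N.
  by rewrite /c !wval_cons !wval_nil !mulg1 !mulgA.
have tc : commute theta c.
  by rewrite /c !wval_cons wval_nil mulg1; do ?apply: commuteM; apply: comm.
have ta : commute (theta * t 0%N * theta) (t 0%N).
  apply: commute_expg2 edge; rewrite expg2 ?t2 //.
  by rewrite !mulgA -(mulgA _ theta theta) th2 mulg1 -(mulgA theta) t2 // mulg1.
rewrite -(glide_square th2 (t2 0%N isT) tc ta) -expgnA.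
have := kR _ toroidal_translation; rewrite weval_exp weval_wseq.
have -> : wval (fun i => kappa (inord i)) [:: 0; 2; 3; 2; 1]%N
    = theta * t 0%N * theta * c * t 0%N.
  by rewrite /c !wval_cons !wval_nil !mulg1 !mulgA ttE.
by move=> ->; apply: conj1g.
Qed.

Theorem toroidal_residue : toroidal_residue_is_400 r.
Proof.
split; first exact: toroidal_presentation.
pose phi : presented_group toroidal_relator -> L := plift rt.
have phiM : {morph phi : x y / x * y} := pliftM toroidal_relations.
have phip i : phi (pgen toroidal_relator i) = r (lift ord_max i).
  exact: (plift_gen toroidal_relations i).
have phi_inj : injective phi.
  move=> x y xy; apply: divg1_eq.
  have : phi (x / y) = 1 by rewrite phiM xy -phiM mulgV (morph_one phiM).
  move: (x / y); elim/clW => w; rewrite /phi plift_cl; last exact: toroidal_relations.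
  by move/toroidal_presentation/clP.
exact: base_residue_isomorphism phiM phi_inj phip (halving_helly hs) (halving_meets hs).
Qed.

End ToroidalResidue.

(** * The order of the halving group *)

Lemma prod_update (G : groupType) (I : eqType) (l : seq I) (F F' : I -> G) j x :
  uniq l -> j \in l -> F' j = F j * x ->
  (forall i, i != j -> F' i = F i /\ commute x (F i)) ->
  (\prod_(i <- l) F i) * x = \prod_(i <- l) F' i.
Proof.
move=> ul jl Fj Fi; elim: l ul jl => // i l IH /= /andP[il ul]; rewrite !big_cons inE.
have [ji _|ij /= jl] := eqVneq j i; last first.
  by rewrite -mulgA IH // (Fi i _).1 // eq_sym.
rewrite -ji Fj -!mulgA; congr (_ * _).
have lj k : k \in l -> k != j by move=> kl; apply: contraNneq il => kj; rewrite -ji -kj.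
have -> : \prod_(k <- l) F' k = \prod_(k <- l) F k.
  by apply: eq_big_seq => k /lj kj; rewrite (Fi k kj).1.
rewrite big_seq_cond; apply/esym/commute_prod => k; rewrite andbT => /lj kj.
exact: (Fi k kj).2.
Qed.

Section Order.
Variables (n : nat) (P : cs_polytope n) (s : nat) (I : finType).
Hypothesis hs : 2 <= s.

Local Notation V := (vertex (tau P)).
Local Notation W := (Defs.W P s).
Local Notation opp F := (vertex_act F (alpha P)).
Local Notation sigma := (@vertex_reflection n P s).

Variable hv : I -> V.
Hypothesis hv_cover : forall F, exists i, F = hv i \/ F = opp (hv i).
Hypothesis hv_inj : injective hv.
Hypothesis hv_opp : forall i j, hv i <> opp (hv j).

(** The element of the dihedral factor of [hv i] that carries the base point of
    the polygon to [p]. *)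
Definition dih_elt (i : I) (p : gon s) : W :=
  (sigma (hv i) * sigma (opp (hv i))) ^+ (p.1 : nat) * sigma (hv i) ^+ p.2.

Definition W_elt (phi : {ffun I -> gon s}) : W := \prod_(i : I) dih_elt i (phi i).

Lemma oppK_inj : injective (fun F : V => opp F).
Proof. exact: inv_inj (@opp_opp n P). Qed.

Let sq F : sigma F * sigma F = 1. Proof. by rewrite -expg2 sigma_sq. Qed.

Lemma dih_elt_flip_a i p : dih_elt i (flip_a p) = dih_elt i p * sigma (hv i).
Proof.
by case: p => k []; rewrite /dih_elt /= ?expg0 ?expg1 ?mulg1 -?mulgA ?sq ?mulg1.
Qed.

Lemma dih_elt_flip_b i p : dih_elt i (flip_b p) = dih_elt i p * sigma (opp (hv i)).
Proof.
have up k : dih_elt i ((k + 1)%R, false) = dih_elt i (k, true) * sigma (opp (hv i)).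
  have kE : (k + 1)%R = (k.+1)%:R%R by rewrite -[k in LHS]natr_Zp GRing.mulrSr.
  have expg_mod m : (sigma (hv i) * sigma (opp (hv i))) ^+ (m %% s)
      = (sigma (hv i) * sigma (opp (hv i))) ^+ m.
    by rewrite [in RHS](divn_eq m s) expgnDr mulnC expgnA sigma_opp expg1n mul1g.
  by rewrite kE /dih_elt (val_Zp_nat hs) expg_mod expg0 expg1 mulg1 -mulgA -expgSr.
case: p => k [] /=; first exact: up.
have := up (k - 1)%R; rewrite GRing.subrK => ->.
by rewrite -mulgA sq mulg1.
Qed.

(** Multiplication by a reflection changes one factor only: it commutes with all
    factors belonging to other antipodal pairs. *)
Lemma W_elt_sigma phi F : exists psi, W_elt phi * sigma F = W_elt psi.
Proof.
have [j jF] := hv_cover F.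
have comm i : i != j -> forall p, commute (sigma F) (dih_elt i p).
  move=> /eqP ij p.
  have [F1 F2] : hv i <> F /\ opp (hv i) <> F.
    case: jF => ->; split; [by move/hv_inj | by move/esym; apply: hv_opp |
      exact: hv_opp | by move/oppK_inj/hv_inj].
  have c1 : commute (sigma F) (sigma (hv i)).
    apply: commute_expg2; rewrite ?sigma_sq ?sigma_comm // => e.
    by apply: F2; rewrite e opp_opp.
  have c2 : commute (sigma F) (sigma (opp (hv i))).
    apply: commute_expg2; rewrite ?sigma_sq ?sigma_comm // => e.
    by apply: F1; apply: oppK_inj.
  by apply: commuteM; apply: commuteX => //; apply: commuteM.
pose fl := if F == hv j then @flip_a s else @flip_b s.
exists [ffun i => if i == j then fl (phi i) else phi i].
apply: (@prod_update _ _ _ _ _ j) => [||/=|i ij];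
  rewrite ?ffunE ?index_enum_uniq ?mem_index_enum //.
- rewrite eqxx /fl; case: eqP => [->|nF]; first exact: dih_elt_flip_a.
  by rewrite dih_elt_flip_b; case: jF => // <-.
by rewrite (negPf ij); split=> //; apply: comm.
Qed.

Lemma W_elt_surj x : exists phi, W_elt phi = x.
Proof.
elim/W_ind: x => [|x F [phi <-]]; last by have [psi ->] := W_elt_sigma phi F; exists psi.
exists [ffun => (0%R, false)]; rewrite /W_elt big1 // => i _.
by rewrite ffunE /dih_elt !expg0 mulg1.
Qed.

(** The projection to each dihedral factor recovers the corresponding point of
    the polygon. *)
Lemma W_elt_inj : injective W_elt.
Proof.
have proj phi j : dih_proj (hv j) (W_elt phi) (0%R, false) = phi j.
  have p1 := morph_one (dih_projM hs (hv j)).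
  have pX (x : W) m : dih_proj (hv j) (x ^+ m) = dih_proj (hv j) x ^+ m.
    by elim: m => [|m IH]; rewrite ?expg0 ?p1 // !expgS (dih_projM hs) IH.
  rewrite /W_elt (big_morph _ (dih_projM hs (hv j)) p1) (@big_only1 _ _ _ _ j) //=.
    rewrite /dih_elt (dih_projM hs) !pX (dih_projM hs) !(dih_proj_sigma hs) /dih_gen eqxx.
    rewrite (introF eqP (@opp_neq _ _ (hv j))) eqxx permM dih_rotation /= GRing.add0r
      natr_Zp.
    by case: (phi j) => k []; rewrite /= ?expg1 ?expg0 ?perm1 ?permE.
  move=> i ij _; rewrite /dih_elt (dih_projM hs) !pX (dih_projM hs) !(dih_proj_sigma
    hs) /dih_gen.
  rewrite (inj_eq hv_inj) (negPf ij) (introF eqP (@hv_opp i j)).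
  rewrite (introF eqP (fun e => @hv_opp j i (esym e))) (inj_eq oppK_inj).
  by rewrite (inj_eq hv_inj) (negPf ij) mulg1 !expg1n mulg1.
by move=> phi psi e; apply/ffunP => j; rewrite -!proj e.
Qed.

End Order.

(** * The halving group of the 24-cell *)
Section Halving24.
Variables (P : cs_polytope 3) (s : nat).
Hypothesis hP : is_24cell P.
Hypothesis hs : 2 <= s.

Local Notation V := (vertex (tau P)).
Local Notation L := (two_pow P s).
Local Notation gt := (tau_nat P).
Local Notation vx := (vertex_of_word P).
Local Notation opp F := (vertex_act F (alpha P)).
Local Notation r := (halving_gen (two_pow_gen P s)).

Definition half_vertex (i : 'I_12) : V := vx (nth [::] half_vertices i).

Lemma half_vertices_sub u : u \in half_vertices -> {subset u <= iota 0 4}.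
Proof. by move=> /mem_take; apply: chain_sub tables_343. Qed.

Lemma half_vertex_mem (i : 'I_12) : nth [::] half_vertices i \in half_vertices.
Proof. by apply: mem_nth; case: i. Qed.

Lemma half_vertex_cover F : exists i, F = half_vertex i \/ F = opp (half_vertex i).
Proof.
have [w w4 ->] := vertex_of_word_surj F;
  have [q [v [q3 vr v4 wqv]]] := chain_decompose tables_343 w4.
have -> : vx w = vx v by rewrite -(vertex_of_word_stable P v q3) /vertex_of_word (wqv _
  _ (tau_nat_coxeter hP)).
have /allP/(_ v vr)/hasP[u uh uv] := half_vertices_complete.
have u4 := half_vertices_sub uh.
have ui : index u half_vertices < 12 by rewrite index_mem.
exists (Ordinal ui); rewrite /half_vertex /= nth_index // (vertex_of_word_alpha hP).
case/orP: uv => /same_vertexP uv; [left|right]; apply/esym/uv => // i.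
by rewrite mem_cat => /orP[/u4 //|/petrie_sub].
Qed.

Lemma half_vertex_inj : injective half_vertex.
Proof.
move=> i j /(vertex_of_word_act hP (half_vertices_sub (half_vertex_mem i))
  (half_vertices_sub (half_vertex_mem j))) e.
have uh := half_vertices_uniq.
have ij := map_uniq_inj uh (half_vertex_mem i) (half_vertex_mem j) e.
apply/val_inj/eqP; rewrite -(nth_uniq [::] _ _ (map_uniq uh)) ?ij //;
  by [case: i {e ij}|case: j {e ij}].
Qed.

Lemma half_vertex_opp i j : half_vertex i <> opp (half_vertex j).
Proof.
have [u4 v4] := (half_vertices_sub (half_vertex_mem i), half_vertices_sub
  (half_vertex_mem j)).
have /allP/(_ _ (half_vertex_mem i))/allP/(_ _ (half_vertex_mem j))/negP ne :=
  half_vertices_opp.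
rewrite /half_vertex (vertex_of_word_alpha hP) => e; apply: ne;
  apply/(same_vertexP hP u4) => // k.
by rewrite mem_cat => /orP[/v4 //|/petrie_sub].
Qed.

Lemma group_343_enum :
  exists l : seq (pgroup P), [/\ uniq l, size l = 1152 & forall g, g \in l].
Proof.
exists (map (wval gt) (normal_forms reps_343 (iota 0 4))); split.
- rewrite map_inj_in_uniq; first exact: (normal_forms_uniq tables_343).
  move=> u v uN vN uv; apply: (normal_forms_inj tables_343 _ _ uN vN) => //.
  exact: (wval_act hP (normal_forms_sub tables_343 uN) (normal_forms_sub tables_343 vN)).
- by rewrite size_map size_normal_forms !big_cons big_nil.
move=> g; have [w w4 <-] := all_word g.
have [u uN wu] := normal_form_exists tables_343 w4.
by apply/mapP; exists u; rewrite // (wu _ _ (tau_nat_coxeter hP)).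
Qed.

Section Enumeration.
Variable l : seq (pgroup P).
Hypothesis ul : uniq l.
Hypothesis sl : size l = 1152.
Hypothesis lg : forall g, g \in l.

Definition two_pow_elt (x : {ffun 'I_12 -> gon s} * 'I_(size l)) : L :=
  (W_elt half_vertex x.1, nth 1 l x.2).

Lemma two_pow_elt_inj : injective two_pow_elt.
Proof.
move=> [phi i] [psi j] [/(W_elt_inj hs half_vertex_inj half_vertex_opp) /= -> ij].
by congr (_, _); apply/val_inj/eqP; rewrite -(nth_uniq 1 (ltn_ord i) (ltn_ord j) ul) ij.
Qed.

Lemma two_pow_elt_surj y : exists x, two_pow_elt x = y.
Proof.
case: y => x g; have [phi <-] := W_elt_surj hs half_vertex_cover half_vertex_inj
  half_vertex_opp x.
have ig : index g l < size l by rewrite index_mem.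
by exists (phi, Ordinal ig); rewrite /two_pow_elt /= nth_index.
Qed.

(** Right multiplication by [rho0] exchanges the halving group with its
    complement, so it contains half of the [1152 * (2 * s) ^ 12] elements. *)
Lemma halving_order_enum : gen (range r) #= `I_(576 * (2 * s) ^ 12)%N.
Proof.
have /choice[g gK] := two_pow_elt_surj.
pose A := [set x | `[< gen (range r) (two_pow_elt x) >]]%SET.
pose h x := g (two_pow_elt x * rho0 P s).
have hE x : two_pow_elt (h x) = two_pow_elt x * rho0 P s by rewrite /h gK.
have hK : involutive h.
  by move=> x; apply: two_pow_elt_inj; rewrite !hE -mulgA rho0_sq mulg1.
have hA : h @^-1: A = (~: A)%SET.
  apply/setP => x; rewrite !inE hE; apply/asboolP/idP.
    by move=> hx; apply/asboolP => /halving_index2; apply.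
  by move/asboolPn => nx; apply: contrapT => nr; apply: nx; apply/halving_index2.
have cA : #|A| = (576 * (2 * s) ^ 12)%N.
  have := cardsC A; rewrite -hA card_preimset; last exact: inv_inj.
  move: #|A| => c; rewrite card_prod card_ffun !card_ord sl.
  have -> : #|{: gon s}| = (2 * s)%N by rewrite card_prod card_bool card_ord Zp_cast //
    mulnC.
  by move: (_ ^ _)%N => X; lia.
rewrite -cA; apply/card_set_bijP; exists (fun y => index (g y) (enum A)); split.
- move=> y Hy; rewrite /= cardE index_mem mem_enum inE gK; exact/asboolP.
- move=> y y' /set_mem Hy /set_mem Hy' e.
  have gA z : gen (range r) z -> g z \in enum A by move=> Hz; rewrite mem_enum inE gK;
    apply/asboolP.
  by rewrite -(gK y) -(gK y') -(nth_index (g y) (gA _ Hy)) e nth_index ?gA.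
move=> m /=; rewrite cardE => mA.
have x0 : {ffun 'I_12 -> gon s} * 'I_(size l) by case: (enum A) mA.
have := mem_nth x0 mA; rewrite mem_enum inE => /asboolP Hm.
exists (two_pow_elt (nth x0 (enum A) m)) => //.
have -> : g (two_pow_elt (nth x0 (enum A) m)) = nth x0 (enum A) m.
  by apply: two_pow_elt_inj; rewrite gK.
by rewrite index_uniq // enum_uniq.
Qed.

End Enumeration.

Theorem halving_order : gen (range r) #= `I_(576 * (2 * s) ^ 12)%N.
Proof. by have [l [ul sl lg]] := group_343_enum;
  apply: (halving_order_enum ul sl lg). Qed.

End Halving24.

Theorem proposition4p6 (s : nat) (hs : (2 <= s)%N) (P : cs_polytope 3)
    (hP : is_24cell P) :
  let r := halving_gen (two_pow_gen P s) in
  let H := gen (range r) in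
  [/\ regular_hypertope (coset_system H (parabolic r)),
      automorphism_group_is H (parabolic r),
      H #= `I_(576 * (2 * s) ^ 12)%N,
      presented_by r (halving_relator s)
    & toroidal_residue_is_400 r].
Proof.
move=> r H.
have inv i : r i ^+ 2 = 1 by apply: halving_gen_sq.
have ne1 i : r i <> 1 by apply: halving_gen_neq1.
have helly : coset_helly r := halving_helly hs.
have meets : parabolic_intersections r := halving_meets hs.
split.
- exact: coset_system_hypertope.
- exact: coset_system_automorphisms.
- exact: halving_order.
- exact: halving_presentation.
exact: toroidal_residue.
Qed.
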